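(* Put $w(z,\tau)=\pi^{-2}\wp(z;\tau)$ and $$E_{2,6}^{(0)}(\tau)=-3w(\tau,2\tau),\quad E_{2,6}^{(1)}(\tau)=-\frac14\left(w(\tau,2\tau)-w(\tau,3\tau)\right),\quad E_{2,6}^{(2)}(\tau)=\Delta_6(\tau)=\frac{\eta(\tau)^2\eta(6\tau)^{12}}{\eta(2\tau)^4\eta(3\tau)^6},$$ and $$E_{4,6}^{(1)}=E_{2,6}^{(0)}E_{2,6}^{(1)},\quad E_{4,6}^{(2)}=E_{2,6}^{(0)}E_{2,6}^{(2)},\quad E_{4,6}^{(3)}=E_{2,6}^{(1)}E_{2,6}^{(2)},\quad E_{4,6}^{(4)}=[E_{2,6}^{(2)}]^2.$$ The space $S_4(\Gamma_0(6))$ is one-dimensional and its unitary generator is $$F_{4,6}^{(1)}=E_{4,6}^{(1)}-25E_{4,6}^{(2)}+540E_{4,6}^{(3)}+864E_{4,6}^{(4)}.$$ For every integer $k\ge2$ and every unitary upper triangular basis $\mathcal{B}_{2k-4}$ of $M_{2k-4}(\Gamma_0(6))$, the family $F_{4,6}^{(1)}\cdot\mathcal{B}_{2k-4}$ is a unitary upper triangular basis of $S_{2k}(\Gamma_0(6))$.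
   Context: $\tau$ is in the upper half-plane, $q=e^{2i\pi\tau}$, $\eta$ is Dedekind's eta function, and $\wp(z;\tau)$ is the Weierstrass $\wp$-function in $z$ of the lattice $\mathbb{Z}+\tau\mathbb{Z}$. $M_{2k}(\Gamma_0(N))$, $S_{2k}(\Gamma_0(N))$ are the spaces of modular and cusp forms of weight $2k$, with $M_0=\mathbb{C}$. The valuation of a nonzero form is its order in $q$ at $\infty$; a form is unitary if its leading $q$-coefficient is $1$; a family is unitary upper triangular if all members are unitary and their valuations are strictly increasing. $F\cdot(b_i)$ denotes $(Fb_i)$. *)

(* Defs.v *)
From HB Require Import structures.
From mathcomp Require Import all_boot all_order all_algebra.
From mathcomp Require Import complex.
From mathcomp Require Import all_classical all_reals all_analysis.
From mathcomp Require Import ring.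
From mathcomp.analysis.showcase Require summability.
Set Implicit Arguments.
Unset Strict Implicit.
Unset Printing Implicit Defensive.
Import Order.TTheory GRing.Theory Num.Theory.
Import numFieldNormedType.Exports.
Local Open Scope classical_set_scope.
Local Open Scope ring_scope.

(* R[i] does not itself carry a topology; as a numClosedFieldType it gets the
   one defined by its modulus.
   Pitfall: Num's generic constant 'i is only some square root of -1, so the
   imaginary unit below is always Complex 0 1. *)
Definition Cx (R : realType) : numClosedFieldType := R[i].

Definition upper_half (R : realType) := {z : Cx R | 0 < complex.Im z}.

Section ComplexFunctions.
Variable R : realType.
Local Notation C := (Cx R).

Definition cexp (z : C) : C :=
  Complex (expR (complex.Re z) * cos (complex.Im z))
          (expR (complex.Re z) * sin (complex.Im z)).

Definition piC : C := Complex pi 0.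

Definition iC : C := Complex 0 1.

Definition e2ipi (z : C) : C := cexp (2 * iC * piC * z).

Definition eta (t : C) : C :=
  e2ipi (t / 24) *
  lim ((fun m => \prod_(1 <= n < m.+1) (1 - e2ipi t ^+ n)) @ \oo).

(* The sum over the nonzero periods is the unordered (absolutely convergent)
   one; the origin contributes 0. *)
Definition weierstrass_p (z t : C) : C :=
  z ^- 2 +
  summability.sum (fun p : int * int =>
    let w := p.1%:~R + p.2%:~R * t in
    if p == (0, 0) then 0 else (z - w) ^- 2 - w ^- 2).

End ComplexFunctions.

Section ModularForms.
Variable R : realType.
Local Notation C := (Cx R).
Local Notation H := (upper_half R).

(* Near t the point z lies in the upper half-plane, so insubd t z is z. *)
Definition holomorphic (f : H -> C) :=
  forall t : H, derivable (fun z : C => f (insubd t z)) (val t) 1.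

Definition SL2Z : set 'M[int]_2 := [set g | \det g = 1].

Definition Gamma0 (N : nat) : set 'M[int]_2 :=
  [set g | SL2Z g /\ (N %| g 1%R 0%R)%Z].

Definition autj (g : 'M[int]_2) (t : H) : C :=
  (g 1 0)%:~R * val t + (g 1 1)%:~R.

(* The default value t is never used when g is in SL2Z, see val_mobius. *)
Definition mobius (g : 'M[int]_2) (t : H) : H :=
  insubd t (((g 0 0)%:~R * val t + (g 0 1)%:~R) / autj g t).

Definition slash (w : nat) (g : 'M[int]_2) (f : H -> C) : H -> C :=
  fun t => autj g t ^- w * f (mobius g t).

(* f = \sum_n (a n) q_h^n on the upper half-plane, q_h = exp (2 i pi t / h). *)
Definition fourier_expansion (h : nat) (f : H -> C) (a : nat -> C) :=
  forall t : H,
    series (fun n => a n * e2ipi (val t / h%:R) ^+ n) @ \oo --> f t.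

(* Every f|g, g in SL2Z, is N-periodic, because Gamma0 N contains the normal
   subgroup Gamma(N) of SL2Z; hence q_N serves at all cusps. *)
Definition modular_form (w N : nat) : set (H -> C) :=
  [set f | [/\ holomorphic f,
    forall g, Gamma0 N g -> slash w g f = f &
    forall g, SL2Z g -> exists a, fourier_expansion N (slash w g f) a]].

Definition cusp_form (w N : nat) : set (H -> C) :=
  [set f | modular_form w N f /\
    forall g, SL2Z g ->
      exists a, fourier_expansion N (slash w g f) a /\ a 0%N = 0].

Definition has_valuation (f : H -> C) (v : nat) :=
  exists a, [/\ fourier_expansion 1 f a, a v != 0 &
                forall m, (m < v)%N -> a m = 0].

Definition unitary (f : H -> C) :=
  exists a v, [/\ fourier_expansion 1 f a, a v = 1 &
                  forall m, (m < v)%N -> a m = 0].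

Definition unitary_upper_triangular (n : nat) (b : 'I_n -> H -> C) :=
  (forall i, unitary (b i)) /\
  exists v : 'I_n -> nat,
    (forall i, has_valuation (b i) (v i)) /\
    {homo v : i j / (i < j)%N >-> (i < j)%N}.

Definition is_basis (S : set (H -> C)) (n : nat) (b : 'I_n -> H -> C) :=
  [/\ forall i, S (b i),
      forall f, S f -> exists c : 'I_n -> C, f = \sum_i c i *: b i &
      forall c : 'I_n -> C, \sum_i c i *: b i = 0 -> forall i, c i = 0].

Definition has_dimension (S : set (H -> C)) (n : nat) :=
  exists b : 'I_n -> H -> C, is_basis S b.

Lemma val_mobius (g : 'M[int]_2) (t : H) : SL2Z g ->
  val (mobius g t) = ((g 0 0)%:~R * val t + (g 0 1)%:~R) / autj g t.
Proof.
rewrite /SL2Z /= => detg; rewrite /mobius insubdK // unfold_in /autj.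
have intC (m : int) : m%:~R = Complex (m%:~R : R) 0 :> C.
  by rewrite -[RHS]/(real_complex R m%:~R) rmorph_int.
have {detg} : g 0 0 * g 1 1 - g 0 1 * g 1 0 = 1.
  rewrite -detg (expand_det_row _ 0) !big_ord_recl big_ord0 /cofactor !det_mx11.
  rewrite !mxE /= !expr0 !expr1 !mul1r addr0 mulN1r mulrN.
  by congr (g _ _ * g _ _ - g _ _ * g _ _); apply: val_inj.
move: (g 0 0) (g 0 1) (g 1 0) (g 1 1) => a b c d detg.
case: t => -[x y] /= y_gt0.
have detR : (a%:~R * d%:~R - b%:~R * c%:~R : R) = 1.
  by rewrite -!intrM -intrB detg.
rewrite !intC; clear detg.
move: (a%:~R) (b%:~R) (c%:~R) (d%:~R) detR => {}a {}b {}c {}d detR.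
rewrite /= !mul0r !subr0 !addr0.
set n := _ ^+ 2 + _ ^+ 2.
have n_gt0 : 0 < n.
  rewrite lt_def addr_ge0 ?sqr_ge0 // andbT paddr_eq0 ?sqr_ge0 // !sqrf_eq0.
  apply/negP => /andP[/eqP cxd0]; rewrite mulf_eq0 (gt_eqF y_gt0) orbF => /eqP c0.
  move: cxd0; rewrite c0 mul0r add0r => d0.
  by move: detR; rewrite c0 d0 !mulr0 subrr => /esym/eqP; rewrite oner_eq0.
suff -> : (a * x + b) * - (c * y / n) + a * y * ((c * x + d) / n) =
    y * (a * d - b * c) / n by rewrite detR mulr1 divr_gt0.
by ring.
Qed.

End ModularForms.

Section Level6.
Variable R : realType.
Local Notation C := (Cx R).
Local Notation H := (upper_half R).

Definition w (z t : C) : C := piC R ^- 2 * weierstrass_p z t.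

Definition E26_0 (t : H) : C := - 3 * w (val t) (2 * val t).

Definition E26_1 (t : H) : C :=
  - (1 / 4) * (w (val t) (2 * val t) - w (val t) (3 * val t)).

Definition E26_2 (t : H) : C :=
  eta (val t) ^+ 2 * eta (6 * val t) ^+ 12 /
  (eta (2 * val t) ^+ 4 * eta (3 * val t) ^+ 6).

Definition E46_1 (t : H) : C := E26_0 t * E26_1 t.
Definition E46_2 (t : H) : C := E26_0 t * E26_2 t.
Definition E46_3 (t : H) : C := E26_1 t * E26_2 t.
Definition E46_4 (t : H) : C := E26_2 t ^+ 2.

Definition F46_1 (t : H) : C :=
  E46_1 t - 25 * E46_2 t + 540 * E46_3 t + 864 * E46_4 t.

End Level6.

Arguments F46_1 : clear implicits.

(* Main.v *)
Require Import Defs.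
From mathcomp Require Import all_boot all_order all_algebra.
From mathcomp Require Import complex finmap.
From mathcomp Require Import all_classical all_reals all_analysis.
From mathcomp Require Import ring lra zify.
From mathcomp.analysis.showcase Require summability.
Set Implicit Arguments.
Unset Strict Implicit.
Unset Printing Implicit Defensive.
Import Order.TTheory GRing.Theory Num.Theory.
Import numFieldNormedType.Exports.
Local Open Scope classical_set_scope.
Local Open Scope ring_scope.

(* The space S_4 is cut out by one cusp form F, and everything follows once F is
   known to vanish nowhere on the upper half-plane: then G -> G/F maps S_2k into
   M_(2k-4).

   The p-values at division points are combinations of the E_2(d t), by summing
   rows of the lattice with the Lipschitz formula.  The quasimodularity of E_2 comes
   from the same row sums: the defect t^-2 E_2(-1/t) - E_2(t) is divided by 2 when
   t is doubled, so its value is the limit of Riemann sums of an elementary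
   integral.  As Delta is the solution of Delta' = 2 pi i E_2 Delta, this gives
   Delta(-1/t) = t^12 Delta(t); a Hermite normal form computation then gives the
   behaviour of E_2(d t) and Delta(d t) at all cusps.

   There are no forms of negative weight: the invariant |f| (Im t)^(-12) is bounded,
   and Cauchy's estimate is used as Im t -> 0.  Dividing by eta quotients of known
   orders, M_0 consists of constants.  Applied to E^12 / Delta_6^12, where E is a
   combination of the E_2(d t), this gives Delta_6 = E, hence the constant terms
   of F at the cusps, all zero; applied to F^12 / (Delta(t) Delta(2t) Delta(3t)
   Delta(6t)), it shows that F has no zeros.  A cusp form has order at least
   gcd(c, 6) in q_6 at the cusp of lower left entry c, as has F exactly, so that
   G/F is holomorphic at the cusps. *)

(** * Modulus and limits of sequences *)

(** No contour integral and no valence formula enters. The definition of a modular form provides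
    expansions in e(t/6) at every cusp, so the analysis takes place on power series converging
    absolutely in the unit disc: derivatives are termwise, and Cauchy's estimate comes from finite
    averages. Zero counting is replaced by one device: a quotient is shown to be holomorphic of
    weight 0 at all four cusps, hence constant. Its denominator must be free of zeros and of known
    orders, that is, a product of Delta(d t) for d dividing 6. The eta quotients in play become such
    products only after a twelfth power, which also removes their multipliers; hence the exponents
    12, and the comparison of twelfth roots through leading coefficients. Weight 0 is reduced to
    weight -24 because Delta_6^12 has weight 24 and vanishes only at infinity. Behind the use of
    F^12 is the classical identity F = (eta(t) eta(2t) eta(3t) eta(6t))^2, of which the twelfth
    power up to a constant suffices. *)

Definition cabs (R : realType) (z : Cx R) : R := ComplexField.Normc.normc z.
Arguments cabs : simpl never.
Definition rC (R : realType) (x : R) : Cx R := Complex x 0.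

Section Modulus.
Variable R : realType.
Local Notation C := (Cx R).
Implicit Types (z w : C) (x y : R).

(** The norm of [C] takes values in [C] itself; estimates are made with the real-valued [cabs]. *)
Lemma cabsE z : `|z| = rC (cabs z).
Proof. by case: z => a b; rewrite normc_def. Qed.

Lemma rCE x : rC x = real_complex R x. Proof. by []. Qed.
Lemma rCD x y : rC (x + y) = rC x + rC y. Proof. by rewrite !rCE rmorphD. Qed.
Lemma rCB x y : rC (x - y) = rC x - rC y. Proof. by rewrite !rCE rmorphB. Qed.
Lemma rCM x y : rC (x * y) = rC x * rC y. Proof. by rewrite !rCE rmorphM. Qed.
Lemma rC1 : rC 1 = 1 :> C. Proof. by []. Qed.
Lemma rC0 : rC 0 = 0 :> C. Proof. by []. Qed.
Lemma rCV x : rC x^-1 = (rC x)^-1. Proof. by rewrite !rCE fmorphV. Qed.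
Lemma rC_nat n : rC (n%:R : R) = n%:R. Proof. by rewrite !rCE rmorph_nat. Qed.
Lemma rC_int (n : int) : rC (n%:~R : R) = n%:~R. Proof. by rewrite !rCE rmorph_int. Qed.
Lemma rC_le x y : (rC x <= rC y :> C) = (x <= y). Proof. exact: lecR. Qed.
Lemma rC_lt x y : (rC x < rC y :> C) = (x < y). Proof. exact: ltcR. Qed.

Lemma cabs_ge0 z : 0 <= cabs z. Proof. by rewrite -rC_le -cabsE normr_ge0. Qed.
Lemma cabs0 : cabs (0 : C) = 0. Proof. exact: ComplexField.Normc.normc0. Qed.
Lemma cabs1 : cabs (1 : C) = 1. Proof. exact: ComplexField.Normc.normc1. Qed.
Lemma cabsM z w : cabs (z * w) = cabs z * cabs w.
Proof. exact: ComplexField.Normc.normcM. Qed.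
Lemma cabsV z : cabs z^-1 = (cabs z)^-1. Proof. exact: ComplexField.Normc.normcV. Qed.
Lemma cabsX z n : cabs (z ^+ n) = cabs z ^+ n.
Proof. by elim: n => [|n IH]; rewrite ?cabs1 // !exprS cabsM IH. Qed.
Lemma cabs_add z w : cabs (z + w) <= cabs z + cabs w. Proof. exact: le_normcD. Qed.
Lemma cabsN z : cabs (- z) = cabs z. Proof. exact: normcN. Qed.
Lemma cabsB z w : cabs (z - w) = cabs (w - z). Proof. by rewrite -cabsN opprB. Qed.
Lemma cabs_eq0 z : (cabs z == 0) = (z == 0).
Proof.
apply/eqP/eqP => [|->]; last exact: cabs0.
exact: ComplexField.Normc.eq0_normc.
Qed.
Lemma cabs_gt0 z : (0 < cabs z) = (z != 0).
Proof. by rewrite lt_def cabs_eq0 cabs_ge0 andbT. Qed.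
Lemma cabs_rC x : cabs (rC x) = `|x|.
Proof. by rewrite /cabs /= expr0n /= addr0 sqrtr_sqr. Qed.
Lemma cabs_nat n : cabs (n%:R : C) = n%:R.
Proof. by rewrite -rC_nat cabs_rC ger0_norm. Qed.
Lemma cabs_sub z w : cabs z - cabs w <= cabs (z - w).
Proof. by rewrite lerBlDr; have := cabs_add (z - w) w; rewrite subrK. Qed.
Lemma cabs_tri z w v : cabs (z - v) <= cabs (z - w) + cabs (w - v).
Proof. by have := cabs_add (z - w) (w - v); rewrite addrA subrK. Qed.
Lemma cabs_sqr z : cabs z ^+ 2 = complex.Re z ^+ 2 + complex.Im z ^+ 2.
Proof. by case: z => a b; rewrite sqr_sqrtr // addr_ge0 ?sqr_ge0. Qed.
Lemma ler_sqr_abs x y : 0 <= y -> x ^+ 2 <= y ^+ 2 -> `|x| <= y.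
Proof. by move=> y0; rewrite -(@real_normK _ x) ?num_real // ler_sqr ?nnegrE. Qed.
Lemma abs_Re z : `|complex.Re z| <= cabs z.
Proof. by apply: ler_sqr_abs; rewrite ?cabs_ge0 // cabs_sqr lerDl sqr_ge0. Qed.
Lemma abs_Im z : `|complex.Im z| <= cabs z.
Proof. by apply: ler_sqr_abs; rewrite ?cabs_ge0 // cabs_sqr lerDr sqr_ge0. Qed.
Lemma cabs_le_ReIm z : cabs z <= `|complex.Re z| + `|complex.Im z|.
Proof.
rewrite -(@ler_pXn2r _ 2) ?nnegrE ?addr_ge0 ?cabs_ge0 //.
rewrite cabs_sqr sqrrD -!normrX !(ger0_norm (sqr_ge0 _)).
by rewrite lerD2r lerDl mulrn_wge0 // mulr_ge0.
Qed.
Lemma cabs_sum (I : Type) (r : seq I) (P : pred I) (f : I -> C) :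
  cabs (\sum_(i <- r | P i) f i) <= \sum_(i <- r | P i) cabs (f i).
Proof.
elim/big_ind2: _ => [|z x w y zx wy|//]; first by rewrite cabs0.
by apply: le_trans (cabs_add _ _) _; apply: lerD.
Qed.
Lemma cabs_inf_eq0 z : (forall e : R, 0 < e -> cabs z < e) -> z = 0.
Proof.
move=> H; apply/eqP; rewrite -cabs_eq0; apply/negPn/negP => z0.
have zp : 0 < cabs z by rewrite lt_def z0 cabs_ge0.
by have := H _ zp; rewrite ltxx.
Qed.
Lemma ReD z w : complex.Re (z + w) = complex.Re z + complex.Re w.
Proof. by case: z w => [? ?] [? ?]. Qed.
Lemma ImD z w : complex.Im (z + w) = complex.Im z + complex.Im w.
Proof. by case: z w => [? ?] [? ?]. Qed.
Lemma Re_sum (I : Type) (r : seq I) (f : I -> C) :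
  complex.Re (\sum_(i <- r) f i) = \sum_(i <- r) complex.Re (f i).
Proof. by elim/big_rec2: _ => // i x y _ <-; rewrite ReD. Qed.
Lemma Im_sum (I : Type) (r : seq I) (f : I -> C) :
  complex.Im (\sum_(i <- r) f i) = \sum_(i <- r) complex.Im (f i).
Proof. by elim/big_rec2: _ => // i x y _ <-; rewrite ImD. Qed.

Lemma cvgC (T : Type) (F : set_system T) (FF : Filter F) (f : T -> C) (l : C) :
  f @ F --> l <-> forall e : R, 0 < e -> \forall x \near F, cabs (f x - l) < e.
Proof.
split.
  move=> /cvgrPdist_lt H e e0; have := H (rC e); rewrite -[0]rC0 rC_lt => /(_ e0).
  by apply: filterS => x; rewrite cabsE rC_lt cabsB.
move=> H; apply/cvgrPdist_lt => e e0.
(* The order of [C] only compares numbers of equal imaginary part, so a positive [e] is real. *)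
have -> : e = rC (complex.Re e) by move: e0; case: e => a b; rewrite ltcE /= => /andP[/eqP -> _].
have {}e0 : 0 < complex.Re e by move: e0; case: e => a b; rewrite ltcE /= => /andP[].
by apply: filterS (H _ e0) => x; rewrite cabsE rC_lt cabsB.
Qed.

End Modulus.

Definition ctends (R : realType) (u : nat -> Cx R) (l : Cx R) :=
  forall e : R, 0 < e -> exists N, forall n, (N <= n)%N -> cabs (u n - l) < e.

Section Tends.
Variable R : realType.
Local Notation C := (Cx R).
Implicit Types (u v : nat -> C) (k l : C).

Lemma ctendsP u l : ctends u l <-> u @ \oo --> l.
Proof.
split=> [H|/cvgC H e e0].
  by apply/cvgC => e /H [N NH]; exists N.
by have [N _ NH] := H _ e0; exists N.
Qed.

Lemma ctends_uniq u k l : ctends u k -> ctends u l -> k = l.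
Proof.
move=> uk ul; apply/eqP; rewrite -subr_eq0; apply/eqP/cabs_inf_eq0 => e e0.
have [N NH] := uk _ (divr_gt0 e0 (ltr0n _ 2)).
have [M MH] := ul _ (divr_gt0 e0 (ltr0n _ 2)).
have := NH _ (leq_maxl N M); have := MH _ (leq_maxr N M).
have := cabs_tri k (u (maxn N M)) l; rewrite (cabsB k (u _)) => *; lra.
Qed.

Lemma ctends_cst k : ctends (fun=> k) k.
Proof. by move=> e e0; exists 0%N => n _; rewrite subrr cabs0. Qed.

Lemma ctends_ext u v l : (exists N, forall n, (N <= n)%N -> u n = v n) ->
  ctends u l -> ctends v l.
Proof.
move=> [M MH] ul e e0; have [N NH] := ul _ e0; exists (maxn N M) => n.
by rewrite geq_max => /andP[? ?]; rewrite -MH // NH.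
Qed.

Lemma ctends_add u v k l :
  ctends u k -> ctends v l -> ctends (fun n => u n + v n) (k + l).
Proof. move=> /ctendsP uk /ctendsP vl; apply/ctendsP.
exact: (@cvgD _ _ _ _ _ _ _ _ _ uk vl). Qed.

Lemma ctends_mul u v k l :
  ctends u k -> ctends v l -> ctends (fun n => u n * v n) (k * l).
Proof. move=> /ctendsP uk /ctendsP vl; apply/ctendsP.
exact: (@cvgM _  _ _ _ _ _ _ _ uk vl). Qed.

Lemma ctends_scale u k l : ctends u k -> ctends (fun n => l * u n) (l * k).
Proof. exact: ctends_mul (ctends_cst l). Qed.

Lemma ctends_sub u v k l :
  ctends u k -> ctends v l -> ctends (fun n => u n - v n) (k - l).
Proof. move=> /ctendsP uk /ctendsP vl; apply/ctendsP.
exact: (@cvgB _ _ _ _ _ _ _ _ _ uk vl). Qed.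

Lemma ctends_inv u k : k != 0 -> ctends u k -> ctends (fun n => (u n)^-1) k^-1.
Proof. by move=> ? /ctendsP ?; apply/ctendsP; apply: cvgV. Qed.

Lemma ctends_exp u k m : ctends u k -> ctends (fun n => u n ^+ m) (k ^+ m).
Proof.
move=> uk; elim: m => [|m IH]; first exact: ctends_cst.
by under [fun n => _]funext do rewrite exprS; rewrite exprS; apply: ctends_mul.
Qed.

Lemma ctends_shift u l p : ctends u l -> ctends (fun n => u (n + p)%N) l.
Proof. by move=> ul e /ul [N NH]; exists N => n Nn; apply: NH; rewrite (leq_trans Nn) ?leq_addr. Qed.

Lemma ctends_le u l (M : R) : (exists N, forall n, (N <= n)%N -> cabs (u n) <= M) ->
  ctends u l -> cabs l <= M.
Proof.
move=> [N NH] ul; rewrite leNgt; apply/negP => Ml.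
have [K KH] := ul (cabs l - M) ltac:(by rewrite subr_gt0).
have := KH _ (leq_maxr N K); have := NH _ (leq_maxl N K).
have := cabs_sub l (u (maxn N K)); rewrite (cabsB l) => *; lra.
Qed.

Lemma ctends0_le u (b : nat -> R) :
  (exists N, forall n, (N <= n)%N -> cabs (u n) <= b n) ->
  (forall e : R, 0 < e -> exists N, forall n, (N <= n)%N -> b n < e) -> ctends u 0.
Proof.
move=> [N NH] H e /H [M MH]; exists (maxn N M) => n; rewrite geq_max => /andP[Nn Mn].
by rewrite subr0 (le_lt_trans (NH _ Nn)) ?MH.
Qed.

End Tends.

(** * Unordered sums *)

Section HasSum.
Variable R : realType.
Local Notation C := (Cx R).

(** A relation rather than a value: existence and value of a sum are obtained together.
    Duplicate-free lists over an [eqType] play the role of finite sets. *)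
Definition hsum (I : eqType) (f : I -> C) (s : C) :=
  forall e : R, 0 < e -> exists J : seq I, forall K : seq I, uniq K ->
    {subset J <= K} -> cabs (\sum_(i <- K) f i - s) < e.

Definition bsum (I : eqType) (b : I -> R) :=
  (forall i, 0 <= b i) /\
  exists M : R, forall K : seq I, uniq K -> \sum_(i <- K) b i <= M.

Definition asum (I : eqType) (f : I -> C) := bsum (fun i => cabs (f i)).

Lemma le_eps (x y : R) : (forall e : R, 0 < e -> x <= y + e) -> x <= y.
Proof. by move=> H; apply/ler_addgt0Pr => e e0; apply: H. Qed.

Lemma sum_cst_le (I : Type) (K : seq I) (e : R) : 0 < e ->
  \sum_(i <- K) (e / (size K).+1%:R) <= e.
Proof.
move=> e0; rewrite big_const_seq count_predT iter_addr_0 -[leLHS]mulr_natr.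
by rewrite mulrAC ler_pdivrMr ?ltr0n // ler_wpM2l ?ler_nat // ltW.
Qed.

Lemma sum_uniq_sub (V : nmodType) (I : eqType) (J K : seq I) (f : I -> V) :
  uniq J -> uniq K -> {subset J <= K} ->
  \sum_(i <- K) f i = \sum_(i <- J) f i + \sum_(i <- [seq i <- K | i \notin J]) f i.
Proof.
move=> uJ uK sJK; rewrite (bigID (mem J)) /= big_filter; congr (_ + _).
rewrite -big_filter; apply: perm_big; apply: uniq_perm => //; first exact: filter_uniq.
move=> i; rewrite mem_filter /=; have [/sJK ->//|//] := boolP (i \in J).
Qed.

(** [J] is a list whose sum comes within [e] of the supremum, which leaves less than [e] for any
    list disjoint from it. *)
Lemma bsum_tail (I : eqType) (b : I -> R) : bsum b -> forall e : R, 0 < e ->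
  exists2 J : seq I, uniq J & forall K, uniq K -> {in K, forall i, i \notin J} ->
    \sum_(i <- K) b i < e.
Proof.
move=> [b0 [M MH]] e e0.
pose S := [set x : R | exists2 K : seq I, uniq K & x = \sum_(i <- K) b i].
have hS : has_sup S.
  split; first by exists 0, [::] => //; rewrite big_nil.
  by exists M => _ [K uK ->]; apply: MH.
have [_ [J uJ ->] HJ] := sup_adherent e0 hS; exists J => // K uK KJ.
have : \sum_(i <- J ++ K) b i <= sup S.
  apply: ub_le_sup; first by case: hS.
  exists (J ++ K) => //; rewrite cat_uniq uJ uK andbT /=.
  by apply/hasPn => i /KJ.
by rewrite big_cat /=; lra.
Qed.

Lemma bsum_hsum (I : eqType) (b : I -> R) : bsum b -> exists s : R,
  [/\ forall e : R, 0 < e -> exists J : seq I, forall K : seq I, uniq K ->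
    {subset J <= K} -> `|\sum_(i <- K) b i - s| < e,
    0 <= s & forall K, uniq K -> \sum_(i <- K) b i <= s].
Proof.
move=> bb; have [b0 [M MH]] := bb.
pose S := [set x : R | exists2 K : seq I, uniq K & x = \sum_(i <- K) b i].
have hS : has_sup S.
  split; first by exists 0, [::] => //; rewrite big_nil.
  by exists M => _ [K uK ->]; apply: MH.
have ubS K : uniq K -> \sum_(i <- K) b i <= sup S.
  by move=> uK; apply: ub_le_sup; [case: hS|exists K].
exists (sup S); split => //; last by have := ubS [::] isT; rewrite big_nil.
move=> e e0; have [_ [J uJ ->] HJ] := sup_adherent e0 hS; exists J => K uK JK.
rewrite ler0_norm ?subr_le0 ?ubS // opprB.
rewrite (sum_uniq_sub _ uJ uK JK).
have : 0 <= \sum_(i <- [seq i <- K | i \notin J]) b i by apply: sumr_ge0.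
lra.
Qed.

Lemma bsum_le (I : eqType) (b c : I -> R) :
  (forall i, 0 <= b i <= c i) -> bsum c -> bsum b.
Proof.
move=> bc [c0 [M MH]]; split; first by move=> i; have /andP[] := bc i.
by exists M => K uK; apply: le_trans (MH K uK); apply: ler_sum => i _; have /andP[] := bc i.
Qed.

Lemma bsum_add (I : eqType) (b c : I -> R) : bsum b -> bsum c -> bsum (fun i => b i + c i).
Proof.
move=> [b0 [M MH]] [c0 [N NH]]; split; first by move=> i; apply: addr_ge0.
by exists (M + N) => K uK; rewrite big_split lerD ?MH ?NH.
Qed.

Lemma bsum_scale (I : eqType) (b : I -> R) (k : R) : 0 <= k -> bsum b ->
  bsum (fun i => k * b i).
Proof.
move=> k0 [b0 [M MH]]; split; first by move=> i; apply: mulr_ge0.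
by exists (k * M) => K uK; rewrite -mulr_sumr ler_wpM2l ?MH.
Qed.

Lemma bsum_fin (I : eqType) (b : I -> R) (E : seq I) : (forall i, 0 <= b i) ->
  bsum (fun i => if i \in E then 0 else b i) -> bsum b.
Proof.
move=> b0 [_ [M MH]]; split=> //; exists (\sum_(i <- undup E) b i + M) => K uK.
rewrite (bigID (mem E)) /=; apply: lerD.
  rewrite -big_filter (@sum_uniq_sub _ _ [seq x <- K | x \in E] (undup E)) ?filter_uniq ?undup_uniq //.
    by rewrite lerDl sumr_ge0.
  by move=> i; rewrite mem_filter mem_undup => /andP[].
apply: le_trans (MH K uK); rewrite big_mkcond /=; apply: ler_sum => i _.
by case: (i \in E).
Qed.

Lemma bsum_inj (I L : eqType) (b : I -> R) (p : L -> I) : injective p -> bsum b ->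
  bsum (b \o p).
Proof.
move=> pI [b0 [M MH]]; split; first by move=> l /=.
by exists M => K uK; have := MH (map p K); rewrite map_inj_uniq // big_map; apply.
Qed.

Lemma bsum_prod (I L : eqType) (b : I -> R) (c : L -> R) : bsum b -> bsum c ->
  bsum (fun p : I * L => b p.1 * c p.2).
Proof.
move=> [b0 [M MH]] [c0 [N NH]]; split; first by move=> p; apply: mulr_ge0.
exists (M * N) => K uK.
have M0 : 0 <= M by have := MH [::] isT; rewrite big_nil.
set A := undup (map fst K); set B := undup (map snd K).
apply: (@le_trans _ _ (\sum_(i <- A) \sum_(l <- B) b i * c l)).
  have -> : \sum_(i <- A) \sum_(l <- B) b i * c l =
      \sum_(p <- [seq (i, l) | i <- A, l <- B]) b p.1 * c p.2 by rewrite big_allpairs_dep.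
  rewrite (@sum_uniq_sub _ _ K [seq (i, l) | i <- A, l <- B]) //.
  - by rewrite lerDl sumr_ge0 // => p _; apply: mulr_ge0.
  - by apply: allpairs_uniq; rewrite ?undup_uniq // => -[? ?] [? ?].
  move=> [i l] Kil; apply/allpairsP; exists (i, l); rewrite /A /B !mem_undup; split => //=.
    by apply/mapP; exists (i, l).
  by apply/mapP; exists (i, l).
under eq_bigr do rewrite -mulr_sumr; rewrite -mulr_suml.
by apply: ler_pM; rewrite ?sumr_ge0 ?MH ?NH ?undup_uniq.
Qed.

(** A real family g dominated by |f| is the difference of the nonnegative summable families |f| + g
    and |f|; this is applied to real and imaginary parts. *)
Lemma asum_hsum (I : eqType) (f : I -> C) : asum f -> exists s, hsum f s.
Proof.
move=> af.
have pr (g : I -> R) : (forall i, `|g i| <= cabs (f i)) -> exists s : R,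
    forall e : R, 0 < e -> exists J : seq I, forall K : seq I, uniq K ->
    {subset J <= K} -> `|\sum_(i <- K) g i - s| < e.
  move=> gf; have [s1 [H1 _ _]] := bsum_hsum af.
  have [s2 [H2 _ _]] : exists s : R,
  [/\ forall e : R, 0 < e -> exists J : seq I, forall K : seq I, uniq K ->
    {subset J <= K} -> `|\sum_(i <- K) (cabs (f i) + g i) - s| < e,
    0 <= s & forall K, uniq K -> \sum_(i <- K) (cabs (f i) + g i) <= s].
    apply: bsum_hsum; apply: bsum_le (bsum_add af af) => i.
    by move: (gf i); rewrite ler_norml => /andP[? ?]; apply/andP; split; lra.
  exists (s2 - s1) => e e0; have e2 : 0 < e / 2 by lra.
  have [J1 HJ1] := H1 _ e2; have [J2 HJ2] := H2 _ e2; exists (J1 ++ J2) => K uK sK.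
  have sJ1 : {subset J1 <= K} by move=> i iJ; apply: sK; rewrite mem_cat iJ.
  have sJ2 : {subset J2 <= K} by move=> i iJ; apply: sK; rewrite mem_cat iJ orbT.
  have := HJ1 K uK sJ1; have := HJ2 K uK sJ2; rewrite big_split /= !ltr_norml.
  by move=> /andP[? ?] /andP[? ?]; apply/andP; split; lra.
have [s1 H1] := pr (fun i => complex.Re (f i)) (fun i => abs_Re (f i)).
have [s2 H2] := pr (fun i => complex.Im (f i)) (fun i => abs_Im (f i)).
exists (Complex s1 s2) => e e0; have e2 : 0 < e / 2 by lra.
have [J1 HJ1] := H1 _ e2; have [J2 HJ2] := H2 _ e2; exists (J1 ++ J2) => K uK sK.
have sJ1 : {subset J1 <= K} by move=> i iJ; apply: sK; rewrite mem_cat iJ.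
have sJ2 : {subset J2 <= K} by move=> i iJ; apply: sK; rewrite mem_cat iJ orbT.
apply: le_lt_trans (cabs_le_ReIm _) _; rewrite ReD ImD Re_sum Im_sum /=.
by have := HJ1 K uK sJ1; have := HJ2 K uK sJ2; lra.
Qed.

Lemma hsum_uniq (I : eqType) (f : I -> C) s s' : hsum f s -> hsum f s' -> s = s'.
Proof.
move=> H1 H2; apply/eqP; rewrite -subr_eq0; apply/eqP/cabs_inf_eq0 => e e0.
have e2 : 0 < e / 2 by lra.
have [J1 HJ1] := H1 _ e2; have [J2 HJ2] := H2 _ e2.
have := HJ1 (undup (J1 ++ J2)) (undup_uniq _).
have := HJ2 (undup (J1 ++ J2)) (undup_uniq _).
set S := \sum_(i <- _) _ => X1 X2.
have {}X1 : cabs (S - s') < e / 2 by apply: X1 => i iJ; rewrite mem_undup mem_cat iJ orbT.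
have {}X2 : cabs (S - s) < e / 2 by apply: X2 => i iJ; rewrite mem_undup mem_cat iJ.
have := cabs_tri s S s'; rewrite (cabsB s S); lra.
Qed.

Lemma hsum_ext (I : eqType) (f g : I -> C) s : f =1 g -> hsum f s -> hsum g s.
Proof. by move=> /funext ->. Qed.

Lemma hsum_le (I : eqType) (f : I -> C) s (M : R) : hsum f s ->
  (forall K, uniq K -> \sum_(i <- K) cabs (f i) <= M) -> cabs s <= M.
Proof.
move=> H MH; apply: le_eps => e e0; have [J HJ] := H _ e0.
have := HJ (undup J) (undup_uniq _) (fun i => ltac:(by rewrite mem_undup)).
have := MH (undup J) (undup_uniq _); have := cabs_sum (undup J) xpredT f.
set S := \sum_(i <- _) _; have := cabs_sub s S; rewrite cabsB; lra.
Qed.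

Lemma hsum_add (I : eqType) (f g : I -> C) s t : hsum f s -> hsum g t ->
  hsum (fun i => f i + g i) (s + t).
Proof.
move=> H1 H2 e e0; have e2 : 0 < e / 2 by lra.
have [J1 HJ1] := H1 _ e2; have [J2 HJ2] := H2 _ e2; exists (J1 ++ J2) => K uK sK.
have sJ1 : {subset J1 <= K} by move=> i iJ; apply: sK; rewrite mem_cat iJ.
have sJ2 : {subset J2 <= K} by move=> i iJ; apply: sK; rewrite mem_cat iJ orbT.
have := HJ1 K uK sJ1; have := HJ2 K uK sJ2; rewrite big_split /=.
set S := \sum_(i <- _) _; set T := \sum_(i <- _) _.
have := cabs_add (S - t) (T - s).
by rewrite (_ : S - t + (T - s) = T + S - (s + t)); [lra|ring].
Qed.

Lemma hsum_scale (I : eqType) (f : I -> C) s k : hsum f s -> hsum (fun i => k * f i) (k * s).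
Proof.
move=> H e e0; have k1 : 0 < cabs k + 1 by have := cabs_ge0 k; lra.
have [J HJ] := H _ (divr_gt0 e0 k1); exists J => K uK sK.
rewrite -mulr_sumr -mulrBr cabsM.
have := HJ K uK sK; rewrite ltr_pdivlMr // mulrC; apply: le_lt_trans.
by rewrite ler_wpM2r ?cabs_ge0 // lerDl.
Qed.

Lemma hsum_sub (I : eqType) (f g : I -> C) s t : hsum f s -> hsum g t ->
  hsum (fun i => f i - g i) (s - t).
Proof.
move=> H1 H2; have := hsum_add H1 (hsum_scale (-1) H2); rewrite mulN1r.
by apply: hsum_ext => i; rewrite mulN1r.
Qed.

Lemma hsum_seq (I : eqType) (f : I -> C) (J : seq I) : uniq J ->
  (forall i, i \notin J -> f i = 0) -> hsum f (\sum_(i <- J) f i).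
Proof.
move=> uJ f0 e e0; exists J => K uK sK; rewrite (sum_uniq_sub _ uJ uK sK) addrAC subrr add0r.
rewrite big_seq big1 ?cabs0 // => i; rewrite mem_filter => /andP[iJ _]; exact: f0.
Qed.

Lemma hsum0 (I : eqType) : hsum (fun _ : I => 0) 0.
Proof. by have := @hsum_seq I (fun=> 0) [::] isT (fun _ _ => erefl); rewrite big_nil. Qed.

(** The fibres of [p] are finite and listed by [F], so finitely many fibres form a finite set of
    indices, to which convergence of the original sum applies. *)
Lemma hsum_regroup (I L : eqType) (f : I -> C) s (p : I -> L) (F : L -> seq I) :
  (forall l, uniq (F l)) -> (forall i l, (i \in F l) = (p i == l)) -> hsum f s ->
  hsum (fun l => \sum_(i <- F l) f i) s.
Proof.
move=> uF pF H e e0; have [J HJ] := H _ e0; exists (map p J) => K uK sK.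
have -> : \sum_(i <- K) \sum_(i0 <- F i) f i0 = \sum_(i <- flatten (map F K)) f i.
  by rewrite big_flatten big_map.
apply: HJ.
  elim: K uK {sK} => //= l K IH /andP[lK uK]; rewrite cat_uniq uF IH // andbT.
  apply/hasPn => i /flattenP[_ /mapP[l' l'K ->]]; rewrite pF => /eqP pi.
  by apply/negP => /=; rewrite pF pi => /eqP ll'; rewrite -ll' l'K in lK.
move=> i iJ; apply/flattenP; exists (F (p i)); last by rewrite pF.
by apply: map_f; apply: sK; apply: map_f.
Qed.

Lemma hsum_bij (I L : eqType) (f : I -> C) s (p : L -> I) (q : I -> L) :
  cancel p q -> cancel q p -> hsum f s -> hsum (f \o p) s.
Proof.
move=> pK qK H.
have /= := @hsum_regroup I L f s q (fun l => [:: p l]) (fun=> isT) _ H.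
under [fun l => _]funext do rewrite big_seq1.
by apply=> i l; rewrite inE; apply/eqP/eqP => [->|<-].
Qed.

(** Extension by zero along an injection; dilated and shifted power series and residue classes are
    summed this way. *)
Lemma hsum_inj (I L : eqType) (f : I -> C) s (p : L -> I) (q : I -> option L) :
  pcancel p q -> ocancel q p -> (forall i, q i = None -> f i = 0) ->
  hsum (f \o p) s -> hsum f s.
Proof.
move=> pK qK f0 H e e0; have [J HJ] := H _ e0; exists (map p J) => K uK sK.
have -> : \sum_(i <- K) f i = \sum_(l <- pmap q K) (f \o p) l.
  rewrite -(big_map p xpredT f) (pmap_filter qK) big_filter (bigID (fun i => q i : bool)) /=.
  by rewrite [X in _ + X]big1 ?addr0 // => i; case E: (q i) => // _; apply: f0.
apply: HJ; first exact: (pmap_uniq qK).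
by move=> l lJ; rewrite mem_pmap -pK; apply: map_f; apply: sK; apply: map_f.
Qed.

Lemma bsum_nat (b : nat -> R) (M : R) : (forall i, 0 <= b i) ->
  (forall n, \sum_(i < n) b i <= M) -> bsum b.
Proof.
move=> b0 MH; split=> //; exists M => K uK.
pose n := (\max_(i <- K) i).+1.
apply: le_trans (MH n); rewrite -(big_mkord xpredT b) (@sum_uniq_sub _ _ K (index_iota 0 n)) ?iota_uniq //.
  by rewrite lerDl sumr_ge0.
move=> i iK; rewrite mem_index_iota /= ltnS; exact: (@leq_bigmax_seq _ K xpredT id i iK).
Qed.

Lemma bsum_int (b : nat -> R) : bsum b -> bsum (fun m : int => b `|m|%N).
Proof.
move=> [b0 [M MH]]; split=> //; exists (M + M) => K uK.
rewrite (bigID (fun m : int => 0 <= m)) /=; apply: lerD.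
  rewrite -big_filter -(big_map absz xpredT b) MH // map_inj_in_uniq ?filter_uniq //.
  by move=> m n; rewrite !mem_filter => /andP[? _] /andP[? _]; lia.
rewrite -big_filter -(big_map absz xpredT b) MH // map_inj_in_uniq ?filter_uniq //.
by move=> m n; rewrite !mem_filter => /andP[? _] /andP[? _]; lia.
Qed.

Lemma bsum_geom (r : R) : 0 <= r -> r < 1 -> bsum (fun n => r ^+ n).
Proof.
move=> r0 r1; apply: (@bsum_nat _ (1 - r)^-1) => [i|n]; first exact: exprn_ge0.
have d0 : 0 < 1 - r by lra.
rewrite -[leLHS](mulfK (lt0r_neq0 d0)) mulrC -ler_pdivlMl ?invr_gt0 // invrK mulfV ?lt0r_neq0 //.
have -> : (\sum_(i < n) r ^+ i) * (1 - r) = 1 - r ^+ n.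
  by have := subrX1 r n; move: (\sum_(i < n) _) => S E; rewrite mulrC -opprB mulNr -E opprB.
by have := exprn_ge0 n r0; lra.
Qed.

Lemma hsum_series (f : nat -> C) s : hsum f s -> series f @ \oo --> s.
Proof.
move=> H; apply/ctendsP => e e0; have [J HJ] := H _ e0.
exists (\max_(i <- J) i).+1 => n Jn; rewrite /series /=.
apply: HJ; rewrite ?iota_uniq // => i iJ; rewrite mem_index_iota /=.
by apply: leq_trans Jn; rewrite ltnS; apply: (@leq_bigmax_seq _ J xpredT id i iJ).
Qed.

Lemma asum_series (f : nat -> C) s : asum f -> series f @ \oo --> s -> hsum f s.
Proof.
move=> af /ctendsP fs; have [t ft] := asum_hsum af.
by rewrite (ctends_uniq fs (_ : ctends _ t)) //; apply/ctendsP/hsum_series.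
Qed.

Lemma asum_le_hsum (I : eqType) (f : I -> C) (g : I -> R) :
  (forall i, cabs (f i) <= g i) -> bsum g -> asum f.
Proof. by move=> fg; apply: bsum_le => i; rewrite cabs_ge0 fg. Qed.

Lemma hsum_tail (I : eqType) (f : I -> C) s (J : seq I) (e : R) : uniq J -> hsum f s ->
  (forall K, uniq K -> {in K, forall i, i \notin J} -> \sum_(i <- K) cabs (f i) <= e) ->
  cabs (s - \sum_(i <- J) f i) <= e.
Proof.
move=> uJ H He; apply: le_eps => d d0; have [L HL] := H _ d0.
have := HL (undup (J ++ L)) (undup_uniq _) _.
have sL : {subset L <= undup (J ++ L)} by move=> i iL; rewrite mem_undup mem_cat iL orbT.
move=> /(_ sL); rewrite (@sum_uniq_sub _ _ J) ?undup_uniq //; last first.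
  by move=> i iJ; rewrite mem_undup mem_cat iJ.
set K := [seq _ <- _ | _]; set S := \sum_(i <- J) _.
have uK : uniq K by rewrite filter_uniq ?undup_uniq.
have KJ : {in K, forall i, i \notin J} by move=> i; rewrite mem_filter => /andP[].
have := He K uK KJ; have := cabs_sum K xpredT f; set T := \sum_(i <- K) f i.
have := cabs_add (s - (S + T)) T; rewrite (_ : s - (S + T) + T = s - S); last by ring.
rewrite (cabsB s (_ + _)); lra.
Qed.

(** Fubini for absolutely convergent sums. For finitely many rows, a single finite list [D] of
    columns brings every row sum within its share of epsilon. *)
Lemma hsum_sigma (I L : eqType) (f : I * L -> C) s (g : I -> C) : asum f -> hsum f s ->
  (forall i, hsum (fun l => f (i, l)) (g i)) -> hsum g s /\ asum g.
Proof.
move=> af H Hg.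
have fin (K : seq I) (e : R) (B : seq L) : 0 < e -> exists2 D : seq L, uniq D & {subset B <= D} /\
    {in K, forall i, cabs (\sum_(l <- D) f (i, l) - g i) < e}.
  move=> e0; elim: K => [|i K [D uD [BD HD]]].
    by exists (undup B); rewrite ?undup_uniq; split => // l lB; rewrite mem_undup.
  have [J HJ] : exists D : seq L, uniq D /\ {subset B <= D} /\
    {in K, forall i, forall E, uniq E -> {subset D <= E} -> cabs (\sum_(l <- E) f (i, l) - g i) < e}.
    elim: K {D uD BD HD} => [|k K [D [uD [BD HD]]]].
      by exists (undup B); rewrite undup_uniq; split => //; split => // l lB; rewrite mem_undup.
    have [J HJ] := Hg k _ e0; exists (undup (D ++ J)); split; first exact: undup_uniq.
    split; first by move=> l /BD lD; rewrite mem_undup mem_cat lD.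
    move=> j; rewrite inE => /orP[/eqP ->|jK] E uE sE.
      by apply: HJ => // l lJ; apply: sE; rewrite mem_undup mem_cat lJ orbT.
    by apply: HD => // l lJ; apply: sE; rewrite mem_undup mem_cat lJ.
  have [J' HJ'] := Hg i _ e0; case: HJ => uJ [BJ HJ].
  exists (undup (J ++ J')); first exact: undup_uniq.
  split; first by move=> l /BJ lJ; rewrite mem_undup mem_cat lJ.
  move=> j; rewrite inE => /orP[/eqP ->|jK].
    by apply: HJ'; rewrite ?undup_uniq // => l lJ; rewrite mem_undup mem_cat lJ orbT.
  by apply: HJ; rewrite ?undup_uniq // => l lJ; rewrite mem_undup mem_cat lJ.
have uP (K : seq I) (D : seq L) : uniq K -> uniq D -> uniq [seq (i, l) | i <- K, l <- D].
  by move=> uK uD; apply: allpairs_uniq => // -[? ?] [? ?].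
have bnd (K : seq I) (D : seq L) (e : R) : 0 < e ->
    {in K, forall i, cabs (\sum_(l <- D) f (i, l) - g i) < e / (size K).+1%:R} ->
    \sum_(i <- K) cabs (\sum_(l <- D) f (i, l) - g i) <= e.
  move=> e0 H'; apply: (@le_trans _ _ (\sum_(i <- K) (e / (size K).+1%:R))).
    by rewrite big_seq [leRHS]big_seq; apply: ler_sum => i /H' /ltW.
  exact: sum_cst_le.
split.
  move=> e e0; have e2 : 0 < e / 2 by lra.
  have [J HJ] := H _ e2; exists (map fst J) => K uK sK.
  have k0 : 0 < (size K).+1%:R :> R by rewrite ltr0n.
  have [D uD [BD HD]] := fin K _ (map snd J) (divr_gt0 e2 k0).
  have := HJ _ (uP _ _ uK uD) _.
  have sJ : {subset J <= [seq (i, l) | i <- K, l <- D]}.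
    move=> [i l] ilJ; apply/allpairsP; exists (i, l); split => //=.
      by apply: sK; apply/mapP; exists (i, l).
    by apply: BD; apply/mapP; exists (i, l).
  move=> /(_ sJ); rewrite big_allpairs_dep /=.
  have := bnd K D _ e2 HD.
  have := cabs_sum K xpredT (fun i => \sum_(l <- D) f (i, l) - g i).
  rewrite sumrB; set S := \sum_(i <- K) \sum_(l <- D) _; set T := \sum_(i <- K) g i.
  have := cabs_tri T S s; rewrite (cabsB T S); lra.
have [_ [M MH]] := af; split; first by move=> i; apply: cabs_ge0.
exists M => K uK; apply: le_eps => e e0.
have k0 : 0 < (size K).+1%:R :> R by rewrite ltr0n.
have [D uD [_ HD]] := fin K _ [::] (divr_gt0 e0 k0).
have := MH _ (uP _ _ uK uD); rewrite big_allpairs_dep /= => HM.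
have := bnd K D _ e0 HD.
have : \sum_(i <- K) cabs (g i) <= \sum_(i <- K) (\sum_(l <- D) cabs (f (i, l)) +
    cabs (\sum_(l <- D) f (i, l) - g i)).
  apply: ler_sum => i _; have := cabs_sum D xpredT (fun l => f (i, l)).
  set S := \sum_(l <- D) f (i, l); have := cabs_sub (g i) S; rewrite cabsB; lra.
by rewrite big_split /=; lra.
Qed.

Lemma hsum_mul (I L : eqType) (f : I -> C) (g : L -> C) s t :
  asum f -> asum g -> hsum f s -> hsum g t ->
  asum (fun p : I * L => f p.1 * g p.2) /\ hsum (fun p : I * L => f p.1 * g p.2) (s * t).
Proof.
move=> af ag Hf Hg.
have afg : asum (fun p : I * L => f p.1 * g p.2).
  by apply: asum_le_hsum (bsum_prod af ag) => p; rewrite cabsM.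
split=> //; have [u Hu] := asum_hsum afg.
have [] := @hsum_sigma I L (fun p => f p.1 * g p.2) u (fun i => t * f i) afg Hu.
  by move=> i /=; rewrite mulrC; apply: hsum_scale.
by move=> H1 _; rewrite (hsum_uniq H1 (hsum_scale t Hf)) mulrC in Hu.
Qed.

(** Dominated convergence: outside a finite [J] the dominating family is small uniformly in k, and
    on [J] there are finitely many limits. *)
Lemma tannery (I : eqType) (F : nat -> I -> C) (f : I -> C) (b : I -> R) (S : nat -> C) s :
  bsum b -> (forall k i, cabs (F k i) <= b i) ->
  (forall i, ctends (fun k => F k i) (f i)) ->
  (forall k, hsum (F k) (S k)) -> hsum f s -> ctends S s.
Proof.
move=> bb Fb Ff HS Hs e e0.
have fb i : cabs (f i) <= b i by apply: ctends_le (Ff i); exists 0%N.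
have e6 : 0 < e / 6 by lra.
have [J uJ HJ] := bsum_tail bb e6.
have k0 : 0 < (size J).+1%:R :> R by rewrite ltr0n.
have [N HN] : exists N, forall k, (N <= k)%N -> {in J, forall i,
    cabs (F k i - f i) < e / 6 / (size J).+1%:R}.
  move: {1}J (size J) k0 => K m k0; elim: K => [|i K [N HN]]; first by exists 0%N.
  have [M HM] := Ff i _ (divr_gt0 e6 k0); exists (maxn N M) => k.
  rewrite geq_max => /andP[Nk Mk] j; rewrite inE => /orP[/eqP ->|jK]; first exact: HM.
  exact: HN.
exists N => k Nk.
have t1 : cabs (S k - \sum_(i <- J) F k i) <= e / 6.
  apply: hsum_tail (HS k) _ => // K uK KJ; apply: le_trans (ltW (HJ K uK KJ)).
  by apply: ler_sum.
have t2 : cabs (s - \sum_(i <- J) f i) <= e / 6.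
  apply: hsum_tail Hs _ => // K uK KJ; apply: le_trans (ltW (HJ K uK KJ)).
  by apply: ler_sum.
have t3 : cabs (\sum_(i <- J) F k i - \sum_(i <- J) f i) <= e / 6.
  rewrite -sumrB; apply: le_trans (cabs_sum _ _ _) _.
  apply: (@le_trans _ _ (\sum_(i <- J) (e / 6 / (size J).+1%:R))).
    by rewrite big_seq [leRHS]big_seq; apply: ler_sum => i /(HN k Nk) /ltW.
  exact: sum_cst_le.
have := cabs_tri (S k) (\sum_(i <- J) F k i) s.
have := cabs_tri (\sum_(i <- J) F k i) (\sum_(i <- J) f i) s.
rewrite (cabsB s) in t2; lra.
Qed.

Lemma hsum_sum (I : choiceType) (f : I -> C) s : hsum f s -> summability.sum f = s.
Proof.
move=> H; rewrite /summability.sum; apply: cvg_lim => //; first exact: summability.totally_filter.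
have FF : Filter (@summability.totally I) := @summability.totally_filter I.
apply: (proj2 (@cvgC R _ _ FF (summability.partial_sum f) s)) => e e0.
have [J HJ] := H _ e0; exists [fset i | i in J]%fset => //= K sK.
have -> : summability.partial_sum f K = \sum_(i <- K) f i by rewrite big_seq_fsetE.
apply: HJ; first exact: fset_uniq.
by move=> i iJ; apply: (fsubsetP sK); rewrite in_fset.
Qed.

End HasSum.

(** * The exponential function *)

Section RealTrig.
Variable R : realType.
Implicit Types x y a : R.

Lemma ler_cos x y : 0 <= x -> x <= y -> y <= pi -> cos y <= cos x.
Proof.
move=> x0 xy yp; rewrite leNgt ltr_cos ?in_itv /=; first by rewrite -leNgt.
  by apply/andP; split; lra.
by apply/andP; split; lra.
Qed.

Lemma sin_mvt y : exists2 c : R, `|c| <= `|y| & sin y = cos c * y.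
Proof.
wlog y0 : y / 0 <= y => [W|].
  have [/W //|/ltW y0] := leP 0 y; have [|c cy E] := W (- y); first by rewrite oppr_ge0.
  by exists c; [rewrite normrN in cy|move: E; rewrite sinN mulrN => /oppr_inj].
have [|c] := @MVT_segment R sin cos 0 y y0 (fun x _ => is_derive_sin x).
  by apply: continuous_subspaceT; exact: continuous_sin.
rewrite in_itv /= => /andP[c0 cy]; rewrite sin0 !subr0 => E.
by exists c => //; rewrite !ger0_norm.
Qed.

Lemma abs_sin_le y : `|sin y| <= `|y|.
Proof.
have [c _ ->] := sin_mvt y; rewrite normrM -[leRHS]mul1r ler_wpM2r //.
exact: cos_max.
Qed.

Lemma one_sub_cosE y : 1 - cos y = 2 * sin (y / 2) ^+ 2.
Proof.
have {1}-> : y = (y / 2) *+ 2 by rewrite -mulr_natr; field.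
by rewrite cos_mulr2n cos2sin2 -mulr_natr; ring.
Qed.

Lemma one_sub_cos_le y : 0 <= 1 - cos y <= `|y| /\ 1 - cos y <= y ^+ 2.
Proof.
have := abs_sin_le (y / 2); have := sin_max (y / 2); rewrite one_sub_cosE.
rewrite normrM (@ger0_norm _ 2^-1) ?invr_ge0 // -(@real_normK _ (sin _)) ?num_real //.
rewrite -(@real_normK _ y) ?num_real //.
have := normr_ge0 (sin (y / 2)); have := normr_ge0 y.
move: `|sin _| `|y| => s t *; split; first by apply/andP; split; nra.
nra.
Qed.

Lemma abs_sin_sub y : `|sin y - y| <= y ^+ 2.
Proof.
have [c cy ->] := sin_mvt y.
have -> : cos c * y - y = - ((1 - cos c) * y) by ring.
rewrite normrN normrM -(@real_normK _ y) ?num_real // expr2 ler_wpM2r //.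
by have [/andP[c0 cc] _] := one_sub_cos_le c; rewrite ger0_norm // (le_trans cc).
Qed.

Lemma sin_ge a y : 0 <= y -> y <= a -> a <= pi -> cos a * y <= sin y.
Proof.
move=> y0 ya api; have [c cy ->] := sin_mvt y; apply: ler_wpM2r => //.
rewrite -(cos_norm c); apply: ler_cos => //.
by rewrite (le_trans cy) // ger0_norm.
Qed.

Lemma abs_expR_sub1 x : `|expR x - 1| <= `|x| * expR `|x|.
Proof.
have [x0|x0] := leP 0 x.
  rewrite !ger0_norm ?subr_ge0 //; last by have := expR_ge1Dx x; lra.
  have := expR_ge1Dx (- x); have := expRxMexpNx_1 x; have := expR_gt0 x.
  move: (expR x) (expR (- x)) => a b a0 ab H; nra.
have e1 : expR x <= 1 by rewrite expR_le1 ltW.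
rewrite ler0_norm ?subr_le0 // (ltr0_norm x0).
have := expR_ge1Dx x; have := expR_ge1Dx (- x); nra.
Qed.

Lemma expR_quad x : `|expR x - 1 - x| <= x ^+ 2 * expR `|x|.
Proof.
have := expR_ge1Dx x; have := expR_ge1Dx (- x); have := expRxMexpNx_1 x => ab h1 h2.
have H : expR x - 1 - x <= x * (expR x - 1).
  have := expR_gt0 x; move: (expR x) (expR (- x)) ab h1 h2 => a b *; nra.
rewrite ger0_norm; last by lra.
apply: le_trans H _; apply: le_trans (ler_norm _) _.
rewrite normrM -(@real_normK _ x) ?num_real // expr2 -mulrA ler_wpM2l //.
exact: abs_expR_sub1.
Qed.

(* The bound is uniform on the three quarters of a period around 0, which is
   what the dyadic averaging needs. *)
Lemma sin_pi_lower : exists2 c : R, 0 < c &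
  forall x, `|x| <= 3 / 4 -> c * x ^+ 2 <= sin (pi * x) ^+ 2.
Proof.
(* For |x| <= 3/4 the half angle pi x / 2 is at most 3 pi / 8 < pi / 2, so its cosine is at least
   [k]; this bounds both factors of sin (pi x) = 2 sin cos. *)
pose k : R := cos (pi * (3 / 8)).
have p0 := pi_gt0 R.
have k0 : 0 < k by apply: cos_gt0_pihalf; apply/andP; split; lra.
exists ((k ^+ 2 * pi) ^+ 2); first by rewrite exprn_gt0 // mulr_gt0 // exprn_gt0.
move=> x; wlog x0 : x / 0 <= x => [W|] xb.
  have [x0|/ltW x0] := leP 0 x; first exact: W.
  by have := W (- x); rewrite oppr_ge0 normrN mulrN sinN !sqrrN; apply.
rewrite ger0_norm // in xb; rewrite -exprMn lerXn2r ?nnegrE //.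
- by rewrite mulr_ge0 // mulr_ge0 ?sqr_ge0 // ltW.
- by apply: sin_ge0_pi; apply/andP; split; nra.
have -> : pi * x = (pi * x / 2) *+ 2 by rewrite -mulr_natr; field.
rewrite sin_mulr2n -mulr_natr.
have h0 : 0 <= pi * x / 2 by rewrite divr_ge0 // mulr_ge0 // ltW.
have h1 : pi * x / 2 <= pi * (3 / 8) by nra.
have s1 : k * (pi * x / 2) <= sin (pi * x / 2) by apply: sin_ge => //; nra.
have s2 : k <= cos (pi * x / 2) by apply: ler_cos => //; nra.
have s3 : 0 <= k * (pi * x / 2) by rewrite mulr_ge0 // ltW.
have s4 : k * (k * (pi * x / 2)) <= cos (pi * x / 2) * sin (pi * x / 2).
  by apply: ler_pM => //; rewrite ltW.
apply: (@le_trans _ _ (k * (k * (pi * x / 2)) * 2)); last by rewrite ler_wpM2r.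
by rewrite le_eqVlt; apply/orP; left; apply/eqP; field.
Qed.

End RealTrig.

(** * The complex exponential *)

Section ComplexExp.
Variable R : realType.
Local Notation C := (Cx R).
Local Notation e := (@e2ipi R).
Implicit Types z w s : C.

Lemma cexpD z w : cexp (z + w) = cexp z * cexp w.
Proof.
case: z w => [a b] [c d]; rewrite /cexp /= expRD cosD sinD.
by congr Complex; ring.
Qed.

Lemma cexp0 : cexp (0 : C) = 1.
Proof. by rewrite /cexp /= expR0 cos0 sin0 mulr1 mulr0. Qed.

Lemma cabs_cexp z : cabs (cexp z) = expR (complex.Re z).
Proof.
case: z => a b; rewrite /cexp /cabs /= !exprMn -mulrDr cos2Dsin2 mulr1.
by rewrite sqrtr_sqr ger0_norm ?expR_ge0.
Qed.

(** The constant 4 is crude: real and imaginary parts of the remainder are each at most 2 r^2 exp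
    r. *)
Lemma cexp_quad s : cabs (cexp s - 1 - s) <= 4 * cabs s ^+ 2 * expR (cabs s).
Proof.
have := abs_Re s; have := abs_Im s; have := cabs_ge0 s.
have := cabs_le_ReIm (cexp s - 1 - s); rewrite !ReD !ImD.
case: s => x y; set r := cabs (Complex x y : Cx R) => H r0 yr xr.
apply: le_trans H _ => /=; rewrite subr0.
have er : 1 <= expR r by rewrite -expR0 ler_expR.
have exr : expR `|x| <= expR r by rewrite ler_expR.
have ex : expR x <= expR r by rewrite ler_expR (le_trans (ler_norm x)).
have X1 : `|expR x * cos y - 1 - x| <= expR r * r ^+ 2 + expR r * r ^+ 2.
  have -> : expR x * cos y - 1 - x = (expR x - 1 - x) - expR x * (1 - cos y) by ring.
  apply: le_trans (ler_normB _ _) _; apply: lerD.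
    apply: le_trans (expR_quad x) _; rewrite mulrC; apply: ler_pM => //; rewrite ?expR_ge0 ?sqr_ge0 //.
    by rewrite -(@real_normK _ x) ?num_real // lerXn2r ?nnegrE.
  rewrite normrM; apply: ler_pM => //; first by rewrite ger0_norm ?expR_ge0.
  have [/andP[c0 _] c2] := one_sub_cos_le y; rewrite ger0_norm //.
  by apply: le_trans c2 _; rewrite -(@real_normK _ y) ?num_real // lerXn2r ?nnegrE.
have X2 : `|expR x * sin y - y| <= expR r * r ^+ 2 + expR r * r ^+ 2.
  have -> : expR x * sin y - y = (expR x - 1) * sin y + (sin y - y) by ring.
  apply: le_trans (ler_normD _ _) _; apply: lerD.
    rewrite normrM; apply: (@le_trans _ _ ((r * expR r) * r)); last by rewrite expr2; nra.
    apply: ler_pM => //; last by apply: le_trans (abs_sin_le y) _.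
    by apply: le_trans (abs_expR_sub1 x) _; apply: ler_pM; rewrite ?expR_ge0.
  apply: le_trans (abs_sin_sub y) _; rewrite -[leLHS]mul1r.
  apply: ler_pM => //; rewrite ?sqr_ge0 //.
  by rewrite -(@real_normK _ y) ?num_real // lerXn2r ?nnegrE.
lra.
Qed.

Lemma twopii_neq0 : 2 * iC R * piC R != 0 :> C.
Proof.
rewrite !mulf_neq0 ?pnatr_eq0 //; first by rewrite eq_complex /= eqxx /= oner_eq0.
by rewrite eq_complex /= negb_and gt_eqF ?pi_gt0.
Qed.

Lemma iC2 : iC R ^+ 2 = -1. Proof. exact: sqr_i. Qed.

Lemma e2ipiE z : e z = cexp (Complex (- (2 * pi * complex.Im z)) (2 * pi * complex.Re z)).
Proof.
case: z => x y; rewrite /e2ipi; congr cexp.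
have -> : 2 * iC R * piC R = Complex 0 (2 * pi).
  rewrite -[2 : C]rC_nat /rC /iC /piC; apply/eqP; rewrite eq_complex /=.
  by apply/andP; split; apply/eqP; ring.
by apply/eqP; rewrite eq_complex /=; apply/andP; split; apply/eqP; ring.
Qed.

Lemma eD z w : e (z + w) = e z * e w.
Proof. by rewrite /e2ipi mulrDr cexpD. Qed.
Lemma e0 : e 0 = 1.
Proof. by rewrite /e2ipi mulr0 cexp0. Qed.
Lemma eNM z : e (- z) * e z = 1.
Proof. by rewrite -eD addrC subrr e0. Qed.
Lemma e_neq0 z : e z != 0.
Proof. by apply/eqP => E; have := eNM z; rewrite E mulr0 => /eqP; rewrite eq_sym oner_eq0. Qed.
Lemma eN z : e (- z) = (e z)^-1.
Proof. by apply: (mulIf (e_neq0 z)); rewrite eNM mulVf ?e_neq0. Qed.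
Lemma eX z n : e z ^+ n = e (n%:R * z).
Proof.
elim: n => [|n IH]; first by rewrite mul0r e0.
by rewrite exprS IH -eD mulrSr mulrDl mul1r addrC.
Qed.
Lemma cabs_e z : cabs (e z) = expR (- (2 * pi * complex.Im z)).
Proof. by rewrite e2ipiE cabs_cexp. Qed.

Lemma e1 : e 1 = 1.
Proof.
rewrite e2ipiE /cexp /= !mulr0 oppr0 expR0 !mul1r mulr1.
have -> : 2 * pi = pi *+ 2 :> R by rewrite mulr_natl.
by rewrite cos2pi sin2pi.
Qed.

Lemma e_int (n : int) : e n%:~R = 1.
Proof.
have N m : e m%:R = 1 by rewrite -[m%:R]mulr1 -eX e1 expr1n.
by case: n => n; rewrite ?NegzE ?mulrNz ?eN N ?invr1.
Qed.

Lemma eDint z (n : int) : e (z + n%:~R) = e z.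
Proof. by rewrite eD e_int mulr1. Qed.

Lemma e_half : e (1 / 2) = -1.
Proof.
have -> : 1 / 2 = rC (1 / 2) :> C by rewrite mul1r rCM rC1 mul1r rCV -rC_nat.
rewrite e2ipiE /cexp /= mulr0 oppr0 expR0 !mul1r.
have -> : 2 * pi / 2 = pi :> R by field.
by rewrite cospi sinpi; apply/eqP; rewrite eq_complex /= oppr0 !eqxx.
Qed.

(** The modulus forces Im z = 0; then the fractional part f satisfies sin (pi f) = 0 with 0 <= f <
    1, so f = 0. *)
Lemma e_eq1 z : e z = 1 -> exists n : int, z = n%:~R.
Proof.
move=> ez; have := cabs_e z; rewrite ez cabs1 => E.
have /eqP := @expR_inj R _ _ (etrans (expR0 R) E).
rewrite eq_sym oppr_eq0 mulf_eq0 mulf_eq0 gt_eqF //= gt_eqF ?pi_gt0 //= => /eqP y0.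
have {y0 E}zE : z = rC (complex.Re z) by case: z y0 {ez E} => x y /= ->.
set x := complex.Re z in zE; pose n := Num.floor x; pose f := x - n%:~R.
have /andP[f0 f1] : 0 <= f < 1.
  rewrite /f subr_ge0 ltrBlDl -[1]/(1%:~R) -intrD.
  by rewrite Num.Theory.floor_le_tmp ?num_real // Num.Theory.floorD1_gt ?num_real.
have : e (rC f) = 1.
  by rewrite /f rCB rC_int -zE -mulrNz eDint.
rewrite e2ipiE /cexp /= mulr0 oppr0 expR0 !mul1r => /(congr1 (@complex.Re R)) /= cf.
have := one_sub_cosE (2 * pi * f); rewrite cf subrr => /esym/eqP.
rewrite mulf_eq0 gt_eqF //= sqrf_eq0.
have -> : 2 * pi * f / 2 = pi * f by field.
have p0 := pi_gt0 R.
have [f00|fn0] := eqVneq f 0; last first.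
  have fp : 0 < f by rewrite lt_def fn0 f0.
  by rewrite gt_eqF // sin_gt0_pi // mulr_gt0 //= -[ltRHS]mulr1 ltr_pM2l.
by move=> _; exists n; rewrite zE -rC_int; congr rC; apply/eqP; rewrite -subr_eq0 -/f f00.
Qed.

End ComplexExp.

(** * Power series and q-expansions *)

Section PowerSeries.
Variable R : realType.
Local Notation C := (Cx R).
Local Notation H := (upper_half R).
Local Notation e := (@e2ipi R).
Implicit Types (a b : nat -> C) (f g : H -> C).

(* Radius of convergence at least 1. *)
Definition tame a := forall r : R, 0 <= r -> r < 1 -> exists M : R,
  forall n, cabs (a n) * r ^+ n <= M.

Definition psum a (q : C) : C := summability.sum (fun n => a n * q ^+ n).

(** Comparison with a geometric series of ratio r / s, where s = (1 + r) / 2 is still below 1. *)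
Lemma tame_bsum a (r : R) : tame a -> 0 <= r -> r < 1 ->
  bsum (fun n => cabs (a n) * r ^+ n).
Proof.
move=> ta r0 r1; pose s := (1 + r) / 2.
have s0 : 0 < s by rewrite /s; lra.
have [M HM] := ta s (ltW s0) ltac:(by rewrite /s; lra).
apply: (@bsum_le _ _ _ (fun n => M * (r / s) ^+ n)).
  move=> n; rewrite mulr_ge0 ?cabs_ge0 ?exprn_ge0 //=.
  apply: (@le_trans _ _ ((cabs (a n) * s ^+ n) * (r / s) ^+ n)).
    by rewrite -mulrA -exprMn mulrCA mulfV ?mulr1 // gt_eqF.
  by rewrite ler_wpM2r // exprn_ge0 // divr_ge0 // ltW.
apply: bsum_scale; first by apply: le_trans (HM 0%N); rewrite mulr_ge0 ?cabs_ge0 ?exprn_ge0 // ltW.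
apply: bsum_geom; first by rewrite divr_ge0 // ltW.
by rewrite ltr_pdivrMr // mul1r /s; lra.
Qed.

Lemma psum_asum a (q : C) : tame a -> cabs q < 1 -> asum (fun n => a n * q ^+ n).
Proof.
move=> ta q1; apply: bsum_le (tame_bsum ta (cabs_ge0 q) q1) => n.
by rewrite cabs_ge0 cabsM cabsX lexx.
Qed.

Lemma psumP a (q : C) : tame a -> cabs q < 1 -> hsum (fun n => a n * q ^+ n) (psum a q).
Proof.
move=> ta q1; have [s Hs] := asum_hsum (psum_asum ta q1).
by rewrite /psum (hsum_sum Hs).
Qed.

Lemma tame_le a b : (forall n, cabs (a n) <= cabs (b n)) -> tame b -> tame a.
Proof.
move=> ab tb r r0 r1; have [M HM] := tb r r0 r1; exists M => n.
by apply: le_trans (HM n); rewrite ler_wpM2r // exprn_ge0.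
Qed.

(** Each of the n powers x^i with i < n is at least x^n. *)
Lemma nat_geom_le (x : R) n : 0 <= x -> x < 1 -> n%:R * x ^+ n <= (1 - x)^-1.
Proof.
move=> x0 x1; have d0 : 0 < 1 - x by lra.
apply: (@le_trans _ _ (\sum_(i < n) x ^+ i)).
  rewrite mulr_natl -[n in _ *+ n]card_ord -sumr_const; apply: ler_sum => i _.
  exact: (@ler_wiXn2l _ x x0 (ltW x1) n i (ltnW (ltn_ord i))).
rewrite -[leLHS](mulfK (lt0r_neq0 d0)) mulrC -ler_pdivlMl ?invr_gt0 // invrK mulfV ?lt0r_neq0 //.
have := subrX1 x n; have := exprn_ge0 n x0.
move: (\sum_(i < n) _) => S; lra.
Qed.

Lemma tame_natmul a : tame a -> tame (fun n => n%:R * a n).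
Proof.
move=> ta r r0 r1; pose s := (1 + r) / 2.
have s0 : 0 < s by rewrite /s; lra.
have rs0 : 0 <= r / s by rewrite divr_ge0 // ltW.
have rs1 : r / s < 1 by rewrite ltr_pdivrMr // mul1r /s; lra.
have [M HM] := ta s (ltW s0) ltac:(by rewrite /s; lra).
exists (M * (1 - r / s)^-1) => n; rewrite cabsM cabs_nat.
have -> : n%:R * cabs (a n) * r ^+ n = (cabs (a n) * s ^+ n) * (n%:R * (r / s) ^+ n).
  rewrite [(r / s) ^+ n]exprMn exprVn; have := exprn_gt0 n s0.
    by move: (s ^+ n) (r ^+ n) => S T S0; field; rewrite gt_eqF.
apply: ler_pM; rewrite ?HM ?nat_geom_le //.
  by rewrite mulr_ge0 ?cabs_ge0 ?exprn_ge0 // ltW.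
by rewrite mulr_ge0 ?exprn_ge0.
Qed.

Lemma tame_add a b : tame a -> tame b -> tame (fun n => a n + b n).
Proof.
move=> ta tb r r0 r1; have [M HM] := ta r r0 r1; have [N HN] := tb r r0 r1.
exists (M + N) => n; apply: le_trans (lerD (HM n) (HN n)).
by rewrite -mulrDl ler_wpM2r ?exprn_ge0 // cabs_add.
Qed.

Lemma tame_scale k a : tame a -> tame (fun n => k * a n).
Proof.
move=> ta r r0 r1; have [M HM] := ta r r0 r1; exists (cabs k * M) => n.
by rewrite cabsM -mulrA ler_wpM2l ?cabs_ge0.
Qed.

Lemma tame_poly a (d : nat) : (forall n, (d <= n)%N -> a n = 0) -> tame a.
Proof.
move=> a0 r r0 r1; exists (\sum_(i < d) cabs (a i)) => n.
have [dn|nd] := leqP d n.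
  by rewrite a0 // cabs0 mul0r sumr_ge0 // => i _; apply: cabs_ge0.
rewrite (bigD1 (Ordinal nd)) //=; apply: (@le_trans _ _ (cabs (a n))).
  by rewrite ler_piMr ?cabs_ge0 // exprn_ile1 // ltW.
by rewrite lerDl sumr_ge0 // => i _; apply: cabs_ge0.
Qed.

Definition conv a b n : C := \sum_(i < n.+1) a i * b (n - i)%N.

Lemma tame_conv a b : tame a -> tame b -> tame (conv a b).
Proof.
move=> ta tb r r0 r1.
have [_ [M HM]] := tame_bsum ta r0 r1; have [_ [N HN]] := tame_bsum tb r0 r1.
have M0 : 0 <= M by have := HM [::] isT; rewrite big_nil.
exists (M * N) => n; rewrite /conv.
apply: (@le_trans _ _ (\sum_(i < n.+1) (cabs (a i) * r ^+ i) * N)).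
  apply: (@le_trans _ _ ((\sum_(i < n.+1) cabs (a i * b (n - i)%N)) * r ^+ n)).
    by rewrite ler_wpM2r ?exprn_ge0 ?cabs_sum.
  rewrite mulr_suml; apply: ler_sum => i _.
  have iN : (i <= n)%N by rewrite -ltnS.
  have -> : r ^+ n = r ^+ (n - i) * r ^+ i by rewrite -exprD subnK.
  rewrite cabsM.
  have -> : cabs (a i) * cabs (b (n - i)%N) * (r ^+ (n - i) * r ^+ i) =
     (cabs (a i) * r ^+ i) * (cabs (b (n - i)%N) * r ^+ (n - i)) by ring.
  rewrite ler_wpM2l ?mulr_ge0 ?cabs_ge0 ?exprn_ge0 //.
  by have := HN [:: (n - i)%N] isT; rewrite big_seq1.
rewrite -mulr_suml ler_wpM2r //; first by have := HN [::] isT; rewrite big_nil.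
have := HM (iota 0 n.+1) (iota_uniq _ _).
by have -> : iota 0 n.+1 = index_iota 0 n.+1; rewrite ?big_mkord // /index_iota subn0.
Qed.

(** Cauchy product: the antidiagonals [F n] are the fibres of (i, j) -> i + j in the double sum. *)
Lemma psum_conv a b (q : C) : tame a -> tame b -> cabs q < 1 ->
  psum (conv a b) q = psum a q * psum b q.
Proof.
move=> ta tb q1.
have [_ Hm] := hsum_mul (psum_asum ta q1) (psum_asum tb q1) (psumP ta q1) (psumP tb q1).
pose F n := [seq (i, (n - i)%N) | i <- iota 0 n.+1].
have := @hsum_regroup _ _ _ _ _ (fun p : nat * nat => (p.1 + p.2)%N) F _ _ Hm.
move=> H'; apply: hsum_sum; apply: hsum_ext (H' _ _) => [n|n|[i j] n].
- rewrite /F /conv big_map; have -> : iota 0 n.+1 = index_iota 0 n.+1 by rewrite /index_iota subn0.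
  rewrite big_mkord mulr_suml; apply: eq_bigr => i _ /=.
  have iN : (i <= n)%N by rewrite -ltnS.
  have -> : q ^+ n = q ^+ (n - i) * q ^+ i by rewrite -exprD subnK.
  ring.
- by rewrite map_inj_uniq ?iota_uniq // => i j [].
- apply/mapP/eqP => [[k]|<-].
    by rewrite mem_iota /= => kn [-> ->] /=; rewrite subnKC.
  by exists i; [rewrite mem_iota add0n leq0n ltnS leq_addr|rewrite /= addKn].
Qed.

Lemma psum_add a b (q : C) : tame a -> tame b -> cabs q < 1 ->
  psum (fun n => a n + b n) q = psum a q + psum b q.
Proof.
move=> ta tb q1; apply: hsum_sum.
apply: hsum_ext (hsum_add (psumP ta q1) (psumP tb q1)) => n; by rewrite mulrDl.
Qed.

Lemma psum_scale k a (q : C) : tame a -> cabs q < 1 ->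
  psum (fun n => k * a n) q = k * psum a q.
Proof.
move=> ta q1; apply: hsum_sum.
by apply: hsum_ext (hsum_scale k (psumP ta q1)) => n; rewrite mulrA.
Qed.

Definition cone : nat -> C := fun n => (n == 0)%N%:R.

Lemma tame_cone : tame cone.
Proof. by apply: (@tame_poly _ 1) => -[]. Qed.

Lemma psum_cone (q : C) : psum cone q = 1.
Proof.
apply: hsum_sum; have -> : 1 = \sum_(i <- [:: 0%N]) cone i * q ^+ i.
  by rewrite big_seq1 /cone expr0 mul1r.
by apply: hsum_seq => // -[|n] //; rewrite /cone mul0r.
Qed.

Lemma convC a b : conv a b = conv b a.
Proof.
apply/funext => n; rewrite /conv (reindex_inj rev_ord_inj) /=; apply: eq_bigr => i _.
have iN : (i <= n)%N by rewrite -ltnS.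
by rewrite subSS subKn // mulrC.
Qed.

Lemma conv_cone a : conv a cone = a.
Proof.
apply/funext => n; rewrite /conv big_ord_recr /= subnn /cone mulr1 big1 ?add0r // => i _.
by rewrite subn_eq0 leqNgt ltn_ord mulr0.
Qed.

Lemma cabs_e_lt1 (h : nat) (z : C) : (0 < h)%N -> 0 < complex.Im z -> cabs (e (z / h%:R)) < 1.
Proof.
move=> h0 z0; rewrite cabs_e expR_lt1 oppr_lt0 mulr_gt0 //; first by rewrite mulr_gt0 ?pi_gt0.
have -> : complex.Im (z / h%:R) = complex.Im z / h%:R.
  case: z {z0} => x y; rewrite -rC_nat -rCV /=; ring.
by rewrite divr_gt0 // ltr0n.
Qed.

Definition mkH (z : C) (h : 0 < complex.Im z) : H := exist (fun z : C => is_true (0 < complex.Im z)) z h.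

(** The working form of [fourier_expansion], with the growth of the coefficients recorded and an
    unordered sum; for positive h the two agree by [FX_FE] and [FE_FX]. *)
Definition FX (h : nat) f a := tame a /\ forall t : H, f t = psum a (e (val t / h%:R)).

Lemma FX_hsum h f a t : (0 < h)%N -> FX h f a ->
  hsum (fun n => a n * e (val t / h%:R) ^+ n) (f t).
Proof. by move=> h0 [ta ->]; apply: psumP => //; apply: cabs_e_lt1 => //; apply: valP t. Qed.

Lemma FX_FE h f a : (0 < h)%N -> FX h f a -> fourier_expansion h f a.
Proof. by move=> h0 fa t; apply: hsum_series; apply: FX_hsum. Qed.

(** Ordinary convergence at the point of the imaginary axis where |q| = r makes the terms bounded;
    as r < 1 is arbitrary, the series converges absolutely in the disc. *)
Lemma FE_FX h f a : (0 < h)%N -> fourier_expansion h f a -> FX h f a.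
Proof.
move=> h0 fa.
have ta : tame a.
  move=> r; rewrite le_eqVlt => /orP[/eqP <- _|r0 r1].
    exists (cabs (a 0%N)) => -[|n]; first by rewrite expr0 mulr1.
    by rewrite expr0n /= mulr0 cabs_ge0.
  have [y yr] := expR_total r0.
  have y0 : y < 0 by rewrite -expR_lt1 yr.
  have h0R : 0 < h%:R :> R by rewrite ltr0n.
  have w0 : 0 < complex.Im (Complex 0 (- y * h%:R / (2 * pi)) : C).
    by rewrite /= divr_gt0 ?mulr_gt0 ?pi_gt0 // oppr_gt0.
  pose t : H := mkH w0.
  have qr : cabs (e (val t / h%:R)) = r.
    rewrite -yr cabs_e; congr expR; rewrite /t /= -rC_nat -rCV /=.
    have p0 : pi != 0 :> R by rewrite gt_eqF ?pi_gt0.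
    have h1 : h%:R != 0 :> R by rewrite gt_eqF.
    by move: (pi : R) p0 (h%:R : R) h1 => p p0 m m0; field; rewrite p0 m0.
  have /ctendsP ft := fa t.
  have := ctends_sub (ctends_shift 1 ft) ft; rewrite subrr => /(_ 1 ltr01) [N HN].
  have HN' n : (N <= n)%N -> cabs (a n) * r ^+ n <= 1.
    move=> /HN; rewrite subr0 addn1 seriesSB cabsM cabsX qr; exact: ltW.
  exists (1 + \sum_(i < N) cabs (a i) * r ^+ i) => n.
  have s0 (P : pred 'I_N) : 0 <= \sum_(i < N | P i) cabs (a i) * r ^+ i.
    by rewrite sumr_ge0 // => i _; rewrite mulr_ge0 ?cabs_ge0 ?exprn_ge0 // ltW.
  have [/HN' nN|nN] := leqP N n; first by rewrite (le_trans nN) // lerDl.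
  rewrite (bigD1 (Ordinal nN)) //= addrCA lerDl addr_ge0 //.
split=> // t; apply: esym; apply: hsum_sum; apply: asum_series (fa t).
by apply: psum_asum => //; apply: cabs_e_lt1 => //; apply: valP t.
Qed.

Lemma FX_add h f g a b : (0 < h)%N -> FX h f a -> FX h g b ->
  FX h (fun t => f t + g t) (fun n => a n + b n).
Proof.
move=> h0 [ta fa] [tb gb]; split; first exact: tame_add.
by move=> t; rewrite fa gb psum_add //; apply: cabs_e_lt1 => //; apply: valP t.
Qed.

Lemma FX_scale h f a k : (0 < h)%N -> FX h f a -> FX h (fun t => k * f t) (fun n => k * a n).
Proof.
move=> h0 [ta fa]; split; first exact: tame_scale.
by move=> t; rewrite fa psum_scale //; apply: cabs_e_lt1 => //; apply: valP t.
Qed.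

Lemma FX_mul h f g a b : (0 < h)%N -> FX h f a -> FX h g b ->
  FX h (fun t => f t * g t) (conv a b).
Proof.
move=> h0 [ta fa] [tb gb]; split; first exact: tame_conv.
by move=> t; rewrite fa gb psum_conv //; apply: cabs_e_lt1 => //; apply: valP t.
Qed.

Lemma FX_one h : FX h (fun=> 1) cone.
Proof. by split; [apply: tame_cone|move=> t; rewrite psum_cone]. Qed.

Lemma FX_ext h f g a : f =1 g -> FX h f a -> FX h g a.
Proof. by move=> /funext ->. Qed.

(* The coefficients of the power series a in the variable z * q ^ m. *)
Definition cdil (m : nat) (z : C) a : nat -> C :=
  fun n => if (m %| n)%N then a (n %/ m)%N * z ^+ (n %/ m) else 0.

Lemma tame_cdil m z a : (0 < m)%N -> cabs z = 1 -> tame a -> tame (cdil m z a).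
Proof.
move=> m0 z1 ta r r0 r1.
have [M HM] := ta (r ^+ m) (exprn_ge0 _ r0) ltac:(by rewrite exprn_ilt1 // -lt0n).
have M0 : 0 <= M by apply: le_trans (HM 0%N); rewrite mulr_ge0 ?cabs_ge0 ?exprn_ge0.
exists M => n; rewrite /cdil; case: ifP => [mn|_]; last by rewrite cabs0 mul0r.
rewrite cabsM cabsX z1 expr1n mulr1; apply: le_trans (HM (n %/ m)%N).
by rewrite -exprM mulnC divnK.
Qed.

Lemma psum_cdil m z a (q : C) : (0 < m)%N -> cabs z = 1 -> tame a -> cabs q < 1 ->
  psum (cdil m z a) q = psum a (z * q ^+ m).
Proof.
move=> m0 z1 ta q1; apply: hsum_sum.
have zq1 : cabs (z * q ^+ m) < 1.
  by rewrite cabsM z1 mul1r cabsX exprn_ilt1 ?cabs_ge0 // -lt0n.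
apply: (@hsum_inj R nat nat _ _ (fun k => k * m)%N
  (fun n => if (m %| n)%N then Some (n %/ m)%N else None)).
- by move=> k; rewrite dvdn_mull // mulnK.
- by move=> n /=; case: ifP => //= mn; rewrite divnK.
- by move=> n; rewrite /cdil; case: ifP => // _ _; rewrite mul0r.
apply: hsum_ext (psumP ta zq1) => k /=; rewrite /cdil dvdn_mull // mulnK //.
by rewrite exprMn -exprM mulnC mulrA.
Qed.

Lemma FX_dil h m z a g : (0 < h)%N -> (0 < m)%N -> cabs z = 1 -> tame a ->
  (forall t : H, g t = psum a (z * e (val t / h%:R) ^+ m)) -> FX h g (cdil m z a).
Proof.
move=> h0 m0 z1 ta E; split; first exact: tame_cdil.
by move=> t; rewrite psum_cdil ?E //; apply: cabs_e_lt1 => //; apply: valP t.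
Qed.

Lemma FX_shift h f a N : (0 < h)%N -> FX h f a -> (forall n, (n < N)%N -> a n = 0) ->
  FX h (fun t => f t / e (val t / h%:R) ^+ N) (fun n => a (n + N)%N).
Proof.
move=> h0 fa a0; have [ta _] := fa.
have tb : tame (fun n => a (n + N)%N).
  move=> r; rewrite le_eqVlt => /orP[/eqP <- _|r0 r1].
    exists (cabs (a N)) => -[|n]; first by rewrite expr0 mulr1 add0n.
    by rewrite expr0n /= mulr0 cabs_ge0.
  have [M HM] := ta r (ltW r0) r1; exists (M / r ^+ N) => n.
  by rewrite ler_pdivlMr ?exprn_gt0 // -mulrA -exprD.
split=> // t; set q := e _; have q1 : cabs q < 1 by apply: cabs_e_lt1 => //; apply: valP t.
have qN : q ^+ N != 0 by rewrite expf_neq0 // e_neq0.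
apply: (mulIf qN); rewrite divfK //.
apply: hsum_uniq (FX_hsum t h0 fa) _; rewrite [X in hsum _ X]mulrC -/q.
apply: (@hsum_inj R nat nat _ _ (fun k => k + N)%N
  (fun n => if (N <= n)%N then Some (n - N)%N else None)).
- by move=> k; rewrite leq_addl addnK.
- by move=> n /=; case: ifP => //= mn; rewrite subnK.
- by move=> n; case: leqP => // nN _; rewrite a0 // mul0r.
by apply: hsum_ext (hsum_scale (q ^+ N) (psumP tb q1)) => k /=; rewrite exprD; ring.
Qed.

End PowerSeries.

(** * Derivatives and Cauchy's estimate *)

Section Derivatives.
Variable R : realType.
Local Notation C := (Cx R).
Local Notation H := (upper_half R).
Local Notation e := (@e2ipi R).
Implicit Types (F G : C -> C) (z d k : C).

(* Differentiability with a quadratic error term; analytic functions all have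
   it, and it is stable under the operations without any limit argument. *)
Definition qderiv F z d := exists M kap : R, [/\ 0 <= M, 0 < kap &
  forall k, cabs k < kap -> cabs (F (z + k) - F z - k * d) <= M * cabs k ^+ 2].

Lemma nbhs_cabs z (kap : R) : 0 < kap -> \forall x \near z, cabs (x - z) < kap.
Proof. by move=> k0; have /(@cvgC R) := @cvg_id _ (nbhs z); apply. Qed.

Lemma qderiv_is_derive F z d : qderiv F z d -> is_derive z (1 : C) F d.
Proof.
move=> [M [kap [M0 kap0 H]]].
have L : (fun h : C => h^-1 *: ((F \o shift z) (h *: (1 : C)) - F z)) @ 0^' --> d.
  apply/cvgC => eps eps0; rewrite /dnbhs /=.
  have m0 : 0 < Num.min kap (eps / (M + 1)).
    by rewrite lt_min kap0 divr_gt0 //; lra.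
  apply: filterS (@nbhs_cabs 0 _ m0) => h; rewrite subr0 lt_min => /andP[hk hM] h0.
  have -> : h^-1 *: ((F \o shift z) (h *: (1 : C)) - F z) - d =
      h^-1 * (F (z + h) - F z - h * d).
    have -> : (F \o shift z) (h *: (1 : C)) = F (z + h).
      by rewrite /= /GRing.scale /= mulr1 addrC.
    by rewrite /GRing.scale /= !mulrBr mulKf.
  have hp : 0 < cabs h by rewrite cabs_gt0.
  rewrite cabsM cabsV mulrC ltr_pdivrMr //; apply: le_lt_trans (H h hk) _.
  rewrite expr2 mulrA ltr_pM2r //.
  move: hM; rewrite ltr_pdivlMr; last by lra.
  by rewrite mulrDr mulr1 mulrC; have := cabs_ge0 h; lra.
apply: DeriveDef; first by apply/cvg_ex; exists d.
exact: cvg_lim L.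
Qed.

Lemma qderiv_ext F G z d (kap : R) : 0 < kap ->
  (forall k, cabs k < kap -> F (z + k) = G (z + k)) -> qderiv F z d -> qderiv G z d.
Proof.
move=> k0 FG [M [kap' [M0 k'0 H]]]; exists M, (Num.min kap kap'); split=> //.
  by rewrite lt_min k0.
move=> k; rewrite lt_min => /andP[k1 k2].
rewrite -FG // -[in G z](addr0 z) -FG ?cabs0 // addr0; exact: H.
Qed.

Lemma qderiv_bound F z d : qderiv F z d -> exists M kap : R, [/\ 0 <= M, 0 < kap &
  forall k, cabs k < kap -> cabs (F (z + k) - F z) <= M * cabs k].
Proof.
move=> [M [kap [M0 kap0 H]]]; exists (M * kap + cabs d), kap; split=> //.
  by rewrite addr_ge0 ?cabs_ge0 // mulr_ge0 // ltW.
move=> k kk; have := H k kk; have := cabs_add (F (z + k) - F z - k * d) (k * d).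
rewrite subrK cabsM => h1 h2; apply: le_trans h1 _.
rewrite mulrDl [cabs d * _]mulrC lerD2r; apply: le_trans h2 _.
by rewrite expr2 mulrA ler_wpM2r ?cabs_ge0 // ler_wpM2l // ltW.
Qed.

Lemma qderiv_mul F G z d d' : qderiv F z d -> qderiv G z d' ->
  qderiv (fun x => F x * G x) z (F z * d' + d * G z).
Proof.
move=> HF HG; have [M1 [k1 [M10 k10 H1]]] := qderiv_bound HF.
have [M2 [k2 [M20 k20 H2]]] := qderiv_bound HG.
move: HF HG => [M3 [k3 [M30 k30 H3]]] [M4 [k4 [M40 k40 H4]]].
exists (M1 * M2 + cabs (F z) * M4 + M3 * cabs (G z)), (Num.min (Num.min k1 k2) (Num.min k3 k4)).
split; first by rewrite !addr_ge0 ?mulr_ge0 ?cabs_ge0.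
  by rewrite !lt_min k10 k20 k30 k40.
move=> k; rewrite !lt_min => /andP[/andP[kk1 kk2] /andP[kk3 kk4]].
have -> : F (z + k) * G (z + k) - F z * G z - k * (F z * d' + d * G z) =
  (F (z + k) - F z) * (G (z + k) - G z) + F z * (G (z + k) - G z - k * d') +
   (F (z + k) - F z - k * d) * G z by ring.
apply: le_trans (cabs_add _ _) _.
have -> : (M1 * M2 + cabs (F z) * M4 + M3 * cabs (G z)) * cabs k ^+ 2 =
  M1 * M2 * cabs k ^+ 2 + cabs (F z) * M4 * cabs k ^+ 2 + M3 * cabs (G z) * cabs k ^+ 2 by ring.
apply: lerD.
  apply: le_trans (cabs_add _ _) _; apply: lerD.
    rewrite cabsM (_ : M1 * M2 * cabs k ^+ 2 = (M1 * cabs k) * (M2 * cabs k)); last by ring.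
    by apply: ler_pM; rewrite ?cabs_ge0 ?H1 ?H2.
  by rewrite cabsM -mulrA ler_wpM2l ?cabs_ge0 ?H4.
by rewrite cabsM mulrAC ler_wpM2r ?cabs_ge0 ?H3.
Qed.

Lemma qderiv_comp F G z d d' : qderiv F z d -> qderiv G (F z) d' ->
  qderiv (fun x => G (F x)) z (d * d').
Proof.
move=> HF HG; have [M1 [k1 [M10 k10 H1]]] := qderiv_bound HF.
move: HF HG => [M3 [k3 [M30 k30 H3]]] [M4 [k4 [M40 k40 H4]]].
exists (M4 * M1 ^+ 2 + M3 * cabs d'), (Num.min (Num.min k1 k3) (k4 / (M1 + 1))).
split; first by rewrite addr_ge0 ?mulr_ge0 ?sqr_ge0 ?cabs_ge0.
  by rewrite !lt_min k10 k30 divr_gt0 //; lra.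
move=> k; rewrite !lt_min => /andP[/andP[kk1 kk3] kk4].
set w := F (z + k) - F z; have Fw : F (z + k) = F z + w by rewrite /w addrCA subrr addr0.
have wb : cabs w <= M1 * cabs k by apply: H1.
have wk : cabs w < k4.
  apply: le_lt_trans wb _; move: kk4; rewrite ltr_pdivlMr; last by lra.
  by rewrite mulrDr mulr1 mulrC; have := cabs_ge0 k; lra.
rewrite Fw; have -> : G (F z + w) - G (F z) - k * (d * d') =
  (G (F z + w) - G (F z) - w * d') + (w - k * d) * d' by ring.
apply: le_trans (cabs_add _ _) _; rewrite [leRHS]mulrDl; apply: lerD.
  apply: le_trans (H4 _ wk) _; rewrite -mulrA ler_wpM2l // -exprMn.
  by rewrite lerXn2r ?nnegrE ?mulr_ge0 ?cabs_ge0.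
by rewrite cabsM mulrAC ler_wpM2r ?cabs_ge0 ?H3.
Qed.

Lemma qderiv_inv z : z != 0 -> qderiv (fun x => x^-1) z (- z ^- 2).
Proof.
move=> z0; have zp : 0 < cabs z by rewrite cabs_gt0.
exists (2 / cabs z ^+ 3), (cabs z / 2); split.
- by rewrite divr_ge0 // exprn_ge0 // ltW.
- by rewrite divr_gt0.
move=> k kk; have zk : cabs z / 2 <= cabs (z + k).
  by have := cabs_sub z (- k); rewrite opprK cabsN; lra.
have zk0 : z + k != 0 by rewrite -cabs_gt0; apply: lt_le_trans zk; rewrite divr_gt0.
have -> : (z + k)^-1 - z^-1 - k * - z ^- 2 = k ^+ 2 / (z ^+ 2 * (z + k)).
  by field; rewrite z0 zk0.
rewrite cabsM cabsX mulrC ler_wpM2r ?sqr_ge0 // cabsV cabsM cabsX.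
have -> : 2 / cabs z ^+ 3 = (cabs z ^+ 2 * (cabs z / 2))^-1 by field; rewrite gt_eqF.
rewrite lef_pV2 ?posrE ?mulr_gt0 ?exprn_gt0 //; last by rewrite cabs_gt0.
by rewrite ler_wpM2l // exprn_ge0 // ltW.
Qed.

Lemma qderiv_id z : qderiv id z 1.
Proof.
exists 0, 1; split => // k _; rewrite mulr1 mul0r (_ : id (z + k) - id z - k = 0) ?cabs0 //.
by rewrite /=; ring.
Qed.

Lemma qderiv_cst (c : C) z : qderiv (fun=> c) z 0.
Proof. by exists 0, 1; split => // k _; rewrite mulr0 subrr subr0 cabs0 mul0r. Qed.

(** Moving z by k multiplies q by exp w, w = 2 pi i k / h. The second-order remainder of the n-th
    term is a_n q^n (exp (n w) - 1 - n w), dominated through [cexp_quad] by 4 |w|^2 n^2 |a_n|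
    s^n. *)
Lemma psum_qderiv (h : nat) (a : nat -> C) z : (0 < h)%N -> tame a -> 0 < complex.Im z ->
  qderiv (fun z => psum a (e (z / h%:R))) z
    (2 * iC R * piC R / h%:R * psum (fun n => n%:R * a n) (e (z / h%:R))).
Proof.
move=> h0 ta z0; set q := e (z / h%:R); set r := cabs q.
have r1 : r < 1 by apply: cabs_e_lt1.
have r0 : 0 < r by rewrite cabs_gt0 e_neq0.
pose s := (1 + r) / 2; have rs : r < s by rewrite /s; lra.
have s1 : s < 1 by rewrite /s; lra.
have s0 : 0 < s by lra.
pose w0 := 2 * iC R * piC R / h%:R; set c := cabs w0.
have c0 : 0 < c.
  by rewrite cabs_gt0 mulf_neq0 ?twopii_neq0 // invr_eq0 pnatr_eq0 -lt0n.
(* The condition |w| < y keeps r exp |w| <= s < 1, where the series of the n^2 a_n still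
   converges. *)
have [y yE] := @expR_total R (s / r) (divr_gt0 s0 r0).
have y0 : 0 < y by rewrite -expR_gt1 yE ltr_pdivlMr // mul1r.
pose a2 n := n%:R * (n%:R * a n).
have ta1 := tame_natmul ta; have ta2 : tame a2 := tame_natmul ta1.
have [_ [M HM]] := tame_bsum ta2 (ltW s0) s1.
have M0 : 0 <= M by have := HM [::] isT; rewrite big_nil.
exists (4 * c ^+ 2 * M), (y / c); split; first by rewrite mulr_ge0 // mulr_ge0 // sqr_ge0.
  by rewrite divr_gt0.
move=> k kk; pose w := w0 * k.
have wE : cabs w = c * cabs k by rewrite cabsM.
have wy : cabs w < y by rewrite wE mulrC -ltr_pdivlMr.
have rw : r * expR (cabs w) <= s.
  by rewrite mulrC -ler_pdivlMr // -yE ler_expR ltW.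
have eqw : e ((z + k) / h%:R) = q * cexp w.
  by rewrite mulrDl eD; congr (_ * _); rewrite /e2ipi /w /w0; congr cexp; ring.
have qw1 : cabs (q * cexp w) < 1.
  rewrite cabsM cabs_cexp; apply: le_lt_trans s1; apply: le_trans rw; rewrite ler_wpM2l ?cabs_ge0 //.
  by rewrite ler_expR; apply: le_trans (abs_Re w); apply: ler_norm.
rewrite eqw -/w0.
have := hsum_sub (hsum_sub (psumP ta qw1) (psumP ta r1)) (hsum_scale w (psumP ta1 r1)).
have -> : psum a (q * cexp w) - psum a q - w * psum (fun n => n%:R * a n) q =
  psum a (q * cexp w) - psum a q - k * (w0 * psum (fun n => n%:R * a n) q).
  by rewrite /w -mulrA mulrCA.
move=> Hs; apply: hsum_le Hs _ => K uK.
apply: (@le_trans _ _ (\sum_(n <- K) 4 * c ^+ 2 * cabs k ^+ 2 * (cabs (a2 n) * s ^+ n))); last first.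
  rewrite -mulr_sumr; have -> : 4 * c ^+ 2 * M * cabs k ^+ 2 = 4 * c ^+ 2 * cabs k ^+ 2 * M by ring.
  rewrite ler_wpM2l ?HM //.
  by rewrite mulr_ge0 ?sqr_ge0 // mulr_ge0 ?sqr_ge0.
apply: ler_sum => n _.
have -> : a n * (q * cexp w) ^+ n - a n * q ^+ n - w * (n%:R * a n * q ^+ n) =
   a n * q ^+ n * (cexp (n%:R * w) - 1 - n%:R * w).
  have -> : cexp (n%:R * w) = cexp w ^+ n.
    elim: (n) => [|m IH]; first by rewrite mul0r cexp0.
    by rewrite exprS -IH -cexpD mulrSr mulrDl mul1r addrC.
  by rewrite exprMn; ring.
rewrite !cabsM cabsX -/r; apply: (@le_trans _ _
  (cabs (a n) * r ^+ n * (4 * cabs (n%:R * w) ^+ 2 * expR (cabs (n%:R * w))))).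
  by rewrite ler_wpM2l ?cexp_quad // mulr_ge0 ?cabs_ge0 // exprn_ge0 // ltW.
rewrite cabsM !cabs_nat expRM_natl.
have -> : cabs (a n) * r ^+ n * (4 * (n%:R * cabs w) ^+ 2 * expR (cabs w) ^+ n) =
  4 * cabs w ^+ 2 * (n%:R * (n%:R * cabs (a n))) * (r * expR (cabs w)) ^+ n.
  by rewrite [(r * _) ^+ n]exprMn; ring.
rewrite wE; have -> : 4 * c ^+ 2 * cabs k ^+ 2 * (n%:R * (n%:R * cabs (a n)) * s ^+ n) =
  4 * (c * cabs k) ^+ 2 * (n%:R * (n%:R * cabs (a n))) * s ^+ n by ring.
apply: ler_wpM2l; first by rewrite !mulr_ge0 ?sqr_ge0 ?cabs_ge0.
rewrite -wE; apply: lerXn2r => //; rewrite nnegrE; last exact: ltW.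
by rewrite mulr_ge0 ?expR_ge0 // ltW.
Qed.

Lemma Im_near z k : cabs k < complex.Im z -> 0 < complex.Im (z + k).
Proof. by have := abs_Im k; rewrite ImD ler_norml => /andP[? ?] ?; lra. Qed.

Lemma val_insubd (t : H) z : 0 < complex.Im z -> val (insubd t z) = z.
Proof. by move=> z0; rewrite insubdK. Qed.

Lemma FX_holomorphic h f (a : nat -> C) : (0 < h)%N -> FX h f a -> holomorphic f.
Proof.
move=> h0 [ta fE] t.
have t0 : 0 < complex.Im (val t) := valP t.
suff Q : qderiv (fun z : C => f (insubd t z)) (val t)
    (2 * iC R * piC R / h%:R * psum (fun n => n%:R * a n) (e (val t / h%:R))).
  by have [] := qderiv_is_derive Q.
apply: qderiv_ext t0 _ (psum_qderiv h0 ta t0) => k kt.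
by rewrite fE val_insubd // Im_near.
Qed.

(** Mean value theorem along the segment from z0 to z1, which stays in the half-plane by convexity;
    [P] stands for the real or the imaginary part. *)
Lemma qderiv0_cst F (z0 z1 : C) : 0 < complex.Im z0 -> 0 < complex.Im z1 ->
  (forall z, 0 < complex.Im z -> qderiv F z 0) -> F z0 = F z1.
Proof.
move=> z00 z10 HF.
suff S (P : C -> R) : (forall x y, P (x + y) = P x + P y) -> (forall x, P (- x) = - P x) ->
   (forall x, `|P x| <= cabs x) -> P (F z0) = P (F z1).
  have NR (x : C) : complex.Re (- x) = - complex.Re x by case: x.
  have NI (x : C) : complex.Im (- x) = - complex.Im x by case: x.
  have := S _ (@ReD R) NR (@abs_Re R); have := S _ (@ImD R) NI (@abs_Im R).
  by case: (F z0) (F z1) => [a b] [c d] /= -> ->.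
move=> PD PN PB; pose g (s : R) := P (F (z0 + rC s * (z1 - z0))).
have Im_s (s : R) : 0 <= s <= 1 -> 0 < complex.Im (z0 + rC s * (z1 - z0)).
  move=> /andP[s0 s1]; have -> : complex.Im (z0 + rC s * (z1 - z0)) =
    (1 - s) * complex.Im z0 + s * complex.Im z1.
    by case: (z0) (z1) => [a b] [c d] /=; ring.
  have [->|s0'] := eqVneq s 0; first by rewrite mul0r addr0 subr0 mul1r.
  by rewrite ltr_wpDl ?mulr_ge0 ?mulr_gt0 ?subr_ge0 // ?lt_def ?s0' // ltW.
have gD (s : R) : 0 <= s <= 1 -> is_derive s (1 : R) g 0.
  move=> /Im_s /HF [M [kap [M0 kap0 HM]]]; set z := z0 + _ in HM.
  set L := cabs (z1 - z0); have L0 : 0 <= L by apply: cabs_ge0.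
  have lim0 : (fun h : R => h^-1 *: ((g \o shift s) (h *: (1 : R)) - g s)) @ 0^' --> (0 : R).
    apply/cvgrPdist_lt => eps eps0; rewrite /dnbhs /=.
    pose m := Num.min (kap / (L + 1)) (eps / (M * L ^+ 2 + 1)).
    have ml0 : 0 < M * L ^+ 2 + 1 by rewrite ltr_wpDl // mulr_ge0 // sqr_ge0.
    have m0 : 0 < m by rewrite lt_min !divr_gt0 //; lra.
    have := @nbhsx_ballx _ _ (0 : R) m m0; apply: filterS => h.
    rewrite /ball /= sub0r normrN lt_min => /andP[h1 h2] h0.
    have hp : 0 < `|h| by rewrite normr_gt0.
    have -> : g (h *: (1 : R) + s) = P (F (z + rC h * (z1 - z0))).
      rewrite /g /GRing.scale /= mulr1 rCD; congr (P (F _)); rewrite /z; ring.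
    have -> : g s = P (F z) by [].
    rewrite sub0r normrN -PN -PD /GRing.scale /= normrM normfV mulrC ltr_pdivrMr //.
    apply: le_lt_trans (PB _) _.
    have hk : cabs (rC h * (z1 - z0)) < kap.
      rewrite cabsM cabs_rC -/L; move: h1; rewrite ltr_pdivlMr; last by lra.
      by rewrite mulrDr mulr1; lra.
    have := HM _ hk; rewrite mulr0 subr0 => hM; apply: le_lt_trans hM _.
    rewrite cabsM cabs_rC -/L; move: h2; rewrite ltr_pdivlMr //.
    by move: `|h| hp => x x0; nra.
  apply: DeriveDef; first by apply/cvg_ex; exists 0.
  exact: cvg_lim lim0.
have gd (s : R) : s \in `]0, 1[%R -> is_derive s (1 : R) g ((fun=> 0) s).
  by rewrite in_itv /= => /andP[? ?]; apply: gD; apply/andP; split; apply: ltW.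
have [|c _] := MVT_segment ler01 gd.
  apply: derivable_within_continuous => s; rewrite in_itv /= => s01.
  by have [] := gD s s01.
rewrite mul0r => /eqP; rewrite subr_eq0 /g => /eqP.
by rewrite rC0 rC1 mul0r addr0 mul1r addrCA subrr addr0.
Qed.

End Derivatives.

(** * Cauchy's estimate by averaging over translates *)

Section CauchyEstimate.
Variable R : realType.
Local Notation C := (Cx R).
Local Notation H := (upper_half R).
Local Notation e := (@e2ipi R).
Implicit Types (a b : nat -> C) (f g : H -> C).

Lemma Im_addr (t : H) (x : R) : 0 < complex.Im (val t + rC x).
Proof. by case: t => -[u v] /= v0; rewrite addr0. Qed.

Definition trans (t : H) (x : R) : H := mkH (Im_addr t x).

Lemma val_trans t x : val (trans t x) = val t + rC x. Proof. by []. Qed.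

(** Orthogonality of the two characters mod 2, which drives the dyadic averages. *)
Lemma e_half_int (l : int) : (1 + e (l%:~R / 2)) / 2 = if (l %% 2)%Z == 0 then 1 else 0.
Proof.
have t0 : 2 != 0 :> C by rewrite pnatr_eq0.
have lE : l = (l %/ 2)%Z * 2 + (l %% 2)%Z by rewrite -divz_eq.
have -> : l%:~R / 2 = (l %% 2)%Z%:~R / 2 + (l %/ 2)%Z%:~R :> C.
  by rewrite {1}lE intrD intrM; field.
have [->|->] : (l %% 2)%Z = 0 \/ (l %% 2)%Z = 1 by lia.
  by rewrite eDint mul0r e0 eqxx; field.
by rewrite eDint (_ : 1%:~R / 2 = 1 / 2 :> C) // e_half subrr mul0r.
Qed.

Lemma avg_aux (A Q P Q' P' Y : C) : Q' / P' = Q / P * Y ->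
  1 / 2 * (A * Q / P + A * Q' / P') = A * Q / P * ((1 + Y) / 2).
Proof. by rewrite -!mulrA => ->; move: (P^-1) => V; field. Qed.

(* Averaging over x and x + h/2^(m+1) keeps the indices congruent to n mod 2^(m+1). *)
Lemma dyadic_average h f a n t (B : R) m : (0 < h)%N -> FX h f a ->
  (forall x : R, cabs (f (trans t x)) <= B) ->
  forall x : R, exists v : C,
    hsum (fun k => if ((2 ^ m)%N %| (k%:Z - n%:Z))%Z then
       a k * e (val (trans t x) / h%:R) ^+ k / e (val (trans t x) / h%:R) ^+ n else 0) v /\
    cabs v <= B / cabs (e (val t / h%:R)) ^+ n.
Proof.
move=> h0 fa HB.
have cE x : cabs (e (val (trans t x) / h%:R)) = cabs (e (val t / h%:R)).
  rewrite val_trans mulrDl eD cabsM [X in _ * X]cabs_e.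
  by rewrite -rC_nat -rCV -rCM /= mulr0 oppr0 expR0 mulr1.
elim: m => [|m IH] x.
  exists (f (trans t x) / e (val (trans t x) / h%:R) ^+ n); split.
    rewrite [X in hsum _ X]mulrC; apply: hsum_ext (hsum_scale _ (FX_hsum (trans t x) h0 fa)) => k.
    by rewrite dvd1z mulrC.
  by rewrite cabsM cabsV cabsX cE ler_wpM2r ?HB // invr_ge0 exprn_ge0 // cabs_ge0.
pose x' := x + h%:R / (2 ^ m.+1)%:R.
have [v [Hv vB]] := IH x; have [v' [Hv' v'B]] := IH x'.
exists (1 / 2 * (v + v')); split; last first.
  rewrite cabsM (_ : cabs (1 / 2 : C) = 1 / 2).
    by have := cabs_add v v'; lra.
  by rewrite cabsM cabs1 cabsV cabs_nat.
apply: hsum_ext (hsum_scale (1 / 2) (hsum_add Hv Hv')) => k.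
set q := e _; set q' := e _; set d := (k%:Z - n%:Z).
have hN : h%:R != 0 :> C by rewrite pnatr_eq0 -lt0n.
have qq : q' = q * e (1 / (2 ^ m.+1)%:R).
  rewrite /q' /q -eD; congr e; rewrite !val_trans /x' rCD rCM rCV !rC_nat; field.
  by rewrite hN andbT natrX expf_neq0 ?pnatr_eq0.
have qN : q != 0 by rewrite e_neq0.
set ep := e (1 / _) in qq.
have epE : q' ^+ k / q' ^+ n = q ^+ k / q ^+ n * e (d%:~R / (2 ^ m.+1)%:R).
  have -> : e (d%:~R / (2 ^ m.+1)%:R) = ep ^+ k / ep ^+ n.
    rewrite !eX -eN -eD; congr e; rewrite /d rmorphB /= -!pmulrn.
    by rewrite mulrBl !mul1r.
  by rewrite qq !exprMn invfM mulrACA.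
have tN i : (2 ^ i)%:R != 0 :> C by rewrite natrX expf_neq0 ?pnatr_eq0.
have [m0|m0] := boolP ((2 ^ m)%N %| d)%Z; last first.
  rewrite addr0 mulr0 ifN //; apply: contra m0; apply: dvdz_trans.
  by rewrite expnS PoszM dvdz_mull.
have [l dl] := dvdzP m0.
rewrite (avg_aux (a k) epE).
have -> : d%:~R / (2 ^ m.+1)%:R = l%:~R / 2 :> C.
  by rewrite dl expnS intrM natrM -pmulrn; field; rewrite tN.
have -> : ((2 ^ m.+1)%N %| d)%Z = ((l %% 2)%Z == 0).
  by rewrite dl expnS PoszM dvdz_mul2r ?eqz_nat ?expn_eq0 //; apply: (sameP dvdz_mod0P eqP).
by rewrite e_half_int; case: eqP => _; rewrite ?mulr1 ?mulr0.
Qed.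

(** The averages that keep the indices congruent to n mod 2^m are bounded by the supremum of |f| on
    a horizontal line over |q|^n, and by Tannery's theorem they tend to a_n as m grows. *)
Lemma cauchy_estimate h f a n t (B : R) : (0 < h)%N -> FX h f a ->
  (forall x : R, cabs (f (trans t x)) <= B) ->
  cabs (a n) * cabs (e (val t / h%:R)) ^+ n <= B.
Proof.
move=> h0 fa HB; set r := cabs (e _); have r0 : 0 < r by rewrite cabs_gt0 e_neq0.
have [v Hv] : exists v : nat -> C, forall m,
    hsum (fun k => if ((2 ^ m)%N %| (k%:Z - n%:Z))%Z then
       a k * e (val (trans t 0) / h%:R) ^+ k / e (val (trans t 0) / h%:R) ^+ n else 0) (v m) /\
    cabs (v m) <= B / r ^+ n.
  exists (fun m => sval (cid (dyadic_average n m h0 fa HB 0))) => m.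
  exact: (svalP (cid (dyadic_average n m h0 fa HB 0))).
rewrite -ler_pdivlMr ?exprn_gt0 //.
apply: (@ctends_le _ v); first by exists 0%N => m _; have [] := Hv m.
have E : val (trans t 0) = val t by rewrite val_trans rC0 addr0.
have [ta _] := fa; have r1 : r < 1 by apply: cabs_e_lt1 => //; apply: valP t.
apply: (@tannery R nat (fun m k => if ((2 ^ m)%N %| (k%:Z - n%:Z))%Z then
       a k * e (val (trans t 0) / h%:R) ^+ k / e (val (trans t 0) / h%:R) ^+ n else 0)
  (fun k => if k == n then a n else 0) (fun k => cabs (a k) * r ^+ k / r ^+ n) v).
- have := bsum_scale (_ : 0 <= r ^- n) (tame_bsum ta (ltW r0) r1).
  rewrite invr_ge0 exprn_ge0 ?ltW // => /(_ isT); congr bsum; apply/funext => k.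
  by rewrite mulrC.
- move=> m k; case: ifP => _; last by rewrite cabs0 !mulr_ge0 ?cabs_ge0 ?invr_ge0 ?exprn_ge0 // ltW.
  by rewrite !cabsM cabsV !cabsX E.
- move=> k; case: eqP => [->|/eqP kn].
    apply: ctends_ext (ctends_cst _); exists 0%N => m _.
    by rewrite subrr dvdz0 mulfK // expf_neq0 // e_neq0.
  apply: ctends_ext (ctends_cst _); exists (k + n).+1 => m km.
  rewrite ifN //; apply/negP; rewrite dvdzE absz_nat => /dvdn_leq.
  have : (k + n < 2 ^ m)%N by apply: ltn_trans (ltn_expl m (ltnSn 1)).
  by move: (2 ^ m)%N => M kM /(_ ltac:(by lia)); lia.
- by move=> m; have [] := Hv m.
have := @hsum_seq R nat (fun k => if k == n then a n else 0) [:: n] isT.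
by rewrite big_seq1 eqxx; apply=> k; rewrite inE => /negbTE ->.
Qed.

Lemma H_inhabited : H.
Proof. by apply: (@mkH R (iC R)); rewrite /= ltr01. Qed.

Lemma FX_eq0 h f a : (0 < h)%N -> FX h f a -> (forall t, f t = 0) -> forall n, a n = 0.
Proof.
move=> h0 fa f0 n; have := @cauchy_estimate h f a n H_inhabited 0 h0 fa.
move=> /(_ (fun x => ltac:(by rewrite f0 cabs0))).
rewrite pmulr_lle0 ?exprn_gt0 ?cabs_gt0 ?e_neq0 // => an; apply/eqP.
by rewrite -cabs_eq0 eq_le an cabs_ge0.
Qed.

Lemma FX_uniq h f a b : (0 < h)%N -> FX h f a -> FX h f b -> a =1 b.
Proof.
move=> h0 fa fb n; apply/eqP; rewrite -subr_eq0; apply/eqP.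
have := FX_eq0 h0 (FX_add h0 fa (FX_scale (-1) h0 fb)) _ n.
by rewrite mulN1r; apply=> t; rewrite mulN1r subrr.
Qed.

End CauchyEstimate.

(** * The Lipschitz formula *)

Section Lipschitz.
Variable R : realType.
Local Notation C := (Cx R).
Local Notation e := (@e2ipi R).
Implicit Types (z w t : C).

Lemma four_pow (F : comNzRingType) k : (2 ^ k)%:R ^+ 2 = 4 ^+ k :> F.
Proof. by rewrite natrX -exprM mulnC exprM -natrX. Qed.

Definition ints (B : nat) : seq int := [seq i%:Z - B%:Z | i <- iota 0 (B.*2.+1)].

Lemma mem_ints B m : (m \in ints B) = (`|m| <= B)%N.
Proof.
apply/mapP/idP; first by case=> i; rewrite mem_iota => ? ->; lia.
move=> mB.
by exists (absz (m + B)%R); rewrite ?mem_iota; lia.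
Qed.

(** The power (n+1)^(-3/2). A constant times [g32 m * g32 n] dominates the inverse cube of m + n,
    which reduces lattice sums to one-dimensional ones. *)
Definition g32 (n : nat) : R := (n.+1%:R * Num.sqrt n.+1%:R)^-1.

Lemma g32_ge0 n : 0 <= g32 n.
Proof. by rewrite invr_ge0 mulr_ge0 // sqrtr_ge0. Qed.

(** Telescoping comparison: if a and b are the square roots of n+1 and n+2, then b^2 - a^2 = 1 gives
    b^-3 <= 2/a - 2/b. *)
Lemma bsum_g32 : bsum g32.
Proof.
suff S n : \sum_(i < n.+1) g32 i <= 3 - 2 / Num.sqrt n.+1%:R.
  apply: (@bsum_nat _ _ 3) g32_ge0 _ => -[|n]; first by rewrite big_ord0.
  apply: le_trans (S n) _; rewrite gerBl divr_ge0 // sqrtr_ge0.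
elim: n => [|n IH]; first by rewrite big_ord1 /g32 sqrtr1 !(mulr1, invr1); lra.
rewrite big_ord_recr /=; apply: le_trans (lerD IH (lexx _)) _.
rewrite /g32; have a2 := @sqr_sqrtr R n.+1%:R (ler0n _ _).
have b2 := @sqr_sqrtr R n.+2%:R (ler0n _ _).
have a0 : 0 < Num.sqrt n.+1%:R :> R by rewrite sqrtr_gt0 ltr0n.
have b0 : 0 < Num.sqrt n.+2%:R :> R by rewrite sqrtr_gt0 ltr0n.
rewrite -{1}b2; move: (Num.sqrt n.+1%:R : R) (Num.sqrt n.+2%:R : R) a0 b0 a2 b2 => a b a0 b0 a2 b2.
have ab : b ^+ 2 = a ^+ 2 + 1 by rewrite a2 b2 mulrSr.
have ltab : a <= b by rewrite -(@ler_pXn2r _ 2) ?nnegrE ?(ltW a0) ?(ltW b0) // ab lerDl.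
suff : (b ^+ 2 * b)^-1 <= 2 / a - 2 / b by lra.
have -> : 2 / a - 2 / b = 2 / (a * b * (a + b)).
  have : (b - a) * (a + b) = 1 by rewrite (_ : (b - a) * (a + b) = b ^+ 2 - a ^+ 2); [rewrite ab|]; ring.
  move=> E; rewrite -[2 in RHS]mulr1 -E; field.
  by rewrite !gt_eqF ?addr_gt0.
have -> : (b ^+ 2 * b)^-1 = 2 / (b * b * (b + b)) by field; rewrite !gt_eqF ?addr_gt0.
rewrite ler_pM2l // lef_pV2 ?posrE ?mulr_gt0 ?addr_gt0 //.
have l1 : a * b <= b * b by rewrite ler_pM2r.
have l2 : a + b <= b + b by rewrite lerD2r.
have p1 : 0 <= a * b by rewrite mulr_ge0 // ltW.
have p2 : 0 <= a + b by rewrite addr_ge0 // ltW.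
exact: ler_pM.
Qed.

Lemma inv_sqr_le n : ((n%:R : R) ^+ 2)^-1 <= 4 * g32 n.
Proof.
case: n => [|n]; first by rewrite expr0n /= invr0 mulr_ge0 ?g32_ge0.
rewrite /g32 -[4]invrK -invfM lef_pV2 ?posrE ?exprn_gt0 ?ltr0n ?mulr_gt0 ?invr_gt0 ?sqrtr_gt0 ?ltr0n //.
have s1 : Num.sqrt n.+2%:R <= n.+2%:R :> R.
  have a2 := @sqr_sqrtr R n.+2%:R (ler0n _ _).
  have : 1 <= Num.sqrt n.+2%:R :> R by rewrite -[X in X <= _]sqrtr1 ler_sqrt ?ler1n ?ltr0n.
  rewrite -{3}a2; move: (Num.sqrt _) => a *; nra.
have n1 : 1 <= n.+1%:R :> R by rewrite ler1n.
move: s1; rewrite [n.+2%:R]mulrSr; move: (n.+1%:R : R) (Num.sqrt _) n1 => a b *; nra.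
Qed.

(** This is -1 / (4 sin^2 (pi z)); at the integers the convention on division makes it 0, which
    drops the pole. *)
Definition hh z : C := e z / (1 - e z) ^+ 2.

Lemma hhDint z (n : int) : hh (z + n%:~R) = hh z.
Proof. by rewrite /hh eDint. Qed.

Lemma hhN z : hh (- z) = hh z.
Proof.
rewrite /hh eN; have [->|n1] := eqVneq (e z) 1; first by rewrite invr1.
have := e_neq0 z; move: (e z) n1 => u n1 u0; have n2 : 1 - u != 0 by rewrite subr_eq0 eq_sym.
have -> : 1 - u^-1 = - (1 - u) / u by field.
by field; rewrite u0 n2.
Qed.

Lemma hh0 : hh 0 = 0.
Proof. by rewrite /hh e0 subrr expr0n invr0 mulr0. Qed.

Lemma hh_half : hh (1 / 2) = - (1 / 4).
Proof. by rewrite /hh e_half; field. Qed.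

(** With u = e(z/2), the two values on the left are u / (1 - u)^2 and -u / (1 + u)^2. *)
Lemma hh_dup z : e z != 1 -> hh (z / 2) + hh ((z + 1) / 2) = 4 * hh z.
Proof.
move=> n1; rewrite /hh mulrDl eD e_half mulrN1.
have E : e z = e (z / 2) ^+ 2 by rewrite eX; congr e; field.
rewrite E in n1 *; move: (e _) n1 => u n1.
have : 1 - u ^+ 2 != 0 by rewrite subr_eq0 eq_sym.
have -> : 1 - u ^+ 2 = (1 - u) * (1 + u) by ring.
rewrite mulf_eq0 negb_or => /andP[a b].
by rewrite opprK; field; rewrite a b.
Qed.

Definition dyad k z : C := \sum_(0 <= j < 2 ^ k) hh ((z + j%:R) / (2 ^ k)%:R).

Lemma tN2 k : (2 ^ k)%:R != 0 :> C.
Proof. by rewrite natrX expf_neq0 ?pnatr_eq0. Qed.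

Lemma sum_double (M : nat) (F : nat -> C) :
  \sum_(0 <= j < M + M) F j = \sum_(0 <= j < M) (F j + F (j + M)%N).
Proof.
rewrite (@big_cat_nat _ _ _ M) ?leq_addr //= -{2}(add0n M) big_addn addnK.
by rewrite big_split.
Qed.

Lemma dyadS k z : dyad k.+1 z = \sum_(0 <= j < 2 ^ k)
  (hh ((z + j%:R) / (2 ^ k)%:R / 2) + hh (((z + j%:R) / (2 ^ k)%:R + 1) / 2)).
Proof.
rewrite /dyad; have -> : (2 ^ k.+1 = 2 ^ k + 2 ^ k)%N by rewrite expnS mul2n addnn.
rewrite sum_double.
have -> : (2 ^ k + 2 ^ k)%:R = (2 ^ k)%:R * 2 :> C by rewrite natrD; ring.
apply: eq_bigr => j _; congr (hh _ + hh _).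
  by field; rewrite tN2.
by rewrite natrD; field; rewrite tN2.
Qed.

Lemma dyadE k z : e z != 1 -> dyad k z = 4 ^+ k * hh z.
Proof.
elim: k => [|k IH] z1; first by rewrite /dyad big_nat1 addr0 divr1 expr0 mul1r.
rewrite dyadS exprS -mulrA -IH // /dyad mulr_sumr; apply: eq_bigr => j _.
rewrite hh_dup //; apply: contraNneq z1 => E.
have -> : z = (2 ^ k)%:R * ((z + j%:R) / (2 ^ k)%:R) + (- j%:Z)%:~R.
  by rewrite rmorphN /= -pmulrn; field; rewrite tN2.
by rewrite eDint -eX E expr1n.
Qed.

Lemma dyad_shift k z : dyad k (z + 1) = dyad k z.
Proof.
rewrite /dyad; have [m ->] : exists m, (2 ^ k = m.+1)%N by exists (2 ^ k).-1; rewrite prednK ?expn_gt0.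
rewrite big_nat_recr // [RHS]big_nat_recl // [LHS]addrC /=; congr (_ + _).
  have -> : (z + 1 + m%:R) / m.+1%:R = (z + 0%:R) / m.+1%:R + 1%:~R.
    by rewrite [m.+1%:R]mulrSr; field; rewrite -mulrSr pnatr_eq0.
  exact: hhDint.
by apply: eq_bigr => j _; rewrite [j.+1%:R]mulrS addrA.
Qed.

(** The pole being dropped, the term j = 0 yields only hh(1/2) = -1/4 when k grows by one, while the
    others obey [hh_dup]: the value x becomes 4 x - 1/4. *)
Lemma dyad_nat k n : dyad k n%:R = - ((4 ^+ k - 1) / 12).
Proof.
elim: n => [|n IH]; last by rewrite mulrSr dyad_shift.
elim: k => [|k IH]; first by rewrite /dyad big_nat1 addr0 divr1 hh0 expr0; field.
rewrite dyadS exprS; have [m mE] : exists m, (2 ^ k = m.+1)%N.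
  by exists (2 ^ k).-1; rewrite prednK ?expn_gt0.
move: IH; rewrite /dyad mE !big_nat_recl //= addr0 !mul0r add0r hh0 hh_half !add0r => IH.
rewrite (eq_big_nat _ _ (F2 := fun i => 4 * hh ((0 + i.+1%:R) / m.+1%:R))).
  by rewrite -mulr_sumr IH; field.
move=> j /andP[_ jm]; rewrite hh_dup //; apply/eqP => /e_eq1[l]; rewrite add0r => E.
have {}E : (j.+1%:Z)%:~R = (l * m.+1%:Z)%:~R :> C.
  have m0 : m.+1%:R != 0 :> C by rewrite pnatr_eq0.
  by rewrite intrM -!pmulrn -E divfK.
have /(congr1 absz) := @intr_inj C _ _ E; rewrite abszM /=; move: jm.
by case: absz => [|n]; nia.
Qed.

(** With rho = |e(w)|, |1 - e(w)|^2 = (1 - rho)^2 + 4 rho sin^2 (pi x): the first term controls y^2,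
    the second x^2 as long as x stays away from the nonzero integers. *)
Lemma hh_bound : exists2 B : R, 0 <= B & forall w, `|complex.Re w| <= 3 / 4 ->
  cabs (hh w) <= B * (cabs w ^+ 2)^-1.
Proof.
have [c c0 Hc] := sin_pi_lower R; pose k := Num.min 1 (4 * c).
have k0 : 0 < k by rewrite lt_min ltr01 /= mulr_gt0.
exists k^-1; first by rewrite invr_ge0 ltW.
move=> w wx; have [->|w0] := eqVneq w 0; first by rewrite hh0 !cabs0 expr0n invr0 mulr0.
have wp : 0 < cabs w by rewrite cabs_gt0.
rewrite -invfM /hh cabsM cabsV cabsX.
set rho := cabs (e w); have r0 : 0 < rho by rewrite cabs_gt0 e_neq0.
suff H : rho * (k * cabs w ^+ 2) <= cabs (1 - e w) ^+ 2.
  have kw : 0 < k * cabs w ^+ 2 by rewrite mulr_gt0 // exprn_gt0.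
  have S0 : 0 < cabs (1 - e w) ^+ 2 by apply: lt_le_trans H; rewrite mulr_gt0.
  by rewrite ler_pdivrMr // mulrC ler_pdivlMr // mulrC.
have E : cabs (1 - e w) ^+ 2 = (1 - rho) ^+ 2 + 4 * rho * sin (pi * complex.Re w) ^+ 2.
  rewrite cabs_sqr /rho cabs_e e2ipiE /cexp /= sub0r; set r := expR _.
  set a := 2 * pi * _; have ca : 1 - cos a = 2 * sin (pi * complex.Re w) ^+ 2.
    by rewrite one_sub_cosE; congr (2 * sin _ ^+ 2); rewrite /a; move: (pi : R) => p; field.
  have -> : 4 * r * sin (pi * complex.Re w) ^+ 2 = 2 * r * (1 - cos a) by rewrite ca; ring.
  have := sin2cos2 a; move: (cos a) (sin a) => C' S' H.
  by rewrite sqrrN exprMn H; ring.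
rewrite E cabs_sqr; set x := complex.Re w; set y := complex.Im w.
have X : 4 * c * x ^+ 2 <= 4 * sin (pi * x) ^+ 2 by have := Hc x wx; lra.
have Y : rho * y ^+ 2 <= (1 - rho) ^+ 2.
  pose a := pi * y; have rE : rho = expR (- a) ^+ 2.
    by rewrite /rho cabs_e -expRM_natl; congr expR; rewrite /a -/y; ring.
  rewrite rE; have := expR_ge1Dx a; have := expR_ge1Dx (- a); have := expRxMexpNx_1 a.
  have := expR_gt0 a; have := expR_gt0 (- a).
  have : y ^+ 2 <= a ^+ 2.
    by rewrite /a exprMn ler_peMl ?sqr_ge0 // expr_ge1 // ltW // (lt_le_trans _ (pi_ge2 R)) // ltr1n.
  move: (expR (- a)) (expR a) => u v ya u0 v0 vu ua va.
  suff : (u * a) ^+ 2 <= (1 - u ^+ 2) ^+ 2 by rewrite exprMn; nra.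
  rewrite -ler_sqrt ?sqr_ge0 // !sqrtr_sqr normrM (gtr0_norm u0).
  have -> : 1 - u ^+ 2 = u * (v - u) by rewrite mulrBr -expr2 mulrC vu.
  rewrite (normrM u (v - u)) (gtr0_norm u0) ler_pM2l //.
  have [a0|/ltW a0] := leP 0 a.
    by rewrite !ger0_norm //; nra.
  by rewrite !ler0_norm //; nra.
have k1 : k <= 1 by rewrite /k ge_min lexx.
have k4 : k <= 4 * c by rewrite /k ge_min lexx orbT.
apply: (@le_trans _ _ (rho * (y ^+ 2 + 4 * c * x ^+ 2))).
  rewrite ler_wpM2l // ?(ltW r0) // addrC mulrDr; apply: lerD; last by rewrite ler_wpM2r ?sqr_ge0.
  by rewrite ler_piMl ?sqr_ge0.
by rewrite mulrDr lerD // mulrA mulrAC -mulrA; move: X; nra.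
Qed.

Lemma ctends_e_dyadic v : ctends (fun k => e (v / (2 ^ k)%:R)) 1 /\
  (v != 0 -> ctends (fun k => (e (v / (2 ^ k)%:R) - 1) * (2 ^ k)%:R) (2 * iC R * piC R * v)).
Proof.
set c := 2 * iC R * piC R * v; set r := cabs c; have r0 : 0 <= r by apply: cabs_ge0.
have H k : cabs (e (v / (2 ^ k)%:R) - 1 - c / (2 ^ k)%:R) <=
    4 * r ^+ 2 * expR r / (2 ^ k)%:R ^+ 2.
  have -> : e (v / (2 ^ k)%:R) = cexp (c / (2 ^ k)%:R) by rewrite /e2ipi /c mulrA.
  apply: le_trans (cexp_quad _) _; rewrite cabsM -/r cabsV cabs_nat.
  have t1 : 1 <= (2 ^ k)%:R :> R by rewrite ler1n expn_gt0.
  have t0 : 0 < (2 ^ k)%:R :> R by lra.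
  rewrite [leRHS]mulrAC exprMn exprVn mulrA; apply: ler_wpM2l.
    by rewrite divr_ge0 ?mulr_ge0 ?sqr_ge0.
  by rewrite ler_expR ler_pdivrMr // ler_peMr.
pose K := 4 * r ^+ 2 * expR r.
have K0 : 0 <= K by rewrite !mulr_ge0 ?sqr_ge0 ?expR_ge0.
have lim0 (x : R) : 0 <= x -> forall eps : R, 0 < eps -> exists N, forall k, (N <= k)%N -> x / (2 ^ k)%:R < eps.
  move=> x0 eps eps0; have HN := archi_boundP (divr_ge0 x0 (ltW eps0)).
  exists (Num.bound (x / eps)) => k Nk; rewrite ltr_pdivrMr ?ltr0n ?expn_gt0 // mulrC -ltr_pdivrMr //.
  apply: lt_trans HN _; rewrite ltr_nat; apply: leq_ltn_trans Nk _; exact: ltn_expl.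
split.
  have L : ctends (fun k => e (v / (2 ^ k)%:R) - 1) 0.
    apply: (@ctends0_le _ _ (fun k => (K + r) / (2 ^ k)%:R)); last by apply: lim0; rewrite addr_ge0.
    exists 0%N => k _; have := H k.
    have t1 : 1 <= (2 ^ k)%:R :> R by rewrite ler1n expn_gt0.
    have := cabs_add (e (v / (2 ^ k)%:R) - 1 - c / (2 ^ k)%:R) (c / (2 ^ k)%:R).
    rewrite subrK [cabs (c / _)]cabsM -/r cabsV cabs_nat -/K mulrDl => A B.
    apply: le_trans A _; rewrite lerD2r; apply: le_trans B _.
    rewrite ler_wpM2l // lef_pV2 ?posrE ?exprn_gt0 //; try lra.
    by rewrite expr2 ler_peMl //; lra.
  by have := ctends_add L (ctends_cst 1); rewrite add0r; apply: ctends_ext; exists 0%N => k _; rewrite subrK.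
move=> v0.
have L : ctends (fun k => (e (v / (2 ^ k)%:R) - 1) * (2 ^ k)%:R - c) 0.
  apply: (@ctends0_le _ _ (fun k => K / (2 ^ k)%:R)); last exact: lim0.
  exists 0%N => k _; have t0 : 0 < (2 ^ k)%:R :> R by rewrite ltr0n expn_gt0.
  have -> : (e (v / (2 ^ k)%:R) - 1) * (2 ^ k)%:R - c = (e (v / (2 ^ k)%:R) - 1 - c / (2 ^ k)%:R) * (2 ^ k)%:R.
    by rewrite [RHS]mulrBl divfK ?tN2.
  rewrite cabsM cabs_nat -ler_pdivlMr // -[leRHS]mulrA -invfM -expr2; exact: H.
by have := ctends_add L (ctends_cst c); rewrite add0r; apply: ctends_ext; exists 0%N => k _; rewrite subrK.
Qed.

(** e(s) - 1 is asymptotic to 2 pi i s, hence hh(s) to (2 pi i s)^-2. At v = 0 both sides are 0 by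
    convention, which lets [lipschitz_aux] include z = 0. *)
Lemma ctends_hh_dyadic v : ctends (fun k => hh (v / (2 ^ k)%:R) / 4 ^+ k)
  (((2 * iC R * piC R) ^- 2) * v ^- 2).
Proof.
have [->|v0] := eqVneq v 0.
  rewrite expr0n invr0 mulr0; apply: ctends_ext (ctends_cst 0); exists 0%N => k _.
  by rewrite mul0r hh0 mul0r.
have [L1 /(_ v0) L2] := ctends_e_dyadic v; set c := 2 * iC R * piC R in L2 *.
have c0 : (c * v) ^+ 2 != 0 by rewrite expf_neq0 // mulf_neq0 ?twopii_neq0.
have := ctends_mul L1 (ctends_inv c0 (ctends_exp 2 L2)).
rewrite mul1r exprMn invfM; apply: ctends_ext; exists 0%N => k _.
rewrite /hh exprMn invfM mulrA; congr (_ / _ / _).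
  by rewrite -sqrrN opprB.
exact: four_pow.
Qed.

(* The partial fraction expansion of pi^2 / sin^2 (z = 0 gives zeta(2)), by
   Tannery's theorem applied to the averages over the 2^(k+1)-division points. *)
Lemma lipschitz_aux z L :
  ctends (fun k => dyad k.+1 (z - (2 ^ k)%:R) / 4 ^+ k.+1) L ->
  hsum (fun m : int => (z + m%:~R) ^- 2) ((2 * iC R * piC R) ^+ 2 * L).
Proof.
move=> HL; have [B B0 HB] := hh_bound.
have [k0 Hk0] : exists k0, forall k, (k0 <= k)%N -> 4 * cabs z <= (2 ^ k.+1)%:R :> R.
  have HN := archi_boundP (mulr_ge0 (ler0n R 4) (cabs_ge0 z)).
  exists (Num.bound (4 * cabs z)) => k Nk; apply: le_trans (ltW HN) _; rewrite ler_nat.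
  by apply: ltnW; apply: leq_ltn_trans (leq_trans Nk (leqnSn k)) _; exact: ltn_expl.
(* These 2^(k+1) integers around 0 keep the real part of (z + j) / 2^(k+1) within 3/4 once 4 |z| <=
   2^(k+1), as [hh_bound] demands. *)
pose F k (j : int) := if (- (2 ^ k)%N%:Z <= j) && (j < (2 ^ k)%N%:Z) then
   hh ((z + j%:~R) / (2 ^ k.+1)%:R) / 4 ^+ k.+1 else 0.
have HF k : hsum (F k) (dyad k.+1 (z - (2 ^ k)%:R) / 4 ^+ k.+1).
  pose J := [seq i%:Z - (2 ^ k)%N%:Z | i <- index_iota 0 (2 ^ k.+1)].
  have -> : dyad k.+1 (z - (2 ^ k)%:R) / 4 ^+ k.+1 = \sum_(j <- J) F k j.
    rewrite /dyad mulr_suml big_map !big_nat; apply: eq_bigr => i /andP[_ ik].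
    rewrite /F ifT; last by move: ik; rewrite expnS; lia.
    by rewrite rmorphB /= -!pmulrn addrAC addrA.
  apply: hsum_seq; first by rewrite map_inj_uniq ?iota_uniq // => a b; lia.
  move=> j jJ; rewrite /F ifN //; apply: contra jJ => /andP[j1 j2].
  apply/mapP; exists (absz (j + (2 ^ k)%N)); rewrite ?mem_index_iota ?expnS; lia.
have bb : bsum (fun j : int => B * (cabs (z + j%:~R) ^+ 2)^-1).
  apply: bsum_scale => //.
  pose N := (Num.trunc (2 * cabs z)).+1.
  apply: (@bsum_fin _ _ _ (ints N)); first by move=> j; rewrite invr_ge0 sqr_ge0.
  apply: bsum_le (bsum_int (bsum_scale (_ : 0 <= 16) bsum_g32)) => // j.
  rewrite mem_ints; case: leqP => jN; first by rewrite lexx mulr_ge0 ?g32_ge0.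
  rewrite invr_ge0 sqr_ge0 /=.
  have jz : 2 * cabs z <= `|j|%N%:R.
    apply: ltW; apply: lt_le_trans (_ : (N%:R : R) <= _); last by rewrite ler_nat ltnW.
    by rewrite /N; have := truncnS_gt (2 * cabs z).
  have jc : cabs (j%:~R : C) = `|j|%N%:R.
    by rewrite -rC_int cabs_rC -intr_norm -abszE -pmulrn.
  have zj : `|j|%N%:R / 2 <= cabs (z + j%:~R).
    by have := cabs_sub (j%:~R : C) (- z); rewrite opprK cabsN jc (addrC _ z); lra.
  have j0 : 0 < `|j|%N%:R :> R by rewrite ltr0n; apply: leq_ltn_trans jN.
  have := inv_sqr_le `|j|%N; rewrite (_ : 16 * g32 _ = 4 * (4 * g32 `|j|%N)); last by ring.
  move=> G; apply: le_trans (ler_wpM2l (ler0n _ 4) G).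
  rewrite -[4]invrK -invfM lef_pV2 ?posrE ?exprn_gt0 ?mulr_gt0 ?invr_gt0 ?exprn_gt0 //; last first.
    by apply: lt_le_trans zj; rewrite divr_gt0.
  apply: (@le_trans _ _ ((`|j|%N%:R / 2) ^+ 2)); first by rewrite exprMn; lra.
  by rewrite lerXn2r ?nnegrE ?cabs_ge0 // divr_ge0 // ltW.
have FB k j : (k0 <= k)%N -> cabs (F k j) <= B * (cabs (z + j%:~R) ^+ 2)^-1.
  move=> /Hk0 kz; rewrite /F; case: ifP => [/andP[j1 j2]|_]; last first.
    by rewrite cabs0 mulr_ge0 // invr_ge0 sqr_ge0.
  have t0 : 0 < (2 ^ k.+1)%:R :> R by rewrite ltr0n expn_gt0.
  rewrite cabsM cabsV cabsX cabs_nat.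
  have cE : cabs ((z + j%:~R) / (2 ^ k.+1)%:R) = cabs (z + j%:~R) / (2 ^ k.+1)%:R.
    by rewrite cabsM cabsV cabs_nat.
  have := HB ((z + j%:~R) / (2 ^ k.+1)%:R); rewrite cE => H.
  have -> : B * (cabs (z + j%:~R) ^+ 2)^-1 =
     B * ((cabs (z + j%:~R) / (2 ^ k.+1)%:R) ^+ 2)^-1 / 4 ^+ k.+1.
    rewrite -four_pow.
    by rewrite -[RHS]mulrA -invfM -exprMn divfK // gt_eqF.
  rewrite ler_wpM2r ?invr_ge0 ?exprn_ge0 //; apply: H.
  rewrite -rC_int -rC_nat -rCV.
  have -> : complex.Re ((z + rC j%:~R) * rC (2 ^ k.+1)%:R^-1) = (complex.Re z + j%:~R) / (2 ^ k.+1)%:R.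
    by case: (z) => a b /=; ring.
  rewrite normrM normfV (gtr0_norm t0) ler_pdivrMr //.
  have jj : `|j%:~R| <= (2 ^ k)%:R :> R.
    rewrite -intr_norm (_ : (2 ^ k)%:R = (2 ^ k)%N%:Z%:~R) ?ler_int ?pmulrn //; lia.
  have := ler_normD (complex.Re z) (j%:~R : R); have := abs_Re z; move: jj kz.
  by rewrite expnS natrM; lra.
have lim j : ctends (fun k => F k j) ((2 * iC R * piC R) ^- 2 * (z + j%:~R) ^- 2).
  apply: ctends_ext (ctends_shift 1 (ctends_hh_dyadic (z + j%:~R))); exists `|j|%N.+1 => k jk.
  rewrite /F addn1 ifT //; have := ltn_expl k (ltnSn 1); lia.
have [s Hs] : exists s, hsum (fun j : int => (2 * iC R * piC R) ^- 2 * (z + j%:~R) ^- 2) s.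
  apply: asum_hsum; apply: asum_le_hsum bb => j.
  apply: ctends_le (lim j); exists k0 => k; exact: FB.
have Ls : s = L.
  have := tannery bb (fun k j => FB (k + k0)%N j (leq_addl _ _))
    (fun j => ctends_shift k0 (lim j)) (fun k => HF (k + k0)%N) Hs.
  by move=> T; apply: ctends_uniq T (ctends_shift k0 HL).
rewrite -Ls; apply: hsum_ext (hsum_scale _ Hs) => j.
by rewrite mulVKf // expf_neq0 // twopii_neq0.
Qed.

Lemma lipschitz_sum z : e z != 1 ->
  hsum (fun m : int => (z + m%:~R) ^- 2) ((2 * iC R * piC R) ^+ 2 * hh z).
Proof.
move=> z1; apply: lipschitz_aux; apply: ctends_ext (ctends_cst _); exists 0%N => k _.
have E : z - (2 ^ k)%:R = z + (- (2 ^ k)%N%:Z)%:~R by rewrite rmorphN /= -pmulrn.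
by rewrite dyadE E ?eDint // hhDint mulrAC mulfV ?mul1r // expf_neq0 ?pnatr_eq0.
Qed.

(** The term m = 0 is 0 by convention, so this is 2 zeta(2) = pi^2 / 3; the value -1/12 is the limit
    of [dyad_nat] divided by the power of 4. *)
Lemma lipschitz0 :
  hsum (fun m : int => (m%:~R : C) ^- 2) ((2 * iC R * piC R) ^+ 2 * - (1 / 12)).
Proof.
have := @lipschitz_aux 0 (- (1 / 12)); under [fun m => (0 + _) ^- 2]funext do rewrite add0r.
apply; apply: (@ctends_ext _ (fun k => 1 / 12 * ((1 / 4) ^+ k.+1 - 1))).
  exists 0%N => k _; have -> : 0 - (2 ^ k)%:R = (2 ^ k)%:R - (2 ^ k.+1)%:R :> C.
    by rewrite expnS natrM; ring.
  have S (n : nat) (w : C) : dyad k.+1 (w - n%:R) = dyad k.+1 w.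
    elim: n => [|n IH]; first by rewrite subr0.
    by rewrite -IH -(dyad_shift _ (w - n.+1%:R)) mulrSr; congr dyad; ring.
  rewrite S dyad_nat exprMn exprVn expr1n mul1r.
  have : 4 ^+ k.+1 != 0 :> C by rewrite expf_neq0 ?pnatr_eq0.
  by move: (4 ^+ k.+1) => x x0; field.
rewrite [X in ctends _ X](_ : _ = 1 / 12 * (0 - 1)); last by ring.
apply: ctends_scale; apply: ctends_sub (ctends_cst 1).
suff L : ctends (fun k => (1 / 4 : C) ^+ k) 0.
  by have := ctends_shift 1 L; apply: ctends_ext; exists 0%N => k _; rewrite addn1.
apply: (@ctends0_le _ _ (fun k => (k%:R + 1)^-1)).
  exists 0%N => k _; rewrite cabsX cabsM cabs1 cabsV cabs_nat mul1r exprVn.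
  have t0 : 0 < k%:R + 1 :> R by rewrite ltr_wpDl.
  rewrite lef_pV2 ?posrE ?exprn_gt0 //.
  by rewrite -natrX -mulrSr ler_nat; apply: ltn_expl.
move=> eps eps0; have ep : 0 <= eps^-1 by rewrite invr_ge0 ltW.
have HN := archi_boundP ep.
exists (Num.bound eps^-1) => n Nn.
have t0 : 0 < n%:R + 1 :> R by rewrite ltr_wpDl.
rewrite invf_plt ?posrE //.
by apply: lt_le_trans HN _; rewrite -mulrSr ler_nat (leq_trans Nn).
Qed.

End Lipschitz.

(** * Row sums of the Weierstrass function *)

Section Lattice.
Variable R : realType.
Local Notation C := (Cx R).
Local Notation e := (@e2ipi R).
Local Notation hh := (@hh R).
Implicit Types (z w t : C).

Lemma geom_small (r A : R) : 0 <= r -> r < 1 -> 0 <= A -> forall eps : R, 0 < eps ->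
  exists N, forall n, (N <= n)%N -> A * r ^+ n < eps.
Proof.
move=> r0 r1 A0 eps eps0; have d0 : 0 < 1 - r by lra.
have b0 : 0 <= A / (1 - r) / eps by rewrite !divr_ge0 // ltW.
have HN := archi_boundP b0; exists (Num.bound (A / (1 - r) / eps)).+1 => n Nn.
have n0 : 0 < n%:R :> R by rewrite ltr0n (leq_ltn_trans _ Nn).
rewrite -(ltr_pM2l n0) mulrCA; apply: (@le_lt_trans _ _ (A * (1 - r)^-1)).
  by rewrite ler_wpM2l // nat_geom_le.
rewrite -ltr_pdivrMr //; apply: lt_trans HN _; by rewrite ltr_nat.
Qed.

Lemma sum_int_le (b : nat -> R) (M : R) : (forall n, 0 <= b n) ->
  (forall n, \sum_(i < n) b i <= M) ->
  forall K : seq int, uniq K -> \sum_(m <- K) b `|m|%N <= M + M.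
Proof.
move=> b0 MH K uK.
have S (J : seq nat) : uniq J -> \sum_(i <- J) b i <= M.
  move=> uJ; pose n := (\max_(i <- J) i).+1.
  apply: le_trans (MH n); rewrite -(big_mkord xpredT b) (@sum_uniq_sub _ _ J (index_iota 0 n)) ?iota_uniq //.
    by rewrite lerDl sumr_ge0.
  move=> i iJ; rewrite mem_index_iota /= ltnS; exact: (@leq_bigmax_seq _ J xpredT id i iJ).
rewrite (bigID (fun m : int => 0 <= m)) /=; apply: lerD.
  rewrite -big_filter -(big_map absz xpredT b) S // map_inj_in_uniq ?filter_uniq //.
  by move=> m n; rewrite !mem_filter => /andP[? _] /andP[? _]; lia.
rewrite -big_filter -(big_map absz xpredT b) S // map_inj_in_uniq ?filter_uniq //.
by move=> m n; rewrite !mem_filter => /andP[? _] /andP[? _]; lia.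
Qed.

Lemma geom_sum_le (r : R) n : 0 <= r -> r < 1 -> \sum_(i < n) r ^+ i <= (1 - r)^-1.
Proof.
move=> r0 r1; have d0 : 0 < 1 - r by lra.
rewrite -[leLHS](mulfK (lt0r_neq0 d0)) mulrC -ler_pdivlMl ?invr_gt0 // invrK mulfV ?lt0r_neq0 //.
have := subrX1 r n; have := exprn_ge0 n r0.
move: (\sum_(i < n) _) => S; lra.
Qed.

Lemma hh_decay w : cabs (e w) <= 1 / 2 -> cabs (hh w) <= 4 * cabs (e w).
Proof.
move=> H; rewrite /hh cabsM cabsV cabsX mulrC ler_wpM2r ?cabs_ge0 //.
have : 1 / 2 <= cabs (1 - e w) by have := cabs_sub 1 (e w); rewrite cabs1; lra.
move=> H2; rewrite -[4]invrK lef_pV2 ?posrE ?invr_gt0 //; last by apply: exprn_gt0; lra.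
have -> : 4^-1 = (1 / 2) ^+ 2 :> R by field.
by rewrite lerXn2r ?nnegrE ?cabs_ge0.
Qed.

Lemma cabs_e_int t (n : int) : 0 < complex.Im t -> n != 0 -> e (n%:~R * t) != 1.
Proof.
move=> t0 n0; apply/eqP => /(congr1 (@cabs R)); rewrite cabs1 cabs_e -expR0 => /expR_inj/eqP.
rewrite oppr_eq0 mulf_eq0 mulf_eq0 gt_eqF //= gt_eqF ?pi_gt0 //=.
have -> : complex.Im (n%:~R * t) = n%:~R * complex.Im t.
  by rewrite -rC_int; case: (t) => a b /=; ring.
by rewrite mulf_eq0 intr_eq0 (negbTE n0) gt_eqF.
Qed.

Lemma cabs_et_lt1 t : 0 < complex.Im t -> cabs (e t) < 1.
Proof. by move=> t0; have := @cabs_e_lt1 R 1 t isT t0; rewrite divr1. Qed.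

(** [hh] is even and at most 4 |e(w)| where |e(w)| <= 1/2, so both tails are dominated by a
    geometric series in |e(t)|. *)
Lemma asum_hh z t : 0 < complex.Im t -> asum (fun n : int => hh (z + n%:~R * t)).
Proof.
move=> t0; set r := cabs (e t); have r0 : 0 <= r by apply: cabs_ge0.
have r1 : r < 1 by apply: cabs_et_lt1.
pose A := cabs (e z) + cabs (e (- z)).
have A0 : 0 <= A by rewrite addr_ge0 ?cabs_ge0.
have h0 : 0 < 1 / 2 :> R by rewrite divr_gt0.
have [N HN] := geom_small r0 r1 A0 h0.
apply: (@bsum_fin _ _ _ (ints N)); first by move=> n; apply: cabs_ge0.
apply: bsum_le (bsum_int (bsum_scale (_ : 0 <= 4 * A) (bsum_geom r0 r1))); last by rewrite mulr_ge0.
move=> n; rewrite mem_ints; case: leqP => nN.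
  by rewrite lexx !mulr_ge0 ?exprn_ge0.
rewrite cabs_ge0 /=.
have S w : cabs (e w) <= A -> cabs (hh (w + `|n|%N%:R * t)) <= 4 * A * r ^+ `|n|.
  move=> wA; have E : cabs (e (w + `|n|%N%:R * t)) <= A * r ^+ `|n|.
    by rewrite eD -eX cabsM cabsX ler_wpM2r ?exprn_ge0.
  rewrite -mulrA; apply: le_trans (hh_decay _) _; last by rewrite ler_wpM2l.
  by apply: le_trans E (ltW _); apply: HN; rewrite ltnW.
have [n0|n0] := leP 0 n.
  have -> : n%:~R = `|n|%N%:R :> C by rewrite -[in LHS](gez0_abs n0) -pmulrn.
  by apply: S; rewrite lerDl cabs_ge0.
have -> : z + n%:~R * t = - (- z + `|n|%N%:R * t).
  have nE : n = - `|n|%N%:Z by lia.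
  have -> : n%:~R = - `|n|%N%:R :> C by rewrite {1}nE rmorphN /= -pmulrn.
  by move: (_%:R : C) => k; ring.
by rewrite hhN; apply: S; rewrite lerDr cabs_ge0.
Qed.

(** Up to the factor (2 pi i)^2, term n is the Lipschitz sum of (z + n t + m)^-2 over the row n of Z
    + t Z. *)
Definition KK z t : C := summability.sum (fun n : int => hh (z + n%:~R * t)).
Definition TT t : C := KK 0 t.
(* TT t is twice the sum of the sigma(n) q^n, see TT_sig. *)
Definition E2 t : C := 1 - 12 * TT t.

Lemma KKP z t : 0 < complex.Im t -> hsum (fun n : int => hh (z + n%:~R * t)) (KK z t).
Proof.
by move=> t0; have [s Hs] := asum_hsum (asum_hh z t0); rewrite /KK (hsum_sum Hs).
Qed.

Lemma TTP t : 0 < complex.Im t -> hsum (fun n : int => hh (n%:~R * t)) (TT t).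
Proof. by move=> t0; apply: hsum_ext (KKP 0 t0) => n; rewrite add0r. Qed.

Lemma hsum_mod (N : nat) (f : int -> C) (s : 'I_N -> C) : (0 < N)%N ->
  (forall r : 'I_N, hsum (fun n : int => f (n * N%:Z + r%:Z)) (s r)) ->
  hsum f (\sum_r s r).
Proof.
move=> N0 H.
have Hr (r : 'I_N) : hsum (fun m : int => if (m %% N%:Z)%Z == r%:Z then f m else 0) (s r).
  apply: (@hsum_inj R int int _ _ (fun n => n * N%:Z + r%:Z)
     (fun m => if (m %% N%:Z)%Z == r%:Z then Some (m %/ N%:Z)%Z else None)).
  - have rN := ltn_ord r.
    move=> n; rewrite modzMDl modz_small ?eqxx; last by rewrite ltz_nat rN.
    by rewrite divzMDl ?divz_small ?addr0 ?ltz_nat ?rN // eqz_nat -lt0n.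
  - by move=> m /=; case: eqP => //= E; rewrite -E -divz_eq.
  - by move=> m; case: eqP.
  apply: hsum_ext (H r) => n /=; have rN := ltn_ord r.
  by rewrite modzMDl modz_small ?eqxx // ltz_nat rN.
have S (J : seq 'I_N) : hsum (fun m => \sum_(r <- J) (if (m %% N%:Z)%Z == r%:Z then f m else 0)) (\sum_(r <- J) s r).
  elim: J => [|r J IH].
    by rewrite big_nil; apply: hsum_ext (@hsum0 R int) => m; rewrite big_nil.
  by rewrite big_cons; apply: hsum_ext (hsum_add (Hr r) IH) => m; rewrite big_cons.
apply: hsum_ext (S _) => m.
have mN : (absz (m %% N%:Z)%Z < N)%N.
  have := ltz_pmod m (_ : 0 < N%:Z); have := @modz_ge0 m N%:Z; rewrite eqz_nat ltz_nat; lia.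
have mE : (m %% N%:Z)%Z = (Ordinal mN)%:Z.
  by rewrite /= gez0_abs // modz_ge0 // eqz_nat -lt0n.
rewrite mE (bigD1 (Ordinal mN)) //= eqxx big1 ?addr0 // => r rm.
by rewrite ifN // eqz_nat eq_sym.
Qed.

(** The rows of Z + t Z fall by n mod N into translates of the rows of Z + N t Z. *)
Lemma TT_mod (N : nat) t : (0 < N)%N -> 0 < complex.Im t ->
  TT t = \sum_(r < N) KK (r%:R * t) (N%:R * t).
Proof.
move=> N0 t0; apply: hsum_uniq (TTP t0) _; apply: hsum_mod => // r.
have Nt : 0 < complex.Im (N%:R * t).
  rewrite -rC_nat; case: (t) t0 => a b /= b0; rewrite mul0r addr0.
  by rewrite mulr_gt0 // ltr0n.
apply: hsum_ext (KKP (r%:R * t) Nt) => n; congr hh.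
by rewrite rmorphD rmorphM /= -!pmulrn; ring.
Qed.

Lemma KK_neg z t : 0 < complex.Im t -> KK (- z) t = KK z t.
Proof.
move=> t0; apply: hsum_uniq (KKP (- z) t0) _.
apply: hsum_ext (hsum_bij (@opprK int) (@opprK int) (KKP z t0)) => n /=.
by rewrite -[RHS]hhN; congr hh; rewrite rmorphN /=; ring.
Qed.

Lemma KK_add z t (m : int) : 0 < complex.Im t -> KK (z + m%:~R * t) t = KK z t.
Proof.
move=> t0; apply: hsum_uniq (KKP _ t0) _.
have := @hsum_bij R _ _ _ _ (fun n : int => n + m) (fun n => n - m) (fun n => addrK m n) (fun n => subrK m n) (KKP z t0).
by apply: hsum_ext => n /=; rewrite rmorphD /=; congr hh; ring.
Qed.

(** The imaginary part bounds |n|, then the triangle inequality bounds |m|. *)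
Lemma lattice_lower t : 0 < complex.Im t -> exists2 c : R, 0 < c &
  forall m n : int, c * (`|m|%N + `|n|%N)%:R <= cabs (m%:~R + n%:~R * t).
Proof.
move=> t0; set y := complex.Im t in t0 *; pose k := 1 + (1 + cabs t) / y.
have k0 : 0 < k by rewrite addr_gt0 // divr_gt0 // ltr_wpDr ?cabs_ge0.
exists k^-1; first by rewrite invr_gt0.
move=> m n; set W := cabs _.
have cint (j : int) : cabs (j%:~R : C) = `|j|%N%:R.
  by rewrite -rC_int cabs_rC -intr_norm -abszE -pmulrn.
have nW : `|n|%N%:R * y <= W.
  have := abs_Im (m%:~R + n%:~R * t); rewrite -/W; apply: le_trans.
  have -> : complex.Im (m%:~R + n%:~R * t) = n%:~R * y.
    by rewrite -!rC_int /y; case: (t) => a b /=; ring.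
  by rewrite normrM (gtr0_norm t0) -intr_norm -abszE -pmulrn.
have mW : `|m|%N%:R <= W + `|n|%N%:R * cabs t.
  have := cabs_add (m%:~R + n%:~R * t) (- (n%:~R * t)).
  by rewrite addrK cabsN cabsM !cint.
have nW' : `|n|%N%:R <= W / y by rewrite ler_pdivlMr.
rewrite mulrC ler_pdivrMr // natrD /k mulrDr mulr1 mulrA mulrDr mulr1 mulrDl.
have : `|n|%N%:R * cabs t <= W / y * cabs t by rewrite ler_wpM2r ?cabs_ge0.
by move: mW nW'; rewrite -!mulrA [y^-1 * cabs t]mulrC; lra.
Qed.

Local Notation lat p t := (p.1%:~R + p.2%:~R * t).

(** The difference is z (2w - z) / (w^2 (z - w)^2), at most 10 |z| / |w|^3 once |w| >= 2 |z|.
    Outside the finite [E], |w| is large enough for this, and |w| >= c (|m| + |n|) leads to the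
    product of two [g32]. *)
Lemma asum_wp z t : 0 < complex.Im t ->
  asum (fun p : int * int => (z - lat p t) ^- 2 - (lat p t) ^- 2).
Proof.
move=> t0; have [c c0 Hc] := lattice_lower t0.
pose N := (Num.trunc (2 * cabs z / c)).+1.
pose E : seq (int * int) := (0, 0) :: [seq (m, n) | m <- ints N, n <- ints N].
apply: (@bsum_fin _ _ _ E); first by move=> p; apply: cabs_ge0.
pose D := 10 * cabs z * 8 / c ^+ 3.
have c3 : 0 < c ^+ 3 by rewrite exprn_gt0.
have D0 : 0 <= D by rewrite divr_ge0 ?mulr_ge0 ?cabs_ge0 ?ler0n // ltW.
apply: bsum_le (bsum_scale D0 (bsum_prod (bsum_int (bsum_g32 R)) (bsum_int (bsum_g32 R)))) => -[m n].
case: ifP => [_|/negbT pE]; first by rewrite lexx mulr_ge0 // mulr_ge0 ?g32_ge0.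
rewrite cabs_ge0 /=; set w := m%:~R + n%:~R * t.
move: pE; rewrite inE negb_or => /andP[p0 pE].
have mn0 : (0 < `|m| + `|n|)%N.
  by move: p0; apply: contraNT; rewrite -leqNgt => H; apply/eqP; congr pair; lia.
have S0 : 0 < (`|m| + `|n|)%N%:R :> R by rewrite ltr0n.
have Sw : c * (`|m| + `|n|)%N%:R <= cabs w by apply: Hc.
have w0 : 0 < cabs w by apply: lt_le_trans Sw; rewrite mulr_gt0.
have zw : 2 * cabs z <= cabs w.
  apply: le_trans Sw; rewrite [leRHS]mulrC -ler_pdivrMr //; apply: ltW.
  apply: lt_le_trans (truncnS_gt _) _; rewrite -/N ler_nat.
  have : ~~ ((`|m| <= N)%N && (`|n| <= N)%N).
    apply: contra pE => /andP[mN nN]; apply/allpairsP; exists (m, n).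
    by split; rewrite ?mem_ints.
  lia.
have wz : cabs w / 2 <= cabs (z - w) by have := cabs_sub w z; rewrite (cabsB w); lra.
have wz0 : z - w != 0 by rewrite -cabs_gt0; apply: lt_le_trans wz; rewrite divr_gt0.
have w0' : w != 0 by rewrite -cabs_gt0.
have -> : (z - w) ^- 2 - w ^- 2 = z * (2 * w - z) / (w ^+ 2 * (z - w) ^+ 2).
  by field; rewrite wz0 w0'.
rewrite !cabsM cabsV cabsM !cabsX.
have h1 : cabs (2 * w - z) <= 5 / 2 * cabs w.
  have := cabs_add (2 * w) (- z); rewrite cabsN cabsM cabs_nat; lra.
have h2 : cabs w ^+ 2 / 4 <= cabs (z - w) ^+ 2.
  have -> : cabs w ^+ 2 / 4 = (cabs w / 2) ^+ 2 by field.
  by rewrite lerXn2r ?nnegrE ?cabs_ge0 // divr_ge0 // cabs_ge0.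
apply: (@le_trans _ _ (10 * cabs z / cabs w ^+ 3)).
  have -> : 10 * cabs z / cabs w ^+ 3 = cabs z * (5 / 2 * cabs w) / (cabs w ^+ 2 * (cabs w ^+ 2 / 4)).
    by field; rewrite gt_eqF.
  apply: ler_pM.
  - by rewrite mulr_ge0 ?cabs_ge0.
  - by rewrite invr_ge0 mulr_ge0 ?sqr_ge0.
  - by rewrite ler_wpM2l ?cabs_ge0.
  rewrite lef_pV2 ?posrE ?mulr_gt0 ?exprn_gt0 ?cabs_gt0 ?invr_gt0 //.
  by rewrite ler_wpM2l ?sqr_ge0.
have -> : D * (g32 R `|m| * g32 R `|n|) = 10 * cabs z * (8 / c ^+ 3 * (g32 R `|m| * g32 R `|n|)).
  by rewrite /D; ring.
rewrite ler_wpM2l ?mulr_ge0 ?cabs_ge0 //.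
set N1 := (_ + _)%N%:R in S0 Sw.
apply: (@le_trans _ _ ((c * N1) ^- 3)).
  rewrite lef_pV2 ?posrE ?exprn_gt0 ?mulr_gt0 //.
  by rewrite lerXn2r ?nnegrE ?cabs_ge0 // mulr_ge0 // ltW.
have F (x y : R) : x != 0 -> y != 0 -> (x * y) ^- 3 = 8 / x ^+ 3 * ((2 * y) ^- 3).
  by move=> x0 y0; field; rewrite x0 y0.
rewrite (F c N1) ?gt_eqF // {F}.
rewrite ler_wpM2l ?divr_ge0 ?(ltW c3) // /g32 -invfM lef_pV2 ?posrE ?exprn_gt0 ?mulr_gt0 ?sqrtr_gt0 ?ltr0n //.
have bnd (j : nat) : (0 < j.+1 <= 2 * (`|m| + `|n|))%N -> j.+1%:R * Num.sqrt j.+1%:R <= 2 * N1 * Num.sqrt (2 * N1).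
  move=> /andP[_ jN]; have jN' : j.+1%:R <= 2 * N1 by rewrite -natrM ler_nat.
  have N0 : 0 < 2 * N1 by rewrite mulr_gt0.
  apply: ler_pM; [exact: ler0n|exact: sqrtr_ge0|exact: jN'|exact: ler_wsqrtr].
have -> : (2 * N1) ^+ 3 = (2 * N1 * Num.sqrt (2 * N1)) * (2 * N1 * Num.sqrt (2 * N1)).
  have := @sqr_sqrtr R (2 * N1) (ltW (mulr_gt0 (ltr0n _ 2) S0)).
  by move: (Num.sqrt _) => s sE; rewrite exprS -[in X in X * (2 * N1) ^+ 2]sE; ring.
have nn (j : nat) : 0 <= j.+1%:R * Num.sqrt j.+1%:R :> R by rewrite mulr_ge0 ?ler0n ?sqrtr_ge0.
apply: (ler_pM (nn _) (nn _)); apply: bnd.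
  by clear -mn0; rewrite mulnDr; lia.
by clear -mn0; rewrite mulnDr; lia.
Qed.

(** At the index (0, 0) the summand is z^-2 - 0^-2 = z^-2, which is the polar term of
    [weierstrass_p]. *)
Lemma wp_hsum z t : 0 < complex.Im t ->
  hsum (fun p : int * int => (z - lat p t) ^- 2 - (lat p t) ^- 2) (weierstrass_p z t).
Proof.
move=> t0; have [s Hs] := asum_hsum (asum_wp z t0).
have H1 := @hsum_seq R _ (fun p : int * int => if p == (0, 0) then z ^- 2 else 0) [:: (0, 0)] isT.
have {}H1 := H1 (fun p pn => ltac:(by move: pn; rewrite inE => /negbTE ->)).
rewrite big_seq1 eqxx in H1.
have H2 := hsum_sub Hs H1.
have -> : weierstrass_p z t = s; last exact: Hs.
rewrite /weierstrass_p -[RHS](subrK (z ^- 2)) addrC; congr (_ + _).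
apply: hsum_sum; apply: hsum_ext H2 => p /=; case: eqP => [->|_]; last by rewrite subr0.
by rewrite /= mul0r addr0 subr0 expr0n invr0 subr0 subrr.
Qed.

Lemma Im_mulr_gt0 (x : R) t : 0 < x -> 0 < complex.Im t -> 0 < complex.Im (rC x * t).
Proof. by case: t => a b /= x0 b0; rewrite mul0r addr0 mulr_gt0. Qed.

(* Summing over the rows first, by the Lipschitz formula. *)
Lemma wp_row z t : 0 < complex.Im t -> (forall n : int, e (z + n%:~R * t) != 1) ->
  weierstrass_p z t = (2 * iC R * piC R) ^+ 2 * (KK z t - TT t + 1 / 12).
Proof.
move=> t0 zt; set c := (2 * iC R * piC R) ^+ 2.
have Hw := hsum_bij (fun p : int * int => let: (a, b) := p in erefl)
   (fun p : int * int => let: (a, b) := p in erefl) (wp_hsum z t0)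
   (p := fun p : int * int => (p.2, p.1)) (q := fun p : int * int => (p.2, p.1)).
have Aw : asum ((fun p : int * int => (z - lat p t) ^- 2 - (lat p t) ^- 2) \o (fun p : int * int => (p.2, p.1))).
  apply: bsum_inj (asum_wp z t0); by move=> [a b] [a' b'] [-> ->].
have rows (n : int) : hsum (fun m : int => (z - (m%:~R + n%:~R * t)) ^- 2 - (m%:~R + n%:~R * t) ^- 2)
    (c * (hh (z - n%:~R * t) - hh (n%:~R * t) + if n == 0 then 1 / 12 else 0)).
  have z1 : e (z - n%:~R * t) != 1 by rewrite -mulNr -rmorphN; apply: zt.
  have H1 := hsum_bij (@opprK int) (@opprK int) (lipschitz_sum z1).
  (* In the row n = 0 the w^-2 add up to 2 zeta(2) although hh 0 = 0; this is the source of the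
     constant 1/12. *)
  have H2 : hsum (fun m : int => (m%:~R + n%:~R * t) ^- 2) (c * (hh (n%:~R * t) - if n == 0 then 1 / 12 else 0)).
    case: eqP => [->|/eqP n0].
      rewrite mul0r hh0 sub0r; apply: hsum_ext (@lipschitz0 R) => m; by rewrite addr0.
    by rewrite subr0; apply: hsum_ext (lipschitz_sum (cabs_e_int t0 n0)) => m; rewrite addrC.
  have -> : c * (hh (z - n%:~R * t) - hh (n%:~R * t) + (if n == 0 then 1 / 12 else 0)) =
    c * hh (z - n%:~R * t) - c * (hh (n%:~R * t) - (if n == 0 then 1 / 12 else 0)) by ring.
  apply: hsum_ext (hsum_sub H1 H2) => m /=; congr (_ ^- 2 - _).
  by rewrite rmorphN /=; ring.
have [Hs _] := hsum_sigma Aw Hw rows.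
apply: hsum_uniq Hs _; apply: hsum_scale; apply: hsum_add.
  apply: hsum_sub (TTP t0).
  have := hsum_bij (@opprK int) (@opprK int) (KKP z t0).
  by apply: hsum_ext => n /=; rewrite rmorphN mulNr.
have := @hsum_seq R _ (fun n : int => if n == 0 then 1 / 12 else 0) [:: 0] isT.
rewrite big_seq1 eqxx; apply=> n; by rewrite inE => /negbTE ->.
Qed.

Lemma Im_neg_inv t : 0 < complex.Im t -> 0 < complex.Im (- t^-1).
Proof.
case: t => a b /= b0; rewrite opprK divr_gt0 // ltr_wpDl ?sqr_ge0 //.
by rewrite exprn_gt0.
Qed.

Lemma Im_neq0 t : 0 < complex.Im t -> t != 0.
Proof. by apply: contraTneq => ->; rewrite /= ltxx. Qed.

(** Homogeneity of degree -2: multiplication by t carries the lattice of -1/t onto that of t. *)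
Lemma wp_S z t : 0 < complex.Im t ->
  weierstrass_p (z / t) (- t^-1) = t ^+ 2 * weierstrass_p z t.
Proof.
move=> t0; have tn := Im_neq0 t0.
apply: hsum_uniq (wp_hsum _ (Im_neg_inv t0)) _.
have pK : cancel (fun p : int * int => (- p.2, p.1)) (fun p : int * int => (p.2, - p.1)).
  by move=> [a b] /=; rewrite opprK.
have qK : cancel (fun p : int * int => (p.2, - p.1)) (fun p : int * int => (- p.2, p.1)).
  by move=> [a b] /=; rewrite opprK.
have := hsum_scale (t ^+ 2) (hsum_bij pK qK (wp_hsum z t0)).
apply: hsum_ext => -[m n] /=; rewrite rmorphN /=.
set w := - n%:~R + m%:~R * t.
have -> : m%:~R + n%:~R * - t^-1 = w / t by rewrite /w; field.
have dv (a : C) : (a / t) ^- 2 = a ^- 2 * t ^+ 2 by rewrite exprMn invfM exprVn invrK.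
by rewrite -[z / t - _]mulrBl !dv -mulrBl mulrC.
Qed.

Lemma TT_rel N t : 0 < complex.Im t -> (0 < N)%N -> 0 < complex.Im (N%:R * t).
Proof. by move=> t0 N0; rewrite -rC_nat; apply: Im_mulr_gt0; rewrite ?ltr0n. Qed.

(** t is a half-period of Z + 2t Z, and KK(t, 2t) collects the odd rows of Z + t Z, so it equals
    TT(t) - TT(2t) by [TT_mod]. *)
Lemma wp_2 t : 0 < complex.Im t ->
  weierstrass_p t (2 * t) = (2 * iC R * piC R) ^+ 2 * (1 / 12) * (2 * E2 (2 * t) - E2 t).
Proof.
move=> t0; have t2 := TT_rel t0 (isT : (0 < 2)%N).
rewrite wp_row //; last first.
  move=> n; have -> : t + n%:~R * (2 * t) = (n * 2 + 1)%:~R * t.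
    by rewrite rmorphD rmorphM /=; ring.
  by apply: cabs_e_int => //; lia.
have := TT_mod (isT : (0 < 2)%N) t0; rewrite !big_ord_recr big_ord0 /= mul0r !mul1r add0r -/(TT _).
move=> E; rewrite /E2 E; move: ((2 * iC R * piC R) ^+ 2) (TT _) (KK _ _) => c x y; by field.
Qed.

(** The two nonzero residues mod 3 give equal row sums because [KK] is even and periodic, so each is
    half of TT(t) - TT(3t); hence 1/24 in place of 1/12. *)
Lemma wp_3 t : 0 < complex.Im t ->
  weierstrass_p t (3 * t) = (2 * iC R * piC R) ^+ 2 * (1 / 24) * (3 * E2 (3 * t) - E2 t).
Proof.
move=> t0; have t3 := TT_rel t0 (isT : (0 < 3)%N).
rewrite wp_row //; last first.
  move=> n; have -> : t + n%:~R * (3 * t) = (n * 3 + 1)%:~R * t.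
    by rewrite rmorphD rmorphM /=; ring.
  by apply: cabs_e_int => //; lia.
have := TT_mod (isT : (0 < 3)%N) t0; rewrite !big_ord_recr big_ord0 /= mul0r !mul1r add0r -/(TT _).
have -> : KK (2 * t) (3 * t) = KK t (3 * t).
  have -> : 2 * t = - t + 1%:~R * (3 * t) by ring.
  by rewrite KK_add // KK_neg.
move=> E; rewrite /E2 E; move: ((2 * iC R * piC R) ^+ 2) (TT _) (KK _ _) => c x y; by field.
Qed.

Definition dS t := t ^- 2 * E2 (- t^-1) - E2 t.

(** The p-function converges absolutely, so [wp_S] exchanges rows and columns; comparing its two row
    expansions expresses the defect by [KK] alone, at any z off the lattice. *)
Lemma dS_KK z t : 0 < complex.Im t -> (forall m n : int, z != m%:~R + n%:~R * t) ->
  dS t / 12 = KK z t - t ^- 2 * KK (z / t) (- t^-1).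
Proof.
move=> t0 zt; have tn := Im_neq0 t0.
have z1 (n : int) : e (z + n%:~R * t) != 1.
  apply/eqP => /e_eq1[m E]; have := zt m (- n); rewrite rmorphN mulNr -E addrK eqxx //.
have z2 (n : int) : e (z / t + n%:~R * - t^-1) != 1.
  apply/eqP => /e_eq1[m E]; have := zt n m; rewrite -E.
  by rewrite (_ : n%:~R + (z / t + n%:~R * - t^-1) * t = z) ?eqxx //; field.
have := wp_S z t0; rewrite (wp_row t0 z1) (wp_row (Im_neg_inv t0) z2).
have c0 : (2 * iC R * piC R) ^+ 2 != 0 by rewrite expf_neq0 // twopii_neq0.
rewrite mulrCA => /(mulfI c0) E; rewrite /dS /E2.
have -> : TT (- t^-1) = KK (z / t) (- t^-1) + 1 / 12 - t ^+ 2 * (KK z t - TT t + 1 / 12).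
  by rewrite -E; move: (KK _ _) => x; ring.
by move: (KK z t) (KK _ _) (TT t) => x y u; field.
Qed.

Lemma offlat z t : 0 < complex.Im t -> complex.Im z = complex.Im t / 2 ->
  forall m n : int, z != m%:~R + n%:~R * t.
Proof.
move=> t0 zt m n; apply/eqP => E; move: zt; rewrite E.
have -> : complex.Im (m%:~R + n%:~R * t) = n%:~R * complex.Im t.
  by rewrite -!rC_int; case: (t) => a b /=; ring.
move: (complex.Im t) t0 => y y0 H.
have : (n * 2)%:~R = 1%:~R :> R.
  by apply: (mulIf (lt0r_neq0 y0)); rewrite intrM mulrAC H; field.
by move=> /intr_inj; lia.
Qed.

Lemma Im_divn z (k : nat) : complex.Im (z / k%:R) = complex.Im z / k%:R.
Proof. by rewrite -rC_nat -rCV; case: z => a b /=; ring. Qed.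

(** Among the rows of step 1/(2t), the even ones start from z/t with step 1/t, the odd ones from (z
    + 1/2)/t up to one step. *)
Lemma KK_S_double z t : 0 < complex.Im t ->
  KK (z / t) (- t^-1) + KK ((z + 1 / 2) / t) (- t^-1) = KK (2 * z / (2 * t)) (- (2 * t)^-1).
Proof.
move=> t0; have tn := Im_neq0 t0; have t2 := TT_rel t0 (isT : (0 < 2)%N).
have i0 := Im_neg_inv t0; have i2 := Im_neg_inv t2.
apply: esym; apply: hsum_uniq (KKP _ i2) _.
have := @hsum_mod 2 (fun n : int => hh (2 * z / (2 * t) + n%:~R * - (2 * t)^-1))
  (fun r => if r == 0 then KK (z / t) (- t^-1) else KK ((z + 1 / 2) / t) (- t^-1)) isT.
rewrite !big_ord_recl big_ord0 addr0 /=; apply => -[[|[|//]] i] /=.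
  apply: hsum_ext (KKP _ i0) => n; congr hh.
  by rewrite addr0 rmorphM /=; field.
rewrite -(KK_add _ 1 i0); apply: hsum_ext (KKP _ i0) => n; congr hh.
by rewrite rmorphD rmorphM /=; field.
Qed.

(** [dS_KK] is used at z = t/2 and at z + 1/2: [hh_dup] merges the two sums at t into the sum of 2z
    at 2t, and on the transformed side the two interlace by [KK_S_double]. *)
Lemma dS_double t : 0 < complex.Im t -> dS t = 2 * dS (2 * t).
Proof.
move=> t0; have tn := Im_neq0 t0; have t2 := TT_rel t0 (isT : (0 < 2)%N).
pose z := t / 2.
have Imz : complex.Im z = complex.Im t / 2 by rewrite /z Im_divn.
have Imz' : complex.Im (z + 1 / 2) = complex.Im t / 2.
  by rewrite ImD Imz (_ : (1 / 2 : C) = rC (1 / 2)) /= ?addr0 // rCM rC1 rCV rC_nat.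
have Im2 : complex.Im (2 * z) = complex.Im (2 * t) / 2.
  by rewrite /z -rC_nat -rCV; case: (t) => a b /=; field.
have off1 := offlat t0 Imz; have off2 := offlat t0 Imz'; have off3 := offlat t2 Im2.
have A : KK z t + KK (z + 1 / 2) t = 4 * KK (2 * z) (2 * t).
  apply: hsum_uniq (hsum_add (KKP z t0) (KKP (z + 1 / 2) t0)) _.
  apply: hsum_ext (hsum_scale 4 (KKP (2 * z) t2)) => n.
  rewrite -hh_dup; first by congr (hh _ + hh _); field.
  apply/eqP => /e_eq1[m E]; have := off3 m (- n).
  by rewrite -E rmorphN mulNr addrK eqxx.
have := dS_KK t0 off1; have := dS_KK t0 off2; have := dS_KK t2 off3.
rewrite -KK_S_double // exprMn invfM.
move: (KK z t) (KK (z + 1 / 2) t) (KK (2 * z) (2 * t)) A (KK (z / t) _) (KK ((z + 1 / 2) / t) _) => a b c A x y E1 E2' E3.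
have E4 : dS t / 12 + dS t / 12 = 4 * c - t ^- 2 * (x + y).
  by rewrite {1}E3 E2' -A; ring.
have : dS t = 6 * (4 * c - t ^- 2 * (x + y)) by rewrite -E4; field.
have -> : dS (2 * t) = 12 * (c - 2 ^- 2 * t ^- 2 * (x + y)) by rewrite -E1; field.
by move=> ->; field.
Qed.

End Lattice.

(** * The transformation of E_2 under S *)

Section E2Transform.
Variable R : realType.
Local Notation C := (Cx R).
Local Notation e := (@e2ipi R).
Local Notation hh := (@hh R).
Local Notation c2 := (2 * iC R * piC R).
Implicit Types (z w t : C).

Lemma hsum_ints (f : int -> C) s : hsum f s -> ctends (fun B => \sum_(n <- ints B) f n) s.
Proof.
move=> H eps eps0; have [J HJ] := H _ eps0; exists (\max_(j <- J) `|j|%N) => B JB.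
apply: HJ; first by rewrite map_inj_uniq ?iota_uniq // => a b; lia.
move=> j jJ; rewrite mem_ints; apply: leq_trans JB.
exact: (@leq_bigmax_seq _ J xpredT absz j jJ).
Qed.

Lemma sum_ints_telescope (P : int -> C) B :
  \sum_(n <- ints B) (P (n + 1) - P n) = P (B%:Z + 1) - P (- B%:Z).
Proof.
rewrite big_map.
have S m : \sum_(i <- iota 0 m) (P (i%:Z - B%:Z + 1) - P (i%:Z - B%:Z)) = P (m%:Z - B%:Z) - P (- B%:Z).
  elim: m => [|m IH]; first by rewrite big_nil sub0r subrr.
  rewrite -addn1 iotaD big_cat /= big_seq1 IH add0n.
  have -> : (m + 1)%N%:Z - B%:Z = m%:Z - B%:Z + 1 by lia.
  by rewrite addrC addrA subrK.
rewrite S; congr (P _ - _); rewrite -addnn; lia.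
Qed.

(** s -> e(s/t) is a logarithmic spiral through 1: for small s its argument stays within pi/2, for
    the other s its modulus stays away from 1, so it keeps off -1. *)
Lemma spiral_lower t : 0 < complex.Im t -> exists2 c : R, 0 < c &
  forall s : R, c * (1 + cabs (e (rC s / t))) <= cabs (1 + e (rC s / t)).
Proof.
move=> t0; pose a : R := - (2 * pi * complex.Im t^-1); pose b : R := 2 * pi * complex.Re t^-1.
have a0 : 0 < a.
  have : 0 < complex.Im (- t^-1) := Im_neg_inv t0.
  have -> : complex.Im (- t^-1) = - complex.Im t^-1 by case: (t^-1).
  by move=> i0; rewrite /a -mulrN mulr_gt0 // mulr_gt0 ?pi_gt0.
have eE s : e (rC s / t) = cexp (Complex (a * s) (b * s)).
  rewrite e2ipiE; congr cexp; rewrite /a /b; move: (pi : R) => p.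
  by case: (t^-1) => x y /=; apply/eqP; rewrite eq_complex /=; apply/andP; split; apply/eqP; ring.
pose s0 : R := pi / 2 / (`|b| + 1); pose r0 := expR (a * s0).
have s00 : 0 < s0 by rewrite !divr_gt0 ?pi_gt0 // ltr_wpDl.
have r01 : 1 < r0 by rewrite /r0 expR_gt1 mulr_gt0.
pose c := Num.min (1 / 2) ((r0 - 1) / (r0 + 1)).
have c0 : 0 < c by rewrite lt_min !divr_gt0 //; lra.
exists c => // s; set rho := cabs _; have rE : rho = expR (a * s) by rewrite /rho eE cabs_cexp.
have rp : 0 < rho by rewrite rE expR_gt0.
have [ss|ss] := ltP `|s| s0.
  have cs : 0 <= cos (b * s).
    rewrite -cos_norm cos_ge0_pihalf //; have n0 := normr_ge0 (b * s).
    have : `|b * s| <= pi / 2.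
      rewrite normrM; apply: le_trans (_ : (`|b| + 1) * s0 <= _).
        apply: ler_pM => //; last exact: ltW.
        by rewrite lerDl.
      by rewrite /s0 mulrC divfK // gt_eqF // ltr_wpDl.
    by have := pi_gt0 R; move=> *; apply/andP; split; lra.
  apply: (@le_trans _ _ (1 / 2 * (1 + rho))).
    by rewrite ler_wpM2r /c ?ge_min ?lexx // addr_ge0 // ltW.
  rewrite -(@ler_pXn2r _ 2) ?nnegrE ?cabs_ge0 ?mulr_ge0 ?addr_ge0 // ?(ltW rp) //.
  rewrite [leRHS]cabs_sqr eE /cexp /= -rE add0r.
  have := cos2Dsin2 (b * s); move: cs; move: (cos _) (sin _) => C' S' cs CS.
  have -> : (1 + rho * C') ^+ 2 + (rho * S') ^+ 2 = 1 + 2 * rho * C' + rho ^+ 2 * (C' ^+ 2 + S' ^+ 2) by ring.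
  rewrite CS mulr1; have : 0 <= rho * C' by rewrite mulr_ge0 // ltW.
  nra.
apply: (@le_trans _ _ ((r0 - 1) / (r0 + 1) * (1 + rho))).
  by rewrite ler_wpM2r /c ?ge_min ?lexx ?orbT // addr_ge0 // ltW.
have d0 : 0 < r0 + 1 by lra.
rewrite mulrAC ler_pdivrMr //.
have [sp|sn] := leP 0 s.
  rewrite ger0_norm // in ss.
  have rr : r0 <= rho by rewrite rE ler_expR ler_pM2l.
  have := cabs_sub (e (rC s / t)) (-1); rewrite opprK cabsN cabs1 -/rho (addrC (e _) 1).
  move: (cabs (1 + _)) => q hq.
  have h1 : (r0 - 1) * (1 + rho) <= (rho - 1) * (r0 + 1) by move: rr; clear; move: r0 rho => p' q' h; nra.
  by apply: le_trans h1 _; rewrite ler_pM2r.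
rewrite ltr0_norm // in ss.
have rr : rho * r0 <= 1.
  rewrite rE /r0 -expRD -expR0 ler_expR -mulrDr.
  by rewrite pmulr_rle0 //; lra.
have := cabs_sub 1 (- e (rC s / t)); rewrite opprK cabsN cabs1 -/rho.
move: (cabs (1 + _)) => q hq.
have h1 : (r0 - 1) * (1 + rho) <= (1 - rho) * (r0 + 1) by move: rr; clear; move: r0 rho => p' q' h; nra.
by apply: le_trans h1 _; rewrite ler_pM2r.
Qed.

(* The Riemann sum of the integrable function hh(1/2 + s/t) over the real
   line, of mesh 1/M, compared with the telescoping sum of its primitive. *)
Lemma riemann_hh t : 0 < complex.Im t -> exists2 B : R, 0 <= B & forall M : nat, (0 < M)%N ->
  cabs (c2 / (M%:R * t) * KK (1 / 2) (- (M%:R * t)^-1) + 1) <= B / M%:R.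
Proof.
move=> t0; have tn := Im_neq0 t0; have [c c0 Hc] := spiral_lower t0.
pose r0 := cabs (c2 / t); have r00 : 0 <= r0 by apply: cabs_ge0.
pose A1 := 4 * r0 ^+ 2 * expR r0.
have A10 : 0 <= A1 by rewrite !mulr_ge0 ?sqr_ge0 ?expR_ge0.
pose A := A1 + r0 * (r0 + A1).
have A0 : 0 <= A by rewrite addr_ge0 // mulr_ge0 // addr_ge0.
pose a : R := - (2 * pi * complex.Im t^-1).
have a0 : 0 < a.
  have : 0 < complex.Im (- t^-1) := Im_neg_inv t0.
  have -> : complex.Im (- t^-1) = - complex.Im t^-1 by case: (t^-1).
  by move=> i0; rewrite /a -mulrN mulr_gt0 // mulr_gt0 ?pi_gt0.
have c30 : 0 < c ^+ 3 by rewrite exprn_gt0.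
exists (A / c ^+ 3 * ((1 + a) / a + (1 + a) / a)).
  have aa : 0 <= (1 + a) / a by rewrite divr_ge0 ?addr_ge0 // ltW.
  exact: mulr_ge0 (divr_ge0 A0 (ltW c30)) (addr_ge0 aa aa).
move=> M M0; have MR0 : 0 < M%:R :> R by rewrite ltr0n.
have MR1 : 1 <= M%:R :> R by rewrite ler1n.
have MC0 : M%:R != 0 :> C by rewrite pnatr_eq0 -lt0n.
have T0 : 0 < complex.Im (M%:R * t) by apply: TT_rel.
set ep := (M%:R * t)^-1; have epE : ep = rC M%:R^-1 / t by rewrite /ep invfM rCV rC_nat.
pose x := e ep; pose X := cabs x.
pose u (n : int) := e (1 / 2 + n%:~R * ep).
have uE n : u n = - e (rC (n%:~R / M%:R) / t).
  rewrite /u eD e_half mulN1r; congr (- e _).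
  by rewrite epE rCM rC_int; ring.
have uS n : u (n + 1) = u n * x by rewrite /u /x -eD; congr e; rewrite rmorphD /=; ring.
have low n : c * (1 + cabs (u n)) <= cabs (1 - u n) by rewrite uE opprK cabsN.
have u1 n : 1 - u n != 0.
  rewrite -cabs_gt0; apply: lt_le_trans (low n); rewrite mulr_gt0 //.
  by rewrite ltr_wpDr ?cabs_ge0.
have XE : X = expR (a / M%:R).
  rewrite /X /x epE cabs_e; congr expR.
  have -> : complex.Im (rC M%:R^-1 / t) = M%:R^-1 * complex.Im t^-1.
    by case: (t^-1) => p q /=; ring.
  by rewrite /a; move: (pi : R) => p; ring.
have X1 : 1 < X by rewrite XE expR_gt1 divr_gt0.
have Xp : 0 < X by lra.
pose y := X^-1; have y0 : 0 < y by rewrite invr_gt0.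
have y1 : y < 1 by rewrite invf_lt1.
have uX n : cabs (u n) = if 0 <= n then X ^+ `|n| else y ^+ `|n|.
  have nat_case (m : nat) : cabs (u m%:Z) = X ^+ m.
    rewrite /u eD e_half mulN1r cabsN -pmulrn -eX cabsX; by [].
  case: n => m; first by rewrite nat_case.
  rewrite NegzE /= /u eD e_half mulN1r cabsN rmorphN /= mulNr eN cabsV -pmulrn -eX cabsX.
  by rewrite /y exprVn.
have rho_le n : cabs (u n) / (1 + cabs (u n)) ^+ 2 <= y ^+ `|n|.
  have r1 : 0 <= cabs (u n) := cabs_ge0 _.
  have d0 : 0 < (1 + cabs (u n)) ^+ 2 by rewrite exprn_gt0 // ltr_wpDr.
  rewrite ler_pdivrMr //; rewrite uX; case: ifP => _.
    have p0 : 0 < X ^+ `|n| by rewrite exprn_gt0.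
    rewrite /y exprVn mulrC ler_pdivlMr //; move: (X ^+ _) p0 => p p0; nra.
  have p0 : 0 < y ^+ `|n| by rewrite exprn_gt0.
  move: (y ^+ _) p0 => p p0; nra.
(* The derivative of (1 - u)^-1 with respect to log u is u / (1 - u)^2, so [P] is the primitive and
   [D] the local error of one mesh step. It is of order M^-2 and decays geometrically in |n|. *)
pose P n := (1 - u n)^-1.
pose D n := P (n + 1) - P n - c2 * ep * hh (1 / 2 + n%:~R * ep).
have w0 : cabs (c2 * ep) = r0 / M%:R.
  by rewrite epE rCV rC_nat mulrCA cabsM cabsV cabs_nat -/r0 mulrC.
have q1 : cabs (x - 1 - c2 * ep) <= A1 / M%:R ^+ 2.
  have -> : x = cexp (c2 * ep) by [].
  apply: le_trans (cexp_quad _) _; rewrite w0 expr_div_n /A1 mulrA [leRHS]mulrAC.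
  rewrite ler_wpM2l //; first by rewrite divr_ge0 ?mulr_ge0 ?sqr_ge0.
  by rewrite ler_expR ler_pdivrMr // ler_peMr.
have q2 : cabs (c2 * ep * (x - 1)) <= r0 * (r0 + A1) / M%:R ^+ 2.
  rewrite cabsM w0; have : cabs (x - 1) <= (r0 + A1) / M%:R.
    have := cabs_add (x - 1 - c2 * ep) (c2 * ep); rewrite subrK w0 => H.
    apply: le_trans H _; rewrite [leLHS]addrC [leRHS]mulrDl lerD2l; apply: le_trans q1 _.
    rewrite ler_wpM2l // lef_pV2 ?posrE ?exprn_gt0 //.
    by rewrite expr2 ler_peMl // ltW.
  move=> H; have -> : r0 * (r0 + A1) / M%:R ^+ 2 = r0 / M%:R * ((r0 + A1) / M%:R).
    by field; rewrite gt_eqF.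
  by rewrite ler_wpM2l // divr_ge0 // ltW.
have Db n : cabs (D n) <= A / c ^+ 3 / M%:R ^+ 2 * y ^+ `|n|.
  have DE : D n = u n * ((x - 1 - c2 * ep) * (1 - u n) + c2 * ep * (x - 1) * u n) /
     ((1 - u n) ^+ 2 * (1 - u (n + 1))).
    have n1 := u1 (n + 1); have n0 := u1 n; move: n1 n0.
    rewrite /D /P /hh -/(u n) uS; move: (u n) (c2 * ep) (x) => v w x'.
    by move=> n1 n0; field; rewrite n0 n1.
  set rho := cabs (u n) in rho_le *; have r1 : 0 <= cabs (u n) := cabs_ge0 _.
  have num : cabs ((x - 1 - c2 * ep) * (1 - u n) + c2 * ep * (x - 1) * u n) <= A / M%:R ^+ 2 * (1 + cabs (u n)).
    apply: le_trans (cabs_add _ _) _; rewrite !(cabsM _ (1 - u n)) (cabsM _ (u n)).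
    have h1 : cabs (1 - u n) <= 1 + cabs (u n).
      by have := cabs_add 1 (- u n); rewrite cabsN cabs1.
    have h2 : cabs (u n) <= 1 + cabs (u n) by rewrite lerDr.
    have -> : A / M%:R ^+ 2 * (1 + cabs (u n)) = A1 / M%:R ^+ 2 * (1 + cabs (u n)) +
       r0 * (r0 + A1) / M%:R ^+ 2 * (1 + cabs (u n)) by rewrite /A !mulrDl.
    by apply: lerD; apply: ler_pM; rewrite ?cabs_ge0.
  have den : c ^+ 3 * (1 + cabs (u n)) ^+ 3 <= cabs ((1 - u n) ^+ 2 * (1 - u (n + 1))).
    rewrite cabsM cabsX -exprMn exprSr.
    have cp : 0 <= c * (1 + cabs (u n)) by rewrite mulr_ge0 ?addr_ge0 // ltW.
    apply: ler_pM => //; first exact: exprn_ge0.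
      by rewrite lerXn2r ?nnegrE ?cabs_ge0.
    apply: le_trans (low _); rewrite ler_wpM2l // ?(ltW c0) // lerD2l uS cabsM -/X.
    by rewrite ler_peMr // ltW.
  have rp : 0 < 1 + cabs (u n) by rewrite ltr_wpDr.
  rewrite DE cabsM cabsV cabsM; apply: (@le_trans _ _
    (cabs (u n) * (A / M%:R ^+ 2 * (1 + cabs (u n))) / (c ^+ 3 * (1 + cabs (u n)) ^+ 3))).
    apply: ler_pM; rewrite ?invr_ge0 ?cabs_ge0 ?mulr_ge0 ?cabs_ge0 ?ler_wpM2l //.
    by rewrite lef_pV2 ?posrE //; [apply: lt_le_trans den|]; rewrite mulr_gt0 // exprn_gt0.
  have -> : cabs (u n) * (A / M%:R ^+ 2 * (1 + cabs (u n))) / (c ^+ 3 * (1 + cabs (u n)) ^+ 3) =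
    A / c ^+ 3 / M%:R ^+ 2 * (cabs (u n) / (1 + cabs (u n)) ^+ 2).
    by field; rewrite !gt_eqF.
  rewrite ler_wpM2l //; first by rewrite divr_ge0 ?sqr_ge0 // divr_ge0 // ltW.
have yS N : \sum_(i < N) y ^+ i <= (1 - y)^-1 by apply: geom_sum_le => //; apply: ltW.
have DS (K : seq int) : uniq K -> \sum_(n <- K) cabs (D n) <= A / c ^+ 3 / M%:R ^+ 2 * ((1 - y)^-1 + (1 - y)^-1).
  move=> uK; apply: le_trans (ler_sum _ (fun n _ => Db n)) _.
  rewrite -mulr_sumr ler_wpM2l //; first by rewrite divr_ge0 ?sqr_ge0 // divr_ge0 // ltW.
  by apply: (@sum_int_le R (fun i => y ^+ i)) => // n; rewrite exprn_ge0 // ltW.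
have [sD HD] : exists s, hsum D s.
  apply: asum_hsum; split; first by move=> n; apply: cabs_ge0.
  by eexists; apply: DS.
have sDb := hsum_le HD DS.
have iT : 0 < complex.Im (- ep) by apply: Im_neg_inv.
have HK : hsum (fun n : int => hh (1 / 2 + n%:~R * ep)) (KK (1 / 2) (- ep)).
  have := hsum_bij (@opprK int) (@opprK int) (KKP (1 / 2) iT).
  by apply: hsum_ext => n /=; congr hh; rewrite rmorphN /=; ring.
have HP := hsum_add HD (hsum_scale (c2 * ep) HK).
have {}HP : hsum (fun n : int => P (n + 1) - P n) (sD + c2 * ep * KK (1 / 2) (- ep)).
  by apply: hsum_ext HP => n; rewrite /D subrK.
(* |u n| tends to infinity with n and to 0 with -n, so [P] descends from 1 to 0. *)
have Pval : sD + c2 * ep * KK (1 / 2) (- ep) = 0 - 1.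
  apply: ctends_uniq (hsum_ints HP) _.
  have bnd (v : nat -> C) : (forall B, cabs (v B) <= c^-1 * y ^+ B) -> ctends v 0.
    move=> vb; apply: ctends0_le (ex_intro _ 0%N (fun n _ => vb n)) _.
    by move=> eps; apply: geom_small => //; rewrite ?invr_ge0 ltW.
  have L1 : ctends (fun B : nat => P (B%:Z + 1)) 0.
    apply: bnd => B; rewrite /P cabsV; have := low (B%:Z + 1).
    have -> : cabs (u (B%:Z + 1)) = X ^+ B.+1 by rewrite addrC -intS uX.
    move=> H; rewrite /y exprVn -invfM lef_pV2 ?posrE ?mulr_gt0 ?exprn_gt0 ?Xp ?cabs_gt0 ?u1 ?c0 //.
    apply: le_trans H; rewrite ler_wpM2l ?(ltW c0) // exprS.
    have := exprn_gt0 B Xp; move: (X ^+ B) => p p0; nra.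
  have L2 : ctends (fun B : nat => P (- B%:Z) - 1) 0.
    apply: bnd => B.
    have -> : P (- B%:Z) - 1 = u (- B%:Z) / (1 - u (- B%:Z)).
      by rewrite /P; have := u1 (- B%:Z); move: (u _) => v v0; field.
    rewrite cabsM cabsV mulrC; have -> : cabs (u (- B%:Z)) = y ^+ B.
      by rewrite uX abszN absz_nat; case: ifP => //; case: (B).
    rewrite ler_wpM2r ?exprn_ge0 ?(ltW y0) // lef_pV2 ?posrE ?cabs_gt0 ?u1 //.
    by apply: le_trans (low _); rewrite ler_peMr ?(ltW c0) // lerDl cabs_ge0.
  have := ctends_sub L1 (ctends_add L2 (ctends_cst 1)); rewrite (add0r 1).
  apply: ctends_ext; exists 0%N => B _.
  by rewrite sum_ints_telescope subrK.
have -> : c2 / (M%:R * t) * KK (1 / 2) (- ep) + 1 = - sD.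
  by rewrite -/ep -[X in _ * X + 1]/(KK _ _) (_ : c2 * ep * KK _ _ = 0 - 1 - sD) ?subrK; [ring|rewrite -Pval addrAC subrr add0r].
rewrite cabsN; apply: le_trans sDb _.
(* y = exp (-a / M), so the geometric sum is O(M), which turns the local order M^-2 into M^-1. *)
have yb : (1 - y)^-1 <= (1 + a) / a * M%:R.
  have aM : 0 < a / M%:R by rewrite divr_gt0.
  have := expR_ge1Dx (a / M%:R); rewrite -XE => Xa.
  have -> : (1 - y)^-1 = X / (X - 1) by rewrite /y; field; rewrite !gt_eqF // subr_gt0.
  have X10 : 0 < X - 1 by lra.
  rewrite ler_pdivrMr //.
  have h : a <= M%:R * (X - 1) by rewrite mulrC -ler_pdivrMr //; lra.
  have -> : (1 + a) / a * M%:R * (X - 1) = (1 + a) * (M%:R * (X - 1)) / a by field; rewrite gt_eqF.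
  rewrite ler_pdivlMr //; move: h; have : X - 1 <= M%:R * (X - 1) by rewrite ler_peMl // ltW.
  move: (M%:R * (X - 1)) => p; nra.
have -> : A / c ^+ 3 * ((1 + a) / a + (1 + a) / a) / M%:R =
  A / c ^+ 3 / M%:R ^+ 2 * ((1 + a) / a * M%:R + (1 + a) / a * M%:R).
  by field; rewrite !gt_eqF.
rewrite ler_wpM2l //; first by rewrite divr_ge0 ?sqr_ge0 // divr_ge0 // ltW.
exact: lerD.
Qed.

(** z = M t / 2 lies halfway between two rows, so every term is exponentially small in M = 2^k;
    writing [sg] as s^2 leaves a factor s^M to absorb M. *)
Lemma KK_decay t : 0 < complex.Im t ->
  ctends (fun k => (2 ^ k)%:R * KK ((2 ^ k)%:R * t / 2) ((2 ^ k)%:R * t)) 0.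
Proof.
move=> t0; have t20 : 0 < complex.Im (t / 2) by rewrite Im_divn divr_gt0.
pose sg := cabs (e (t / 2)); have sg1 : sg < 1 by apply: cabs_et_lt1.
have sg0 : 0 < sg by rewrite cabs_gt0 e_neq0.
pose s := Num.sqrt sg; have ss : s ^+ 2 = sg by rewrite sqr_sqrtr // ltW.
have s0 : 0 < s by rewrite sqrtr_gt0.
have s1 : s < 1 by rewrite -sqrtr1 ltr_sqrt.
pose K := 4 / sg * ((1 - sg)^-1 + (1 - sg)^-1).
have d0 : 0 < 1 - sg by lra.
have ds0 : 0 < 1 - s by lra.
have K0 : 0 <= K by rewrite mulr_ge0 ?addr_ge0 ?invr_ge0 ?divr_ge0 // ltW.
have h0 : 0 < 1 / 2 :> R by rewrite divr_gt0.
have [N H] := geom_small (ltW sg0) sg1 ler01 h0.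
apply: (@ctends0_le _ _ (fun k => K / (1 - s) * s ^+ (2 ^ k))).
  exists N => k Nk; set M := (2 ^ k)%N.
  have M0 : (0 < M)%N by rewrite expn_gt0.
  have MN : (N <= M)%N by apply: leq_trans Nk (ltnW (ltn_expl _ _)).
  have Mt0 := TT_rel t0 M0.
  have Kb : cabs (KK (M%:R * t / 2) (M%:R * t)) <= K * sg ^+ M.
    apply: hsum_le (KKP _ Mt0) _ => J uJ.
    have -> : K * sg ^+ M = 4 * sg ^+ M / sg * ((1 - sg)^-1 + (1 - sg)^-1) by rewrite /K; ring.
    apply: (@le_trans _ _ (\sum_(n <- J) 4 * sg ^+ M / sg * sg ^+ `|n|)); last first.
      rewrite -mulr_sumr ler_wpM2l //; first by rewrite divr_ge0 ?mulr_ge0 ?exprn_ge0 // ltW.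
      apply: (@sum_int_le R (fun i => sg ^+ i)) => // [n|n]; first by rewrite exprn_ge0 // ltW.
      by apply: geom_sum_le => //; apply: ltW.
    apply: ler_sum => n _.
    have S (j : nat) : cabs (hh (M%:R * t / 2 + j%:R * (M%:R * t))) <= 4 * sg ^+ M * sg ^+ j.
      have E : cabs (e (M%:R * t / 2 + j%:R * (M%:R * t))) = sg ^+ (M * j.*2.+1).
        rewrite /sg -cabsX eX; congr (cabs (e _)).
        have -> : (M * j.*2.+1)%:R = M%:R * (j%:R * 2 + 1) :> C by rewrite natrM -natr1 -muln2 (natrM _ j).
        by field.
      have sM : sg ^+ (M * j.*2.+1) <= sg ^+ M * sg ^+ j.
        rewrite -exprD; apply: (@ler_wiXn2l _ sg (ltW sg0) (ltW sg1)).
        by rewrite -muln2; nia.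
      have sM2 : sg ^+ M * sg ^+ j <= sg ^+ M.
        by rewrite ler_piMr ?exprn_ge0 ?exprn_ile1 // ltW.
      apply: le_trans (hh_decay _) _; rewrite E; last by rewrite -mulrA ler_wpM2l.
      apply: le_trans sM (le_trans sM2 _); apply: ltW.
      by have := H M MN; rewrite [ltLHS]mul1r.
    case: n => j.
      apply: le_trans (S j) _; rewrite /= ler_wpM2r ?exprn_ge0 ?(ltW sg0) //.
      by rewrite ler_peMr ?mulr_ge0 ?exprn_ge0 ?(ltW sg0) // invf_ge1 // ltW.
    have -> : M%:R * t / 2 + (Negz j)%:~R * (M%:R * t) = - (M%:R * t / 2 + j%:R * (M%:R * t)).
      by rewrite NegzE rmorphN /= -pmulrn -addn1 natrD; field.
    rewrite hhN; apply: le_trans (S j) _.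
    have -> : 4 * sg ^+ M / sg * sg ^+ `|Negz j| = 4 * sg ^+ M * sg ^+ j.
      by rewrite NegzE abszN absz_nat exprS; field; rewrite gt_eqF.
    exact: lexx.
  rewrite cabsM cabs_nat; apply: (@le_trans _ _ (M%:R * (K * sg ^+ M))).
    by rewrite ler_wpM2l.
  have -> : M%:R * (K * sg ^+ M) = K * s ^+ M * (M%:R * s ^+ M).
    by rewrite -ss -exprM mulnC exprM; ring.
  have -> : K / (1 - s) * s ^+ M = K * s ^+ M * (1 - s)^-1 by ring.
  apply: ler_wpM2l; first by apply: mulr_ge0 => //; rewrite exprn_ge0 // ltW.
  exact: nat_geom_le (ltW s0) s1.
have k0 : 0 <= K / (1 - s) by rewrite divr_ge0 // ltW.
move=> eps eps0; have [N' HN'] := geom_small (ltW s0) s1 k0 eps0; exists N' => k N'k; apply: HN'.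
by apply: leq_trans N'k (ltnW (ltn_expl _ _)).
Qed.

Lemma dS_pow k t : 0 < complex.Im t -> dS t = (2 ^ k)%:R * dS ((2 ^ k)%:R * t).
Proof.
move=> t0; elim: k => [|k IH]; first by rewrite !mul1r.
have tk : 0 < complex.Im ((2 ^ k)%:R * t) by apply: TT_rel; rewrite ?expn_gt0.
have -> : (2 ^ k.+1)%:R = 2 * (2 ^ k)%:R :> C by rewrite expnS natrM.
by rewrite IH (dS_double tk) !mulrA [_ * 2]mulrC.
Qed.

Theorem E2_S t : 0 < complex.Im t ->
  E2 (- t^-1) = t ^+ 2 * E2 t + 12 * t / c2.
Proof.
move=> t0; have tn := Im_neq0 t0; have c20 := twopii_neq0 R.
have [B B0 HB] := riemann_hh t0.
suff D : dS t / 12 = 0 + (c2 * t)^-1.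
  have -> : E2 (- t^-1) = t ^+ 2 * (dS t + E2 t).
    by rewrite /dS subrK mulVKf // expf_neq0.
  have -> : dS t = 12 * (c2 * t)^-1 by rewrite -[(c2 * t)^-1]add0r -D; field.
  by move: (E2 t) c20; move: (c2) => c x c0; field; rewrite c0 tn.
apply: ctends_uniq (ctends_cst _) _.
(* 2^k times the transformed term of [dS_KK] at 2^k t, with its sign; the Riemann sums make it tend
   to (2 pi i t)^-1, while the other term tends to 0 by [KK_decay]. *)
pose v k := - (t * c2)^-1 * (c2 / ((2 ^ k)%:R * t) * KK (1 / 2) (- ((2 ^ k)%:R * t)^-1)).
have Lv : ctends v (c2 * t)^-1.
  rewrite [X in ctends _ X](_ : _ = - (t * c2)^-1 * (0 - 1)); last by rewrite mulrC sub0r mulrNN mulr1.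
  apply: ctends_scale.
  have L0 : ctends (fun k => c2 / ((2 ^ k)%:R * t) * KK (1 / 2) (- ((2 ^ k)%:R * t)^-1) + 1) 0.
    apply: (@ctends0_le _ _ (fun k => B / (2 ^ k)%:R)).
      by exists 0%N => k _; apply: HB; rewrite expn_gt0.
    move=> eps eps0; have h0 : 0 <= 1 / 2 :> R by rewrite divr_ge0.
    have h1 : 1 / 2 < 1 :> R by lra.
    have [N HN] := geom_small h0 h1 B0 eps0; exists N => n /HN.
    by rewrite natrX mul1r exprVn.
  by have := ctends_sub L0 (ctends_cst 1); apply: ctends_ext; exists 0%N => k _; rewrite addrK.
have := ctends_add (KK_decay t0) Lv; apply: ctends_ext; exists 0%N => k _.
set M := (2 ^ k)%:R; have M0 : M != 0 by apply: tN2.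
have Mt : 0 < complex.Im (M * t) by apply: TT_rel; rewrite ?expn_gt0.
have := dS_KK Mt (offlat Mt (Im_divn _ 2)).
have -> : M * t / 2 / (M * t) = 1 / 2 by field; rewrite tn M0.
rewrite (dS_pow k t0) -/M /v -/M => E; rewrite -[RHS]mulrA E.
move: (KK _ _) (KK _ _) (c2) c20 => p q c c0; field; by rewrite c0 tn M0.
Qed.

End E2Transform.

(** * The product formula, Delta and eta *)

Section FormalODE.
Variable R : realType.
Local Notation C := (Cx R).
Implicit Types (a b c s y : nat -> C).

(** The monomial q^m; [theta] is the derivation q d/dq. *)
Definition xm (m : nat) : nat -> C := fun n => (n == m)%:R.
Definition theta a : nat -> C := fun n => n%:R * a n.

(** Truncation to polynomials, from which [convA] borrows associativity. *)
Lemma conv_poly N a b n : (n < N)%N ->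
  conv a b n = ((\poly_(i < N) a i) * (\poly_(i < N) b i))`_n.
Proof.
move=> nN; rewrite coefM; apply: eq_bigr => i _; rewrite !coef_poly.
by rewrite (leq_trans (ltn_ord i) nN) (leq_ltn_trans (leq_subr _ _) nN).
Qed.

Lemma convA a b c : conv a (conv b c) = conv (conv a b) c.
Proof.
apply/funext => n; pose P a := \poly_(i < n.+1) a i.
have L : conv a (conv b c) n = (P a * (P b * P c))`_n.
  rewrite coefM; apply: eq_bigr => i _; rewrite coef_poly ltn_ord.
  by rewrite (@conv_poly n.+1) // ltnS leq_subr.
have L' : conv (conv a b) c n = (P a * P b * P c)`_n.
  rewrite coefM; apply: eq_bigr => i _; rewrite coef_poly ltnS leq_subr.
  by rewrite (@conv_poly n.+1).
by rewrite L L' mulrA.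
Qed.

Lemma convDl a b c : conv (fun n => a n + b n) c = fun n => conv a c n + conv b c n.
Proof.
by apply/funext => n; rewrite /conv -big_split; apply: eq_bigr => i _; rewrite mulrDl.
Qed.

Lemma convZl k a c : conv (fun n => k * a n) c = fun n => k * conv a c n.
Proof.
by apply/funext => n; rewrite /conv mulr_sumr; apply: eq_bigr => i _; rewrite mulrA.
Qed.

Lemma theta_conv a b : theta (conv a b) = fun n => conv (theta a) b n + conv a (theta b) n.
Proof.
apply/funext => n; rewrite /theta /conv mulr_sumr -big_split; apply: eq_bigr => i _ /=.
have iN : (i <= n)%N by rewrite -ltnS.
have -> : n%:R = i%:R + (n - i)%:R :> C by rewrite -natrD subnKC.
ring.
Qed.

Lemma conv_xm m a n : conv a (xm m) n = if (m <= n)%N then a (n - m)%N else 0.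
Proof.
case: leqP => mn.
  have nm : (n - m < n.+1)%N by rewrite ltnS leq_subr.
  rewrite /conv (bigD1 (Ordinal nm)) //=; rewrite subKn // /xm eqxx mulr1 big1 ?addr0 // => i /eqP ni.
  case: eqP => [E|]; last by rewrite mulr0.
  case: ni; apply: val_inj => /=; have := ltn_ord i; lia.
rewrite /conv big1 // => i _; rewrite /xm; case: eqP => [E|]; last by rewrite mulr0.
by have := ltn_ord i; lia.
Qed.

Lemma psum_xm m (q : C) : psum (xm m) q = q ^+ m.
Proof.
apply: hsum_sum; have -> : q ^+ m = \sum_(i <- [:: m]) xm m i * q ^+ i.
  by rewrite big_seq1 /xm eqxx mul1r.
apply: hsum_seq => // n; rewrite inE /xm => /negPf ->; exact: mul0r.
Qed.

Lemma tame_xm m : tame (xm m).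
Proof. by apply: (@tame_poly _ _ m.+1) => n mn; rewrite /xm gtn_eqF. Qed.

(** Each coefficient depends on all earlier ones, so the whole list is carried along. *)
Fixpoint ode_seq s n : seq C :=
  if n is m.+1 then let l := ode_seq s m in
    rcons l (m.+1%:R^-1 * \sum_(i < m.+1) s i.+1 * nth 0 l (m - i)) else [:: 1].

(* The solution of y' = (s / q) y, y(0) = 1, where s(0) = 0. *)
Definition ode s n := nth 0 (ode_seq s n) n.

Lemma size_ode_seq s n : size (ode_seq s n) = n.+1.
Proof. by elim: n => //= n IH; rewrite size_rcons IH. Qed.

Lemma nth_ode_seq s n k : (k <= n)%N -> nth 0 (ode_seq s n) k = ode s k.
Proof.
elim: n => [|n IH]; first by rewrite leqn0 => /eqP ->.
rewrite leq_eqVlt => /orP[/eqP -> //|kn]; rewrite /= nth_rcons size_ode_seq kn.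
exact: IH.
Qed.

Lemma odeS s n : ode s n.+1 = n.+1%:R^-1 * \sum_(i < n.+1) s i.+1 * ode s (n - i).
Proof.
rewrite {1}/ode /= nth_rcons size_ode_seq ltnn eqxx; congr (_ * _).
by apply: eq_bigr => i _; rewrite nth_ode_seq // leq_subr.
Qed.

Lemma ode0 s : ode s 0 = 1. Proof. by []. Qed.

Lemma ode_theta s : s 0%N = 0 -> theta (ode s) = conv s (ode s).
Proof.
move=> s0; apply/funext => -[|n]; rewrite /theta /conv.
  by rewrite big_ord1 s0 !mul0r.
rewrite odeS mulVKf ?pnatr_eq0 // [RHS]big_ord_recl /= s0 mul0r add0r.
by apply: eq_bigr => i _; rewrite /bump /= add1n subSS.
Qed.

Lemma ode_uniq s y : s 0%N = 0 -> y 0%N = 1 -> theta y = conv s y -> y = ode s.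
Proof.
move=> s0 y0 E; apply/funext => n; have [m] := ubnP n; elim: m n => // m IH [|n] nm.
  by rewrite y0.
apply: (@mulfI _ n.+1%:R); first by rewrite pnatr_eq0.
have := congr1 (fun f => f n.+1) E; rewrite {1}/theta => ->.
have := congr1 (fun f => f n.+1) (ode_theta s0); rewrite {1}/theta => ->.
rewrite /conv big_ord_recl [RHS]big_ord_recl /= s0 !mul0r; congr (_ + _); apply: eq_bigr => i _.
by rewrite IH // /bump /= add1n subSS; apply: leq_ltn_trans (leq_subr _ _) _.
Qed.

(** [ode s] is formally the exponential of the integral of s dq/q, and this is the law of exponents;
    powers and inverses of q-products are read off from s. *)
Lemma conv_ode s s' : s 0%N = 0 -> s' 0%N = 0 ->
  conv (ode s) (ode s') = ode (fun n => s n + s' n).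
Proof.
move=> s0 s'0; apply: ode_uniq.
- by rewrite s0 s'0 addr0.
- by rewrite /conv big_ord1 !ode0 mulr1.
rewrite theta_conv !ode_theta // convDl; apply/funext => n; congr (_ + _).
  by rewrite convA.
by rewrite convA [conv (ode s) s']convC -convA.
Qed.

Lemma ode_scale0 s : ode (fun n => 0 * s n) = cone R.
Proof.
symmetry; apply: ode_uniq; [by rewrite mul0r|by []|].
rewrite convZl; apply/funext => -[|n]; rewrite /theta !mul0r //.
by rewrite /cone /= mulr0.
Qed.

Lemma ode_ext s s' n : (forall j, (j <= n)%N -> s j = s' j) -> ode s n = ode s' n.
Proof.
have [m] := ubnP n; elim: m n => // m IH [|n] nm E //.
rewrite !odeS; congr (_ * _); apply: eq_bigr => i _; rewrite E; last exact: ltn_ord.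
rewrite IH //; first by apply: leq_ltn_trans (leq_subr _ _) _.
by move=> j jn; apply: E; apply: leq_trans jn (leqW (leq_subr _ _)).
Qed.

(* With [u n = |y n| r ^ n] the recursion gives [n * u n <= S * max_(k < n) u k]:
   each of the first N steps multiplies the bound by at most 1 + S, and none
   of the later ones increases it. *)
Lemma ode_bound s (r S : R) N : 0 <= r -> 0 <= S -> S <= N%:R ->
  (forall n, \sum_(j < n) cabs (s j) * r ^+ j <= S) ->
  forall n, cabs (ode s n) * r ^+ n <= (1 + S) ^+ N.
Proof.
move=> r0 S0 SN HS n; have S1 : 1 <= 1 + S by rewrite lerDl.
suff H : cabs (ode s n) * r ^+ n <= (1 + S) ^+ minn n N.
  by apply: le_trans H _; rewrite ler_weXn2l // geq_minr.
have [m] := ubnP n; elim: m n => // m IH [|n] nm.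
  by rewrite ode0 cabs1 mul1r expr0 min0n expr0.
rewrite odeS cabsM cabsV cabs_nat -mulrA.
rewrite mulrC ler_pdivrMr ?ltr0n //.
have B : cabs (\sum_(i < n.+1) s i.+1 * ode s (n - i)) * r ^+ n.+1 <= S * (1 + S) ^+ minn n N.
  apply: (@le_trans _ _ (\sum_(i < n.+1) (cabs (s i.+1) * r ^+ i.+1) * (1 + S) ^+ minn n N)).
    apply: (@le_trans _ _ ((\sum_(i < n.+1) cabs (s i.+1 * ode s (n - i))) * r ^+ n.+1)).
      by rewrite ler_wpM2r ?exprn_ge0 ?cabs_sum.
    rewrite mulr_suml; apply: ler_sum => i _.
    have iN : (i <= n)%N by rewrite -ltnS.
    have -> : r ^+ n.+1 = r ^+ (n - i) * r ^+ i.+1 by rewrite -exprD addnS subnK.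
    rewrite cabsM.
    have -> : cabs (s i.+1) * cabs (ode s (n - i)) * (r ^+ (n - i) * r ^+ i.+1) =
       (cabs (s i.+1) * r ^+ i.+1) * (cabs (ode s (n - i)) * r ^+ (n - i)) by ring.
    apply: ler_wpM2l; first by rewrite mulr_ge0 ?cabs_ge0 ?exprn_ge0.
    apply: le_trans (IH _ _) _; first by apply: leq_ltn_trans (leq_subr _ _) _.
    rewrite ler_weXn2l // leq_min geq_minr andbT; apply: leq_trans (geq_minl _ _) (leq_subr _ _).
  rewrite -mulr_suml ler_wpM2r ?exprn_ge0 ?(le_trans ler01) //.
  have := HS n.+2; rewrite big_ord_recl /=; apply: le_trans.
  by rewrite lerDr mulr_ge0 ?cabs_ge0 ?exprn_ge0.
apply: le_trans B _; case: (leqP n.+1 N) => nN.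
  rewrite (minn_idPl (ltnW nN)) exprS.
  have p0 : 0 <= (1 + S) ^+ n by rewrite exprn_ge0 // (le_trans ler01).
  have n1 : 1 <= n.+1%:R :> R by rewrite ler1n.
  apply: (@le_trans _ _ ((1 + S) * (1 + S) ^+ n)); first by rewrite ler_wpM2r // lerDr.
  by rewrite ler_peMr // mulr_ge0 // (le_trans ler01).
have -> : minn n N = N by apply/minn_idPr; rewrite -ltnS.
have p0 : 0 <= (1 + S) ^+ N by rewrite exprn_ge0 // (le_trans ler01).
rewrite mulrC ler_wpM2l //; apply: le_trans SN _; rewrite ler_nat; exact: ltnW.
Qed.

Lemma nat_ge (x : R) : exists N : nat, x <= N%:R.
Proof. by exists (Num.truncn x).+1; apply: ltW (truncnS_gt _). Qed.

Lemma tame_ode s : tame s -> tame (ode s).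
Proof.
move=> ts r r0 r1; have [_ [S HS]] := tame_bsum ts r0 r1; have [N HN] := nat_ge S.
exists ((1 + S) ^+ N); apply: ode_bound => //; first by have := HS [::] isT; rewrite big_nil.
move=> n; have := HS (iota 0 n) (iota_uniq _ _).
by have -> : iota 0 n = index_iota 0 n; rewrite ?big_mkord // /index_iota subn0.
Qed.

Lemma psum_ode_natmul s m (q : C) : s 0%N = 0 -> tame s -> cabs q < 1 ->
  psum (ode (fun n => m%:R * s n)) q = psum (ode s) q ^+ m.
Proof.
move=> s0 ts q1; elim: m => [|m IH]; first by rewrite ode_scale0 psum_cone.
have -> : (fun n => m.+1%:R * s n) = (fun n => s n + m%:R * s n).
  by apply/funext => n; rewrite -add1n natrD mulrDl mul1r.
rewrite -conv_ode ?s0 ?mulr0 // psum_conv //; first by rewrite IH exprS.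
  exact: tame_ode.
exact/tame_ode/tame_scale.
Qed.

End FormalODE.

(** * Divisor sums and the Euler product *)

Section Lambert.
Variable R : realType.
Local Notation C := (Cx R).
Local Notation e := (@e2ipi R).

(** The series d q^d / (1 - q^d), which is minus q d/dq of log (1 - q^d); the sum over d has
    coefficients sigma(k). *)
Definition dl (d : nat) : nat -> C := fun k => if (0 < k)%N && (d %| k)%N then d%:R else 0.
Definition sig_to (m : nat) : nat -> C := fun k => \sum_(d < m) dl d.+1 k.
Definition sig : nat -> C := fun k => sig_to k k.

Lemma dl0 d : dl d 0 = 0. Proof. by []. Qed.
Lemma sig_to0 m : sig_to m 0 = 0. Proof. by rewrite /sig_to big1. Qed.
Lemma sig0 : sig 0 = 0. Proof. exact: sig_to0. Qed.

Lemma sig_toE m k : (k <= m)%N -> sig_to m k = sig k.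
Proof.
case: k => [|k] km; first by rewrite sig_to0 sig0.
rewrite /sig /sig_to -(subnKC km) big_split_ord /= [X in _ + X]big1 ?addr0 // => i _.
by rewrite /dl /=; case: ifP => // /dvdn_leq; move=> /(_ isT); lia.
Qed.

Lemma cabs_dl d k : (0 < d)%N -> cabs (dl d k) <= k%:R.
Proof.
move=> d0; rewrite /dl; case: ifP => [/andP[k0 dk]|_]; last by rewrite cabs0.
by rewrite cabs_nat ler_nat dvdn_leq.
Qed.

Lemma cabs_sig_to m k : cabs (sig_to m k) <= k%:R ^+ 2.
Proof.
case: (leqP k m) => km; last first.
  rewrite /sig_to; apply: le_trans (cabs_sum _ _ _) _.
  apply: (@le_trans _ _ (\sum_(i < m) k%:R)).
    by apply: ler_sum => i _; apply: cabs_dl.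
  by rewrite sumr_const card_ord -(mulr_natl k%:R) expr2 ler_wpM2r // ler_nat ltnW.
rewrite (sig_toE km) /sig /sig_to; apply: le_trans (cabs_sum _ _ _) _.
apply: (@le_trans _ _ (\sum_(i < k) k%:R)).
  by apply: ler_sum => i _; apply: cabs_dl.
by rewrite sumr_const card_ord -(mulr_natl k%:R) expr2.
Qed.

Lemma tame_one : tame (fun _ : nat => 1 : C).
Proof.
move=> r r0 r1; exists 1 => n; rewrite cabs1 mul1r exprn_ile1 //; exact: ltW.
Qed.

Lemma tame_sqr : tame (fun n : nat => n%:R ^+ 2 : C).
Proof.
have -> : (fun n => n%:R ^+ 2 : C) = (fun n => n%:R * (n%:R * 1)).
  by apply/funext => n; rewrite mulr1.
exact/tame_natmul/tame_natmul/tame_one.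
Qed.

Lemma tame_sig_to m : tame (sig_to m).
Proof. apply: tame_le tame_sqr => n; rewrite cabsX cabs_nat; exact: cabs_sig_to. Qed.

Lemma tame_sig : tame sig.
Proof. apply: tame_le tame_sqr => n; rewrite cabsX cabs_nat; exact: cabs_sig_to. Qed.

Lemma ode_dl d : (0 < d)%N -> ode (fun k => - 1 * dl d k) = (fun n => cone R n + - 1 * xm R d n).
Proof.
move=> d0; symmetry; apply: ode_uniq; first by rewrite dl0 mulr0.
  by rewrite /cone /xm eqxx lt_eqF // mulr0 addr0.
have -> : (fun n => cone R n + - 1 * xm R d n) = (fun n => xm R 0 n + - 1 * xm R d n) by [].
rewrite convC convDl convZl; apply/funext => n.
have cs x : conv (xm R x) (fun k => - 1 * dl d k) n = - 1 * (if (x <= n)%N then dl d (n - x) else 0).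
  by rewrite convC convZl conv_xm.
rewrite !cs {cs} leq0n subn0 /theta /xm /dl.
case: n => [|n]; first by rewrite mul0r sub0n /= if_same !mulr0 addr0.
case: (n.+1 =P d) => [<- | /eqP nd] /=; first by rewrite leqnn subnn dvdnn /= !mulr0 add0r addr0 mulr1 mulrC.
case: (leqP d n.+1) => dn; last first.
  case: ifP => [/dvdn_leq|]; last by rewrite !mulr0 !addr0 mulr0.
  by move=> /(_ isT); lia.
have -> : (0 < n.+1 - d)%N by lia.
rewrite /= dvdn_subl //; case: ifP => _; ring.
Qed.

Lemma psum_prod m (q : C) : cabs q < 1 ->
  psum (ode (fun k => - 1 * sig_to m k)) q = \prod_(1 <= n < m.+1) (1 - q ^+ n).
Proof.
move=> q1; elim: m => [|m IH].
  rewrite big_geq //; have -> : (fun k => - 1 * sig_to 0 k) = (fun k => 0 * sig_to 0 k).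
    by apply/funext => k; rewrite /sig_to big_ord0 !mulr0.
  by rewrite ode_scale0 psum_cone.
have -> : (fun k => - 1 * sig_to m.+1 k) = (fun k => - 1 * sig_to m k + - 1 * dl m.+1 k).
  by apply/funext => k; rewrite /sig_to big_ord_recr /= mulrDr.
rewrite -conv_ode ?sig_to0 ?mulr0 // psum_conv //.
- rewrite IH ode_dl // psum_add //; [|exact: tame_cone|exact/tame_scale/tame_xm].
  rewrite psum_scale ?psum_cone ?psum_xm //; last exact: tame_xm.
  by rewrite [RHS]big_nat_recr //= mulN1r.
- exact/tame_ode/tame_scale/tame_sig_to.
- rewrite ode_dl //; apply: tame_add; [exact: tame_cone|exact/tame_scale/tame_xm].
Qed.

(** Coefficient n of the partial product is final once m >= n, and [ode_bound] is uniform in m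
    because |[sig_to m k]| <= k^2; so Tannery's theorem applies. *)
Lemma ctends_prod_q (q : C) : cabs q < 1 ->
  ctends (fun m => \prod_(1 <= n < m.+1) (1 - q ^+ n)) (psum (ode (fun k => - 1 * sig k)) q).
Proof.
move=> q1; pose r := (1 + cabs q) / 2.
have q0 := cabs_ge0 q; have r0 : 0 < r by rewrite /r; lra.
have r1 : r < 1 by rewrite /r; lra.
have [_ [S HS]] := tame_bsum tame_sqr (ltW r0) r1; have [N HN] := nat_ge S.
have S0 : 0 <= S by have := HS [::] isT; rewrite big_nil.
have HB m n : cabs (ode (fun k => - 1 * sig_to m k) n) * r ^+ n <= (1 + S) ^+ N.
  apply: ode_bound => //; first exact: ltW.
  move=> {}n; have := HS (iota 0 n) (iota_uniq _ _).
  have -> : iota 0 n = index_iota 0 n by rewrite /index_iota subn0.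
  rewrite big_mkord; apply: le_trans; apply: ler_sum => i _.
  rewrite ler_wpM2r ?exprn_ge0 ?(ltW r0) // mulN1r cabsN cabsX cabs_nat; exact: cabs_sig_to.
apply: (@tannery R nat (fun m n => ode (fun k => - 1 * sig_to m k) n * q ^+ n)
  (fun n => ode (fun k => - 1 * sig k) n * q ^+ n)
  (fun n => (1 + S) ^+ N * (cabs q / r) ^+ n)).
- apply: bsum_scale; first by rewrite exprn_ge0 // addr_ge0.
  apply: bsum_geom; first by rewrite divr_ge0 // ltW.
  by rewrite ltr_pdivrMr // mul1r /r; lra.
- move=> m n; rewrite cabsM cabsX.
  have -> : cabs q ^+ n = r ^+ n * (cabs q / r) ^+ n.
    by rewrite -exprMn mulrC divfK // gt_eqF.
  by rewrite mulrA ler_wpM2r // exprn_ge0 // divr_ge0 // ltW.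
- move=> n; apply: ctends_ext (ctends_cst _); exists n => m nm; congr (_ * _).
  apply: ode_ext => j jn; rewrite sig_toE //; exact: leq_trans jn nm.
- move=> m; rewrite -psum_prod //; apply: psumP => //.
  exact/tame_ode/tame_scale/tame_sig_to.
- apply: psumP => //; exact/tame_ode/tame_scale/tame_sig.
Qed.

Lemma geom_psum (q : C) : cabs q < 1 -> psum (fun=> 1) q = (1 - q)^-1.
Proof.
move=> q1.
have E : conv (fun=> 1) (fun n => cone R n + - 1 * xm R 1 n) = cone R.
  rewrite convC convDl convZl (convC (cone R)) conv_cone; apply/funext => n.
  by rewrite convC conv_xm /cone; case: n => [|n] /=; rewrite ?mulr0 ?addr0 // mulr1 subrr.
have := psum_conv tame_one (tame_add (@tame_cone R) (tame_scale (-1) (@tame_xm R 1))) q1.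
rewrite E psum_cone psum_add //; [|exact: tame_cone|exact/tame_scale/tame_xm].
rewrite psum_scale ?psum_cone ?psum_xm //; last exact: tame_xm.
rewrite mulN1r expr1 => H; apply: (@mulIf _ (1 - q)); last first.
  rewrite -H mulVf //; apply/eqP => q0; move: H; rewrite q0 mulr0 => /eqP.
  by rewrite oner_eq0.
by apply/eqP => q0; move: H; rewrite q0 mulr0 => /eqP; rewrite oner_eq0.
Qed.

Lemma hh_psum z : 0 < complex.Im z -> hsum (fun d => d.+1%:R * e z ^+ d.+1) (hh z).
Proof.
move=> z0; have q1 := cabs_et_lt1 z0; set q := e z in q1 *.
have E : conv (fun=> 1) (fun=> 1) = (fun d => d.+1%:R : C).
  by apply/funext => n; rewrite /conv mulr1 sumr_const card_ord.
have -> : hh z = q * psum (fun d => d.+1%:R) q.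
  by rewrite -E psum_conv ?geom_psum //; try exact: tame_one; rewrite /hh -/q -expr2 exprVn.
have T : tame (fun d => d.+1%:R : C) by rewrite -E; apply: tame_conv; apply: tame_one.
apply: hsum_ext (hsum_scale q (psumP T q1)) => d; rewrite exprS; ring.
Qed.

(** The double series of d q^(n d), n, d >= 1 (indices are shifted by one in [f]), gives hh(n t)
    when summed over d and sigma when grouped by n d. The rows n and -n contribute equally, hence
    the 2. *)
Lemma TT_sig t : 0 < complex.Im t -> TT t = 2 * psum sig (e t).
Proof.
move=> t0; have q1 := cabs_et_lt1 t0; set q := e t in q1 *.
pose f (p : nat * nat) := p.2.+1%:R * q ^+ (p.1.+1 * p.2.+1).
have af : asum f.
  have T : tame (fun n => n%:R * 1 + 1 : C) by apply: tame_add (tame_natmul tame_one) tame_one.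
  apply: asum_le_hsum (bsum_prod (bsum_geom (cabs_ge0 q) q1) (tame_bsum T (cabs_ge0 q) q1)).
  move=> [n d]; rewrite /f /= cabsM cabsX cabs_nat mulr1 -natr1.
  have -> : cabs (d%:R + 1 : C) = d%:R + 1 by rewrite natr1 cabs_nat -natr1.
  rewrite mulrCA -exprD ler_wpM2l ?addr_ge0 //.
  apply: (@ler_wiXn2l _ (cabs q) (cabs_ge0 q) (ltW q1)); nia.
have [s Hs] := asum_hsum af.
have Hrow n : hsum (fun d => f (n, d)) (hh (n.+1%:R * t)).
  have := hh_psum (TT_rel t0 (ltn0Sn n)); apply: hsum_ext => d.
  by rewrite /f /= -eX -exprM.
have [Hn _] := hsum_sigma af Hs Hrow.
have sE : s = psum sig q.
  pose F k := if k is 0 then [::] else [seq ((k %/ d.+1).-1, d) | d <- iota 0 k & (d.+1 %| k)%N].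
  have := @hsum_regroup _ _ _ _ _ (fun p : nat * nat => (p.1.+1 * p.2.+1)%N) F _ _ Hs.
  move=> H; apply/esym; apply: hsum_sum; apply: hsum_ext (H _ _).
  - move=> [|k]; first by rewrite big_nil sig0 mul0r.
    rewrite /F big_map big_filter /sig /sig_to.
    have -> : iota 0 k.+1 = index_iota 0 k.+1 by rewrite /index_iota subn0.
    rewrite big_mkord mulr_suml big_mkcond; apply: eq_bigr => d _ /=.
    rewrite /dl /=; case: ifP => dk; last by rewrite mul0r.
    rewrite /f /= prednK ?divnK // divn_gt0 //; exact: dvdn_leq.
  - move=> [|k] //; rewrite map_inj_in_uniq ?filter_uniq ?iota_uniq // => a b _ _ [].
    by [].
  - move=> [n d] k; apply/idP/eqP => /=.
      case: k => // k /mapP[d']; rewrite mem_filter => /andP[dk _] [-> ->].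
      rewrite prednK ?divnK // divn_gt0 //; exact: dvdn_leq.
    move=> <-; apply/mapP; exists d; last by rewrite mulnK.
    by rewrite mem_filter dvdn_mull // mem_iota /=; nia.
have Hp : hsum (fun n : int => if n is Posz m.+1 then hh (m.+1%:R * t) else 0) s.
  apply: (@hsum_inj R int nat _ _ (fun m => Posz m.+1)
    (fun n => if n is Posz m.+1 then Some m else None)) => //.
  - by case=> [[|m]|m].
  - by case=> [[|m]|m].
have Hm : hsum (fun n : int => if n is Negz m then hh (m.+1%:R * t) else 0) s.
  apply: (@hsum_inj R int nat _ _ Negz (fun n => if n is Negz m then Some m else None)) => //.
  - by case=> [m|m].
  - by case=> [m|m].
apply: hsum_uniq (TTP t0) _; rewrite -sE mulr_natl mulr2n.
apply: hsum_ext (hsum_add Hp Hm) => -[[|m]|m].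
- by rewrite mul0r hh0 addr0.
- by rewrite addr0.
- by rewrite add0r NegzE rmorphN /= mulNr hhN.
Qed.

End Lambert.

(** * Delta, eta and their logarithmic derivatives *)

Section Delta.
Variable R : realType.
Local Notation C := (Cx R).
Local Notation e := (@e2ipi R).
Local Notation c2 := (2 * iC R * piC R).
Local Notation sg := (@sig R).
Implicit Types (z t : C).

(** The product of the (1 - q^n)^24; [P24'] is its inverse, whose convergence shows that Delta has
    no zero. *)
Definition P24 : nat -> C := ode (fun n => 24%:R * (- 1 * sg n)).
Definition P24' : nat -> C := ode (fun n => 24%:R * sg n).
Definition Delta z := e z * psum P24 (e z).

Lemma tame_nsig : tame (fun n => - 1 * sg n).
Proof. exact/tame_scale/tame_sig. Qed.

Lemma tame_P24 : tame P24.
Proof. exact/tame_ode/tame_scale/tame_nsig. Qed.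

Lemma tame_P24' : tame P24'.
Proof. exact/tame_ode/tame_scale/tame_sig. Qed.

Lemma psum_P24K (q : C) : cabs q < 1 -> psum P24 q * psum P24' q = 1.
Proof.
move=> q1; rewrite -psum_conv //; [|exact: tame_P24|exact: tame_P24'].
rewrite conv_ode ?sig0 ?mulr0 //; transitivity (psum (cone R) q); last exact: psum_cone.
rewrite -(ode_scale0 sg); congr (psum (ode _) _).
by apply/funext => n; ring.
Qed.

Lemma Delta_neq0 z : 0 < complex.Im z -> Delta z != 0.
Proof.
move=> z0; rewrite mulf_neq0 ?e_neq0 //; apply/eqP => d0.
have := psum_P24K (cabs_et_lt1 z0); rewrite d0 mul0r => /eqP; by rewrite eq_sym oner_eq0.
Qed.

Lemma DeltaV z : 0 < complex.Im z -> (Delta z)^-1 = e (- z) * psum P24' (e z).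
Proof.
move=> z0; have E := psum_P24K (cabs_et_lt1 z0); rewrite /Delta invfM eN; congr (_ * _).
apply: (@mulfI _ (psum P24 (e z))); first by apply/eqP => d0; move: E; rewrite d0 mul0r => /eqP; rewrite eq_sym oner_eq0.
rewrite E mulfV //; apply/eqP => d0; move: E; rewrite d0 mul0r => /eqP; by rewrite eq_sym oner_eq0.
Qed.

Lemma etaE t : 0 < complex.Im t -> Defs.eta t = e (t / 24) * psum (ode (fun k => - 1 * sg k)) (e t).
Proof.
move=> t0; rewrite /Defs.eta (_ : lim _ = psum (ode (fun k => - 1 * sg k)) (e t)) //.
apply: cvg_lim; first exact: norm_hausdorff.
by apply/ctendsP; apply: ctends_prod_q; apply: cabs_et_lt1.
Qed.

Lemma eta24 t : 0 < complex.Im t -> Defs.eta t ^+ 24 = Delta t.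
Proof.
move=> t0; rewrite etaE // exprMn eX /Delta (_ : 24%:R * (t / 24) = t); last by field.
congr (_ * _).
by rewrite psum_ode_natmul ?sig0 ?mulr0 //; [exact: tame_nsig|exact: cabs_et_lt1].
Qed.

Lemma E2_sig t : 0 < complex.Im t -> E2 t = psum (fun n => cone R n + (- 24) * sg n) (e t).
Proof.
move=> t0; have q1 := cabs_et_lt1 t0.
rewrite psum_add ?psum_scale ?psum_cone //; try exact: tame_sig; try exact: tame_cone.
  by rewrite /E2 TT_sig //; ring.
exact/tame_scale/tame_sig.
Qed.

(** Logarithmic derivative l in the division-free form F' = F l; it is additive on products. *)
Definition qlog (F : C -> C) z (l : C) := qderiv F z (F z * l).

Lemma qlog_mul F G z l m : qlog F z l -> qlog G z m -> qlog (fun x => F x * G x) z (l + m).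
Proof.
move=> HF HG; have := qderiv_mul HF HG; rewrite /qlog.
by have -> : F z * (G z * m) + F z * l * G z = F z * G z * (l + m) by ring.
Qed.

Lemma qlog_inv F z l : F z != 0 -> qlog F z l -> qlog (fun x => (F x)^-1) z (- l).
Proof.
move=> F0 HF; have := qderiv_comp HF (qderiv_inv F0); rewrite /qlog.
by have -> : F z * l * - F z ^- 2 = (F z)^-1 * - l by field.
Qed.

Lemma qlog_exp F z l n : qlog F z l -> qlog (fun x => F x ^+ n) z (n%:R * l).
Proof.
move=> HF; elim: n => [|n IH].
  by rewrite /qlog mul0r mulr0; apply: qderiv_cst.
have := qlog_mul HF IH; rewrite /qlog /=; have -> : l + n%:R * l = n.+1%:R * l.
  by rewrite -nat1r; ring.
by rewrite exprS => Hd; apply: (qderiv_ext ltr01 _ Hd) => k _; rewrite exprS.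
Qed.

Lemma qlog_Delta z : 0 < complex.Im z -> qlog Delta z (c2 * E2 z).
Proof.
move=> z0; have q1 := cabs_et_lt1 z0; pose a := conv (xm R 1) P24.
have ta : tame a by apply: tame_conv; [exact: tame_xm|exact: tame_P24].
have aE w : 0 < complex.Im w -> psum a (e (w / 1%:R)) = Delta w.
  move=> w0; rewrite divr1 psum_conv ?psum_xm ?expr1 //; [exact: tame_xm|exact: tame_P24|exact: cabs_et_lt1].
have := psum_qderiv (ltn0Sn 0) ta z0.
have tE : tame (fun n => cone R n + (- 24) * sg n).
  by apply: tame_add; [exact: tame_cone|exact/tame_scale/tame_sig].
have -> : psum (fun n => n%:R * a n) (e (z / 1%:R)) = E2 z * Delta z.
  rewrite -aE // E2_sig // divr1 -psum_conv //; congr (psum _ _).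
  rewrite -/(theta a) theta_conv ode_theta; last by rewrite sig0 !mulr0.
  have -> : theta (xm R 1) = xm R 1.
    apply/funext => n; rewrite /theta /xm; case: eqP => [->|_]; by rewrite ?mulr1 ?mulr0.
  rewrite convDl [conv (cone R) _]convC conv_cone; apply/funext => n; congr (_ + _).
  rewrite convA [conv (xm R 1) (fun _ => _)]convC -convA; congr (conv _ _ n).
  by apply/funext => k; ring.
rewrite divr1 /qlog => HD.
have -> : Delta z * (c2 * E2 z) = c2 * (E2 z * Delta z) by rewrite mulrCA [Delta z * _]mulrC.
apply: (qderiv_ext z0 _ HD) => k kz; rewrite aE //; exact: Im_near.
Qed.

End Delta.

Section DeltaTransform.
Variable R : realType.
Local Notation C := (Cx R).
Local Notation c2 := (2 * iC R * piC R).
Implicit Types (z t : C).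

(** By [E2_S] both sides have the same logarithmic derivative, so the quotient [G] is constant; at
    the fixed point i it is 1 because i^12 = 1. *)
Lemma Delta_S t : 0 < complex.Im t -> Delta (- t^-1) = t ^+ 12 * Delta t.
Proof.
move=> t0; pose G (z : C) := Delta (- z^-1) * (z ^+ 12 * Delta z)^-1.
have HG (z : C) : 0 < complex.Im z -> qderiv G z 0.
  move=> z0; have zn := Im_neq0 z0; have c20 := twopii_neq0 R.
  have Hz : qlog id z z^-1 by rewrite /qlog mulfV //; apply: qderiv_id.
  have Hi : qlog (fun x => - x^-1) z (- z^-1).
    have := qderiv_mul (qderiv_cst (-1) z) (qderiv_inv zn); rewrite /qlog.
    rewrite mul0r addr0.
    have -> : -1 * - z ^- 2 = - z^-1 * - z^-1 by field.
    by move=> Hd; apply: (qderiv_ext ltr01 _ Hd) => k _; rewrite mulN1r.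
  have HD := qderiv_comp Hi (qlog_Delta (Im_neg_inv z0)).
  have {}HD : qlog (fun x => Delta (- x^-1)) z (c2 * E2 z + 12 * z^-1).
    move: HD; rewrite /qlog E2_S //.
    have -> : - z^-1 * - z^-1 * (Delta (- z^-1) * (c2 * (z ^+ 2 * E2 z + 12 * z / c2))) =
      Delta (- z^-1) * (c2 * E2 z + 12 * z^-1).
      move: (Delta _) (E2 _) c20; move: (c2) => c D E c0; field; by rewrite zn.
    by [].
  have H1 := qlog_mul (qlog_exp 12 Hz) (qlog_Delta z0).
  have n0 : z ^+ 12 * Delta z != 0 by rewrite mulf_neq0 ?expf_neq0 ?Delta_neq0.
  have := qlog_mul HD (@qlog_inv _ (fun x => x ^+ 12 * Delta x) _ _ n0 H1).
  by rewrite /qlog [12%:R * _ + _]addrC subrr mulr0.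
have i0 : 0 < complex.Im (iC R) by rewrite /= ltr01.
have n0 : t ^+ 12 * Delta t != 0 by rewrite mulf_neq0 ?expf_neq0 ?Delta_neq0 ?Im_neq0.
have := qderiv0_cst t0 i0 HG; rewrite {2}/G.
have -> : - (iC R)^-1 = iC R.
  apply: (@mulIf _ (iC R)); first exact: Im_neq0.
  by rewrite mulNr mulVf ?Im_neq0 // -expr2 iC2.
have -> : iC R ^+ 12 = 1 by rewrite (exprM _ 2 6) iC2 -signr_odd.
rewrite mul1r mulfV ?Delta_neq0 // /G => E.
by rewrite -[LHS](mulfVK n0) E mul1r.
Qed.

Lemma Delta_int t (n : int) : Delta (t + n%:~R) = Delta t.
Proof. by rewrite /Delta eDint. Qed.

Lemma E2_int t (n : int) : 0 < complex.Im t -> E2 (t + n%:~R) = E2 t.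
Proof.
move=> t0; have t1 : 0 < complex.Im (t + n%:~R) by rewrite ImD -rC_int /= addr0.
by rewrite (E2_sig t0) (E2_sig t1) eDint.
Qed.

End DeltaTransform.

(** * Integral matrices and the slash action *)

Section Mobius.
Variable R : realType.
Local Notation C := (Cx R).
Local Notation H := (upper_half R).
Local Notation c2 := (2 * iC R * piC R).
Implicit Types (z : C) (t : H) (g h : 'M[int]_2) (f : H -> C) (a b c d k : int).

Lemma ImM_int a z : complex.Im (a%:~R * z) = a%:~R * complex.Im z.
Proof. by rewrite -rC_int; case: z => x y /=; rewrite mul0r addr0. Qed.

Lemma Im_int a : complex.Im (a%:~R : C) = 0.
Proof. by rewrite -rC_int. Qed.

Lemma mob_den a b c d z : 0 < complex.Im z -> 0 < a * d - b * c ->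
  c%:~R * z + d%:~R != 0.
Proof.
move=> z0 D; apply/eqP => E.
have := congr1 (@complex.Im R) E; rewrite ImD ImM_int Im_int addr0 => /eqP.
rewrite mulf_eq0 (gt_eqF z0) orbF intr_eq0 => /eqP c0.
move: E D; rewrite c0 mul0r add0r => /eqP; rewrite intr_eq0 => /eqP ->.
by rewrite !mulr0 subrr.
Qed.

Lemma mob_Im a b c d z : 0 < complex.Im z -> 0 < a * d - b * c ->
  complex.Im ((a%:~R * z + b%:~R) / (c%:~R * z + d%:~R)) =
  (a * d - b * c)%:~R * complex.Im z / cabs (c%:~R * z + d%:~R) ^+ 2.
Proof.
move=> z0 D; have := mob_den z0 D; rewrite -cabs_gt0 => n0.
have {n0} : 0 < cabs (c%:~R * z + d%:~R) ^+ 2 by rewrite exprn_gt0.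
rewrite cabs_sqr rmorphB !rmorphM /= -!rC_int /rC; case: z z0 => x y /= y0.
move: (a%:~R) (b%:~R) (c%:~R) (d%:~R) => a' b' c' d'.
rewrite !mul0r !subr0 !addr0 => n0; set n := _ ^+ 2 + _ ^+ 2 in n0 *.
by field; rewrite gt_eqF.
Qed.

Lemma mob_H a b c d z : 0 < complex.Im z -> 0 < a * d - b * c ->
  0 < complex.Im ((a%:~R * z + b%:~R) / (c%:~R * z + d%:~R)).
Proof.
move=> z0 D; rewrite mob_Im //; apply: divr_gt0; first by rewrite mulr_gt0 ?ltr0z.
by rewrite exprn_gt0 // cabs_gt0 (mob_den z0 D).
Qed.

(** Euclid's algorithm on the first column (a, c): translations reduce a mod c, the inversion
    exchanges the rows, and |c| decreases to 0. *)
Lemma euclid_ind (P : int -> int -> int -> int -> Prop) :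
  (forall a b d, P a b 0 d) ->
  (forall k a b c d, P a b c d -> P (a + k * c) (b + k * d) c d) ->
  (forall a b c d, P (- c) (- d) a b -> P a b c d) ->
  forall a b c d, P a b c d.
Proof.
move=> P0 PT PS a b c d; have [n] := ubnP `|c|%N; elim: n a b c d => // n IH a b c d cn.
have [->|c0] := eqVneq c 0; first exact: P0.
have -> : a = (a %% c)%Z + (a %/ c)%Z * c by rewrite addrC -divz_eq.
have -> : b = (b - (a %/ c)%Z * d) + (a %/ c)%Z * d by rewrite subrK.
apply: PT; apply: PS; apply: IH.
have := modz_ge0 a c0; have := ltz_mod a c0; lia.
Qed.

(** Scalar entries rather than [autj] and [mobius]: the matrices belonging to d t have determinant d
    and leave [SL2Z]. *)
Definition jz c d z : C := c%:~R * z + d%:~R.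
Definition mz a b c d z : C := (a%:~R * z + b%:~R) / jz c d z.

(* An integral matrix of positive determinant is brought into the upper
   triangular form (A, B; 0, D) by left multiplication by elements of SL2(Z). *)
Lemma hermite_transform a b c d : 0 < a * d - b * c -> exists A B D : int,
  [/\ 0 < A, 0 < D, A * D = a * d - b * c, A = gcdz a c & forall z, 0 < complex.Im z ->
    Delta (mz a b c d z) = (jz c d z / D%:~R) ^+ 12 * Delta ((A%:~R * z + B%:~R) / D%:~R) /\
    (a * d - b * c)%:~R * E2 (mz a b c d z) / jz c d z ^+ 2 =
      A%:~R / D%:~R * E2 ((A%:~R * z + B%:~R) / D%:~R) + 12 / c2 * (c%:~R / jz c d z)].
Proof.
move: a b c d; apply: euclid_ind => [a b d|k a b c d IH|a b c d IH].
- rewrite mulr0 subr0 gcdz0 => D; have d0 : d != 0 by apply/eqP => d0; move: D; rewrite d0 mulr0.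
  have a0 : a != 0 by apply/eqP => a0; move: D; rewrite a0 mul0r.
  (* The diagonal entries have the same sign s, which is cancelled from the fraction. *)
  have [s [s2 aE dE]] : exists s : int, [/\ s * s = 1, `|a| = s * a & `|d| = s * d].
    have [dn|dp] := ltP d 0.
      exists (-1); split=> //; rewrite ?ltr0_norm ?mulN1r // -(nmulr_lgt0 _ dn) //.
    exists 1; split=> //; rewrite ?ger0_norm ?mul1r //.
    by rewrite -(@pmulr_lge0 _ d) ?ltW // lt_def d0.
  exists `|a|, (s * b), `|d|; split; rewrite ?normr_gt0 //.
  - by rewrite aE dE mulrACA s2 mul1r.
  move=> z z0; rewrite /mz /jz mul0r add0r aE dE !rmorphM /=.
  have sC : (s%:~R : C) * s%:~R = 1 by rewrite -rmorphM s2.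
  have sn : s%:~R != 0 :> C by apply/eqP => s0; move: sC; rewrite s0 mul0r => /eqP; rewrite eq_sym oner_eq0.
  have dn : d%:~R != 0 :> C by rewrite intr_eq0.
  have -> : (s%:~R * a%:~R * z + s%:~R * b%:~R) / (s%:~R * d%:~R) = (a%:~R * z + b%:~R) / d%:~R.
    by field; rewrite dn sn.
  split.
    have -> : d%:~R / (s%:~R * d%:~R) = s%:~R :> C.
      by rewrite invfM mulrCA mulfV // mulr1; apply: (mulfI sn); rewrite mulfV.
    by rewrite (exprM _ 2 6) expr2 sC expr1n mul1r.
  rewrite mul0r mulr0 addr0; move: (E2 _) => x; by field; rewrite dn sn.
- have -> : (a + k * c) * d - (b + k * d) * c = a * d - b * c by ring.
  move=> D; have [A [B [Dd [A0 D0 AD AE H]]]] := IH D.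
  exists A, B, Dd; split=> //; first by rewrite AE [RHS]gcdzC addrC gcdzMDl gcdzC.
  move=> z z0; have n0 := mob_den z0 D.
  have -> : mz (a + k * c) (b + k * d) c d z = mz a b c d z + k%:~R.
    rewrite /mz /jz !rmorphD !rmorphM /=; move: n0; move: (c%:~R) (d%:~R) => x y n0.
    by field.
  have H0 : 0 < complex.Im (mz a b c d z) := mob_H z0 D.
  by rewrite Delta_int (E2_int _ H0); apply: H.
move=> D; have D' : 0 < - c * b - - d * a by move: D; congr (0 < _); ring.
have [A [B [Dd [A0 D0 AD AE H]]]] := IH D'.
exists A, B, Dd; split=> //; first by rewrite AD; ring.
  by rewrite AE gcdzC gcdzN.
move=> z z0; have n0 := mob_den z0 D; have n0' := mob_den z0 D'.
have E : mz a b c d z = - (mz (- c) (- d) a b z)^-1.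
  rewrite /mz /jz !rmorphN /= mulNr -opprD; move: n0 n0'.
  by move: (c%:~R * z + _) (a%:~R * z + _) => x y n0 n0'; field; rewrite n0 n0'.
have H0 : 0 < complex.Im (mz (- c) (- d) a b z) := mob_H z0 D'.
have [HD HE] := H z z0; rewrite E (Delta_S H0) (E2_S H0).
have M : mz (- c) (- d) a b z = - (jz c d z / jz a b z).
  by rewrite /mz /jz !rmorphN /= mulNr -opprD mulNr.
move: HE; have -> : - c * b - - d * a = a * d - b * c by ring.
(* The anomalies c / (c z + d) and a / (a z + b) before and after the inversion differ by what the
   last term of [E2_S] contributes. *)
have ac : c%:~R / jz c d z = a%:~R / jz a b z - (a * d - b * c)%:~R / (jz c d z * jz a b z).
  by rewrite /jz in n0 n0' *; rewrite rmorphB !rmorphM /=; field; rewrite n0 n0'.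
move=> HE; split.
  have dn : Dd%:~R != 0 :> C by rewrite intr_eq0 gt_eqF.
  have -> : (jz c d z / Dd%:~R) ^+ 12 = (- (jz c d z / Dd%:~R)) ^+ 12.
    by rewrite exprNn -signr_odd expr0 mul1r.
  rewrite HD M mulrA -exprMn; congr (_ ^+ _ * _).
  by field; rewrite dn n0'.
rewrite ac [X in _ = _ + X]mulrBr [RHS]addrA -HE M; have := twopii_neq0 R; move: (c2) (E2 _) => cc x c0.
move: n0 n0'; rewrite -/(jz c d z) -/(jz a b z); move: (jz c d z) (jz a b z) => u v u0 v0.
by field; rewrite c0 u0 v0.
Qed.

Lemma mulmx2 g h i j : (g *m h) i j = g i 0 * h 0 j + g i 1 * h 1 j.
Proof.
rewrite mxE big_ord_recl big_ord1; congr (_ + g i _ * h _ j); exact: val_inj.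
Qed.

Lemma det2 g : \det g = g 0 0 * g 1 1 - g 0 1 * g 1 0.
Proof.
rewrite (expand_det_row _ 0) !big_ord_recl big_ord0 /cofactor !det_mx11.
rewrite !mxE /= !expr0 !expr1 !mul1r addr0 mulN1r mulrN.
by congr (g _ _ * g _ _ - g _ _ * g _ _); apply: val_inj.
Qed.

Definition mx2 a b c d : 'M[int]_2 := \matrix_(i, j)
  (if i == 0 then (if j == 0 then a else b) else (if j == 0 then c else d)).

Lemma SL_det g : SL2Z g -> g 0 0 * g 1 1 - g 0 1 * g 1 0 = 1.
Proof. by rewrite /SL2Z /= det2. Qed.

Lemma SL_mx2 a b c d : a * d - b * c = 1 -> SL2Z (mx2 a b c d).
Proof. by rewrite /SL2Z /= det2 !mxE. Qed.

Lemma SL_mul g h : SL2Z g -> SL2Z h -> SL2Z (g *m h).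
Proof. by rewrite /SL2Z /= det_mulmx => -> ->; rewrite mulr1. Qed.

Lemma SL1 : SL2Z (1%:M : 'M[int]_2). Proof. by rewrite /SL2Z /= det1. Qed.

Definition inv2 g := mx2 (g 1 1) (- g 0 1) (- g 1 0) (g 0 0).

Lemma SL_inv g : SL2Z g -> SL2Z (inv2 g).
Proof. by move=> /SL_det E; apply: SL_mx2; rewrite -E; ring. Qed.

Lemma inv2Kl g : SL2Z g -> inv2 g *m g = 1%:M.
Proof.
move=> /SL_det E; apply/matrixP => i j; rewrite mulmx2 !mxE.
case: i => -[|[|i]] // hi; case: j => -[|[|j]] // hj /=.
- rewrite (_ : Ordinal hj = 0); last exact: val_inj.
  by rewrite -[1%:R]E; ring.
- rewrite (_ : Ordinal hj = 1); last exact: val_inj; ring.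
- rewrite (_ : Ordinal hj = 0); last exact: val_inj; ring.
rewrite (_ : Ordinal hj = 1); last exact: val_inj.
by rewrite -[1%:R]E; ring.
Qed.

Lemma SL_pos g : SL2Z g -> 0 < g 0 0 * g 1 1 - g 0 1 * g 1 0.
Proof. by move=> /SL_det ->. Qed.

Lemma autj_neq0 g t : SL2Z g -> autj g t != 0.
Proof. move=> /SL_pos; exact: mob_den (valP t). Qed.

Lemma mobiusM g h t : SL2Z g -> SL2Z h -> mobius (g *m h) t = mobius g (mobius h t).
Proof.
move=> Sg Sh; apply: val_inj; have Sgh := SL_mul Sg Sh.
rewrite !val_mobius // /autj val_mobius //.
have := autj_neq0 t Sgh; have := autj_neq0 t Sh; have := autj_neq0 (mobius h t) Sg.
rewrite /autj val_mobius // !mulmx2 !rmorphD !rmorphM /= /autj.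
move: (sval t) => z; move: (h 1 0)%:~R (h 1 1)%:~R (h 0 0)%:~R (h 0 1)%:~R => x1 x2 x3 x4.
move: (g 1 0)%:~R (g 1 1)%:~R (g 0 0)%:~R (g 0 1)%:~R => y1 y2 y3 y4.
have -> : (y3 * x3 + y4 * x1) * z + (y3 * x4 + y4 * x2) = y3 * (x3 * z + x4) + y4 * (x1 * z + x2) by ring.
have -> : (y1 * x3 + y2 * x1) * z + (y1 * x4 + y2 * x2) = y1 * (x3 * z + x4) + y2 * (x1 * z + x2) by ring.
move: (x3 * z + x4) (x1 * z + x2) => P Q _ n2 n3.
by field; rewrite n2 n3.
Qed.

Lemma autjM g h t : SL2Z g -> SL2Z h -> autj (g *m h) t = autj g (mobius h t) * autj h t.
Proof.
move=> Sg Sh; rewrite {2}/autj val_mobius // mulrDl mulrA divfK ?autj_neq0 //.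
rewrite /autj !mulmx2 !rmorphD !rmorphM /=; ring.
Qed.

Lemma mobius1 t : mobius 1%:M t = t.
Proof.
apply: val_inj; rewrite val_mobius ?/autj; last exact: SL1.
by rewrite !mxE /= mul0r add0r addr0 divr1 mul1r.
Qed.

Lemma autj1 t : autj 1%:M t = 1.
Proof. by rewrite /autj !mxE /= mul0r add0r. Qed.

(** [slash] with weights in Z, since quotients of forms may have negative weight. *)
Definition slashz (w : int) g f : H -> C := fun t => autj g t ^ (- w) * f (mobius g t).

Lemma slashzE (n : nat) g f : slashz n g f = slash n g f.
Proof. by apply/funext => t; rewrite /slashz /slash -exprnN. Qed.

Lemma slashzM w g h f : SL2Z g -> SL2Z h -> slashz w (g *m h) f = slashz w h (slashz w g f).
Proof.
move=> Sg Sh; apply/funext => t; rewrite /slashz mobiusM // autjM //.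
by rewrite exprMz_comm ?unitfE ?autj_neq0 //; [ring|exact: mulrC].
Qed.

Lemma slashz1 w f : slashz w 1%:M f = f.
Proof. by apply/funext => t; rewrite /slashz mobius1 autj1 exp1rz mul1r. Qed.

Lemma slashz_mul w v g f f' : SL2Z g ->
  slashz (w + v) g (fun t => f t * f' t) = fun t => slashz w g f t * slashz v g f' t.
Proof.
move=> Sg; apply/funext => t; rewrite /slashz opprD expfzDr ?autj_neq0 //; ring.
Qed.

Lemma slashz_exp w g f n : SL2Z g ->
  slashz (n%:Z * w) g (fun t => f t ^+ n) = fun t => slashz w g f t ^+ n.
Proof.
move=> Sg; elim: n => [|n IH].
  by apply/funext => t; rewrite /slashz mul0r oppr0 expr0z mul1r.
have -> : n.+1%:Z * w = w + n%:Z * w by rewrite -add1n PoszD mulrDl mul1r.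
have -> : (fun t => f t ^+ n.+1) = (fun t => f t * f t ^+ n) by apply/funext => t; rewrite exprS.
by rewrite slashz_mul // IH; apply/funext => t; rewrite exprS.
Qed.

Lemma slashz_inv w g f : SL2Z g ->
  slashz (- w) g (fun t => (f t)^-1) = fun t => (slashz w g f t)^-1.
Proof. by move=> Sg; apply/funext => t; rewrite /slashz opprK invfM invr_expz opprK. Qed.

End Mobius.

(** * Orders at the cusps of Gamma_0(6) *)

Section QOrder.
Variable R : realType.
Local Notation C := (Cx R).
Local Notation H := (upper_half R).
Local Notation e := (@e2ipi R).
Implicit Types (t : H) (f : H -> C) (N M : int).

Lemma e_int_nat (N : nat) (z : C) : e (N%:Z%:~R * z) = e z ^+ N.
Proof. by rewrite eX -pmulrn. Qed.

(* Order at least N in q_6 = e(t/6); a negative N allows a pole. *)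
Definition LO N f := exists a, FX 6 (fun t => e (- N%:~R * (val t / 6%:R)) * f t) a.

Lemma LO0 f : LO 0 f <-> exists a, FX 6 f a.
Proof.
by split=> -[a Ha]; exists a; apply: FX_ext Ha => t; rewrite oppr0 mul0r e0 mul1r.
Qed.

Lemma LO_ext N f f' : f =1 f' -> LO N f -> LO N f'.
Proof. by move=> /funext ->. Qed.

Lemma LO_mul N M f f' : LO N f -> LO M f' -> LO (N + M) (fun t => f t * f' t).
Proof.
move=> [a Ha] [b Hb]; exists (conv a b); apply: FX_ext (FX_mul _ Ha Hb) => // t.
by rewrite rmorphD /= opprD mulrDl eD; ring.
Qed.

Lemma LO_add N f f' : LO N f -> LO N f' -> LO N (fun t => f t + f' t).
Proof.
move=> [a Ha] [b Hb]; exists (fun n => a n + b n); apply: FX_ext (FX_add _ Ha Hb) => // t.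
by rewrite mulrDr.
Qed.

Lemma FX_q (N : nat) : FX 6 (fun t => e (val t / 6%:R) ^+ N) (xm R N).
Proof. by split; [apply: tame_xm|move=> t; rewrite psum_xm]. Qed.

Lemma LO_weak N M f : M <= N -> LO N f -> LO M f.
Proof.
move=> MN [a Ha]; exists (conv a (xm R `|N - M|%N)).
apply: FX_ext (FX_mul _ Ha (FX_q _)) => // t.
rewrite -e_int_nat gez0_abs ?subr_ge0 // mulrAC -eD rmorphB /=; congr (e _ * _); ring.
Qed.

Lemma LO_cst (k : C) : LO 0 (fun=> k).
Proof.
apply/LO0; exists (fun n => k * cone R n); apply: FX_ext (FX_scale k _ (FX_one R 6)) => // t.
by rewrite mulr1.
Qed.

Lemma LO_exp N f n : LO N f -> LO (n%:Z * N) (fun t => f t ^+ n).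
Proof.
move=> Hf; elim: n => [|n IH]; first by rewrite mul0r; apply: LO_ext (LO_cst 1).
have -> : n.+1%:Z * N = N + n%:Z * N by rewrite -add1n PoszD mulrDl mul1r.
by apply: LO_ext (LO_mul Hf IH) => t; rewrite exprS.
Qed.

Lemma FX_LO (N : nat) f (a : nat -> C) : FX 6 f a -> (forall n, (n < N)%N -> a n = 0) -> LO N f.
Proof.
move=> Ha a0; exists (fun n => a (n + N)%N); apply: FX_ext (FX_shift _ Ha a0) => // t.
by rewrite mulNr eN e_int_nat mulrC.
Qed.

Lemma LO_FX (N : nat) f : LO N f -> exists2 a, FX 6 f a & forall n, (n < N)%N -> a n = 0.
Proof.
move=> [a Ha]; exists (conv a (xm R N)).
  apply: FX_ext (FX_mul _ Ha (FX_q N)) => // t.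
  by rewrite mulNr eN e_int_nat mulrAC mulVf ?mul1r // expf_neq0 ?e_neq0.
by move=> n nN; rewrite conv_xm leqNgt nN.
Qed.

End QOrder.

(** * Forms with prescribed orders at the four cusps *)

Section Forms.
Variable R : realType.
Local Notation C := (Cx R).
Local Notation H := (upper_half R).
Local Notation e := (@e2ipi R).
Implicit Types (t : H) (f : H -> C) (g : 'M[int]_2) (w : int) (N M : nat -> int).

(** Labels the cusp g(oo): as 6 is squarefree, [Gamma0 6] has exactly one cusp for each divisor of
    6. *)
Definition cgcd g : nat := gcdn `|g 1%R 0%R|%N 6.

(* Weight w for Gamma0(6), of order at least N (gcd c 6), measured in q_6, at
   the cusp g(oo), where c is the lower left entry of g. *)
Definition Mf w N f := (forall g, Gamma0 6 g -> slashz w g f = f) /\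
  forall g, SL2Z g -> LO (N (cgcd g)) (slashz w g f).

Lemma Gamma0_SL g : Gamma0 6 g -> SL2Z g. Proof. by case. Qed.

Lemma cgcd_dvd g : (cgcd g %| 6)%N. Proof. exact: dvdn_gcdr. Qed.

Lemma cgcd_Gamma0 g : Gamma0 6 g -> cgcd g = 6%N.
Proof. by move=> [_]; rewrite dvdzE => g6; apply/gcdn_idPr. Qed.

Lemma Mf_mul w v N M f f' : Mf w N f -> Mf v M f' ->
  Mf (w + v) (fun m => N m + M m) (fun t => f t * f' t).
Proof.
move=> [If Lf] [If' Lf']; split=> g Hg.
  by rewrite slashz_mul ?If ?If' //; apply: Gamma0_SL.
by rewrite slashz_mul //; apply: LO_mul; [apply: Lf|apply: Lf'].
Qed.

Lemma Mf_exp w N f n : Mf w N f -> Mf (n%:Z * w) (fun m => n%:Z * N m) (fun t => f t ^+ n).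
Proof.
move=> [If Lf]; split=> g Hg.
  by rewrite slashz_exp ?If //; apply: Gamma0_SL.
by rewrite slashz_exp //; apply: LO_exp; apply: Lf.
Qed.

Lemma slashz_add w g f f' :
  slashz w g (fun t => f t + f' t) = fun t => slashz w g f t + slashz w g f' t.
Proof. by apply/funext => t; rewrite /slashz mulrDr. Qed.

Lemma Mf_add w N f f' : Mf w N f -> Mf w N f' -> Mf w N (fun t => f t + f' t).
Proof.
move=> [If Lf] [If' Lf']; split=> g Hg; first by rewrite slashz_add If ?If'.
by rewrite slashz_add; apply: LO_add; [apply: Lf|apply: Lf'].
Qed.

Lemma Mf_weak w N M f : (forall m, (m %| 6)%N -> M m <= N m) -> Mf w N f -> Mf w M f.
Proof.
move=> MN [If Lf]; split=> // g Hg; apply: LO_weak (Lf g Hg); apply: MN.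
exact: cgcd_dvd.
Qed.

Lemma Mf_cst (k : C) : Mf 0 (fun=> 0) (fun=> k).
Proof.
have E g : slashz 0 g (fun=> k) = fun=> k :> C by apply/funext => t; rewrite /slashz oppr0 expr0z mul1r.
by split=> g Hg; rewrite E //; apply: LO_cst.
Qed.

Lemma Mf_scale w N f (k : C) : Mf w N f -> Mf w N (fun t => k * f t).
Proof.
move=> Hf; have := Mf_mul (Mf_cst k) Hf; rewrite add0r.
by apply: Mf_weak => m _; rewrite add0r.
Qed.

Lemma Mf_ext w N f f' : f =1 f' -> Mf w N f -> Mf w N f'.
Proof. by move=> /funext ->. Qed.

Lemma trans_nat t (k : nat) : mobius (mx2 1 k%:Z 0 1) t = trans t k%:R.
Proof.
apply: val_inj; rewrite val_mobius; last by apply: SL_mx2; rewrite mulr0 subr0 mulr1.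
by rewrite /autj !mxE /= mul0r add0r divr1 mul1r rC_nat.
Qed.

(** Conjugating the translation by k with g gives the lower left entry -k c^2, and k c is divisible
    by 6 for k = 6 / gcd(c, 6). *)
Lemma slashz_period w f g t : (forall h, Gamma0 6 h -> slashz w h f = f) -> SL2Z g ->
  slashz w g f (trans t (6 %/ cgcd g)%:R) = slashz w g f t.
Proof.
move=> If Sg; set k := (6 %/ cgcd g)%N; pose T := mx2 1 k%:Z 0 1.
have ST : SL2Z T by apply: SL_mx2; rewrite mulr0 subr0 mulr1.
have Sgi := SL_inv Sg; pose G := g *m T *m inv2 g.
have SG : SL2Z G by do 2!apply: SL_mul => //.
have GG : Gamma0 6 G.
  split=> //; rewrite /G !mulmx2 !mxE /=.
  have -> : (g 1 0 * 1 + g 1 1 * 0) * g 1 1 + (g 1 0 * k + g 1 1 * 1) * - g 1 0 =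
    - (g 1 0 * k * g 1 0) by ring.
  rewrite dvdzE abszN !abszM absz_nat dvdn_mulr // /k.
  have [u uE] : exists u, `|g 1%R 0%R|%N = (u * cgcd g)%N by apply/dvdnP; apply: dvdn_gcdl.
  by rewrite uE -mulnA [(cgcd g * _)%N]mulnC divnK ?cgcd_dvd // dvdn_mull.
have E : slashz w (g *m T) f = slashz w g f.
  have -> : g *m T = G *m g by rewrite /G -!mulmxA inv2Kl // mulmx1.
  by rewrite slashzM // If.
rewrite -[RHS](congr1 (fun F => F t) E) slashzM // [RHS]/slashz trans_nat.
by rewrite /autj !mxE /= mul0r add0r exp1rz mul1r.
Qed.

(** Translation by 6/m multiplies the n-th term by e(n/m); coefficients being unique, only multiples
    of m occur. *)
Lemma FX_period f (a : nat -> C) m n : (m %| 6)%N -> FX 6 f a ->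
  (forall t, f (trans t (6 %/ m)%:R) = f t) -> ~~ (m %| n)%N -> a n = 0.
Proof.
move=> m6 Ha P mn; pose k := (6 %/ m)%N; pose z := e (k%:R / 6%:R).
have m0 : (0 < m)%N := dvdn_gt0 (ltn0Sn 5) m6.
have km : (k * m)%N = 6%N by rewrite divnK.
have z1 : cabs z = 1.
  rewrite /z cabs_e (_ : complex.Im _ = 0) ?mulr0 ?oppr0 ?expR0 //.
  by rewrite Im_divn -rC_nat /= mul0r.
have Hb : FX 6 f (cdil 1 z a).
  apply: (@FX_dil _ 6 1 z a) => // [|t]; first by case: Ha.
  rewrite -P; case: Ha => _ ->; congr (psum a _).
  by rewrite val_trans rC_nat mulrDl eD expr1 mulrC.
have := FX_uniq (ltn0Sn 5) Ha Hb n; rewrite /cdil dvd1n divn1 => E.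
apply/eqP; apply: contraT => an; case/negP: mn.
have : z ^+ n = 1 by apply: (mulfI an); rewrite mulr1 -E.
rewrite /z eX => /e_eq1 [l lE].
have : ((n * k)%:Z)%:~R = (l * 6)%:~R :> C.
  by rewrite [RHS]rmorphM /= -lE -pmulrn natrM; field.
move=> /intr_inj => F; have : (6 %| n * k)%N.
  by rewrite -(absz_nat (n * k)%N) F abszM dvdn_mull.
by rewrite -km mulnC dvdn_pmul2r // -(ltn_pmul2r m0) km.
Qed.

Lemma modular_Mf (n : nat) f : modular_form n 6 f <-> Mf n (fun=> 0) f.
Proof.
split=> [[Hf If Lf]|[If Lf]].
  split=> g Hg; rewrite slashzE; first exact: If.
  by apply/LO0; have [a Ha] := Lf g Hg; exists a; apply: FE_FX.
split=> [|g Hg|g Hg].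
- have /LO0[a] := Lf _ SL1; rewrite slashz1; exact: FX_holomorphic.
- by rewrite -slashzE If.
by rewrite -slashzE; have /LO0[a Ha] := Lf g Hg; exists a; apply: FX_FE.
Qed.

(** By [FX_period] only multiples of gcd(c, 6) occur as exponents, so losing the constant term gains
    that much order. *)
Lemma cusp_Mf (n : nat) f : cusp_form n 6 f -> Mf n (fun m => m%:Z) f.
Proof.
move=> [/modular_Mf[If _] Cf]; split=> // g Hg; have [a [Ha a0]] := Cf g Hg.
have := FE_FX (ltn0Sn 5) Ha; rewrite -slashzE => {}Ha.
apply: (FX_LO Ha) => -[|k] // kN; apply: FX_period Ha _ _.
- exact: cgcd_dvd.
- by move=> t; apply: slashz_period.
- by apply: contraL kN => /dvdn_leq kN; rewrite -leqNgt; apply: kN.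
Qed.

Lemma Mf_cusp (n : nat) f : Mf n (fun m => m%:Z) f -> cusp_form n 6 f.
Proof.
move=> Hf; split; first by apply/modular_Mf; apply: Mf_weak Hf.
move=> g Hg; case: Hf => _ /(_ g Hg) /LO_FX[a Ha a0]; exists a.
split; first by rewrite -slashzE; apply: FX_FE.
by apply: a0; rewrite gcdn_gt0 orbT.
Qed.

End Forms.

(** * Forms of negative weight vanish *)

Section Cosets.
Variable R : realType.
Local Notation C := (Cx R).
Local Notation H := (upper_half R).
Local Notation e := (@e2ipi R).
Implicit Types (t : H) (f : H -> C) (g : 'M[int]_2).

Lemma Im_mobius g t : SL2Z g ->
  complex.Im (val (mobius g t)) = complex.Im (val t) / cabs (autj g t) ^+ 2.
Proof.
move=> Sg; rewrite val_mobius // /autj (mob_Im (valP t) (SL_pos Sg)).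
by rewrite (SL_det Sg) mul1r.
Qed.

Lemma near_int (x : R) : exists n : int, `|x + n%:~R| <= 1 / 2.
Proof.
exists (- Num.floor (x + 1 / 2)); rewrite rmorphN /=.
have := floor_le_tmp (x + 1 / 2); have := floorD1_gt (x + 1 / 2).
by rewrite intrD1; move: (_%:~R) => y h1 h2; rewrite ler_norml; apply/andP; split; lra.
Qed.

Definition Tn (n : int) := mx2 1 n 0 1.
Definition Sm := mx2 0 (-1) 1 0.

Lemma SL_T n : SL2Z (Tn n). Proof. by apply: SL_mx2; rewrite mulr0 subr0 mulr1. Qed.
Lemma SL_S : SL2Z Sm. Proof. by apply: SL_mx2; rewrite mul0r mulr1 sub0r opprK. Qed.

(* If Im t < 1/2 and |Re t| <= 1/2 then |t|^2 <= 1/2, so S at least doubles Im t. *)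
Lemma reduction t : exists2 g, SL2Z g & 1 / 2 <= complex.Im (val (mobius g t)).
Proof.
have [n Hn] : exists n : nat, 1 / 2 <= 2 ^+ n * complex.Im (val t).
  have t0 := valP t; have [n Hn] := nat_ge (complex.Im (val t))^-1; exists n.
  have h : (complex.Im (val t))^-1 <= 2 ^+ n.
    by apply: le_trans Hn _; rewrite -natrX ler_nat ltnW // ltn_expl.
  have : 1 <= 2 ^+ n * complex.Im (val t) by rewrite -ler_pdivrMr // div1r.
  move: (_ * _) => p; lra.
elim: n t Hn => [|n IH] t Hn.
  by exists 1%:M; [exact: SL1|rewrite mobius1; move: Hn; rewrite expr0 [leRHS]mul1r].
have [tb|ts] := leP (1 / 2) (complex.Im (val t)).
  by exists 1%:M; [exact: SL1|rewrite mobius1].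
have [k Hk] := near_int (complex.Re (val t)).
have Tv : val (mobius (Tn k) t) = val t + k%:~R.
  rewrite val_mobius; last exact: SL_T.
  by rewrite /autj /Tn !mxE /= mul0r add0r divr1 mul1r.
have ST : SL2Z (Sm *m Tn k) := SL_mul SL_S (SL_T k).
have [g Sg Hg] : exists2 g, SL2Z g & 1 / 2 <= complex.Im (val (mobius g (mobius (Sm *m Tn k) t))).
  apply: IH; rewrite Im_mobius // (autjM t SL_S (SL_T k)).
  have -> : autj (Tn k) t = 1 by rewrite /autj /Tn !mxE /= mul0r add0r.
  have -> : autj Sm (mobius (Tn k) t) = val t + k%:~R by rewrite /autj Tv /Sm !mxE /= mul1r addr0.
  rewrite mulr1 cabs_sqr ReD ImD Im_int addr0 -rC_int /=.
  apply: le_trans Hn _; rewrite exprSr -mulrA ler_wpM2l ?exprn_ge0 //.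
  have t0 := valP t; rewrite ler_pdivlMr; last first.
    by rewrite ltr_wpDl ?sqr_ge0 // exprn_gt0.
  move: Hk; rewrite ler_norml => /andP[h1 h2].
  rewrite /= in ts t0 h1 h2 *; move: ts t0 h1 h2.
  move: (complex.Re _ + _) (complex.Im _) => x y ts t0 h1 h2.
  have h : x ^+ 2 + y ^+ 2 <= 1 / 2 by nra.
  have -> : 2 * y * (x ^+ 2 + y ^+ 2) = y * (2 * (x ^+ 2 + y ^+ 2)) by ring.
  by rewrite ler_piMr ?(ltW t0) //; move: h; move: (_ + _) => v; lra.
by exists (g *m (Sm *m Tn k)); [exact: SL_mul|rewrite (mobiusM t Sg ST)].
Qed.

(** For Im t >= 1/2 the series is dominated termwise by its absolute values at height 1/2. *)
Lemma FX_bounded f (a : nat -> C) : FX 6 f a ->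
  exists B : R, forall t, 1 / 2 <= complex.Im (val t) -> cabs (f t) <= B.
Proof.
move=> Ha; have i0 : 0 < complex.Im (Complex 0 (1 / 2) : C) by rewrite /= divr_gt0.
pose t0 : H := mkH i0; pose r := cabs (e (val t0 / 6%:R)).
have r1 : r < 1 by apply: cabs_e_lt1.
have [ta _] := Ha; have [_ [B HB]] := tame_bsum ta (cabs_ge0 _) r1.
exists B => t Ht; apply: hsum_le (FX_hsum t (ltn0Sn 5) Ha) _ => K uK.
apply: le_trans (HB K uK); apply: ler_sum => n _; rewrite cabsM cabsX.
apply: ler_wpM2l; first exact: cabs_ge0.
apply: lerXn2r; rewrite ?nnegrE ?cabs_ge0 // /r !cabs_e ler_expR lerN2 !Im_divn.
by rewrite ler_wpM2l ?ler_wpM2r ?invr_ge0 // mulr_ge0 // pi_ge0.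
Qed.

(** The lower row mod 6 fixes the coset of [Gamma0 6], since g g0^-1 has lower left entry c d0 - d
    c0; one expansion serves the whole class. *)
Lemma coset_bounded w f (i j : 'I_6) : Mf w (fun=> 0) f -> exists B : R,
  forall g, SL2Z g -> (g 1%R 0%R == i%:Z %[mod 6])%Z -> (g 1%R 1%R == j%:Z %[mod 6])%Z ->
  forall t, 1 / 2 <= complex.Im (val t) -> cabs (slashz w g f t) <= B.
Proof.
move=> [If Lf].
have [[g0 [S0 c0 d0]]|N] := pselect (exists g, [/\ SL2Z g, (g 1%R 0%R == i%:Z %[mod 6])%Z &
  (g 1%R 1%R == j%:Z %[mod 6])%Z]); last first.
  by exists 0 => g Sg cg dg; case: N; exists g.
have /LO0[a Ha] := Lf g0 S0; have [B HB] := FX_bounded Ha; exists B => g Sg cg dg t Ht.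
have Sgi := SL_inv S0; have SG := SL_mul Sg Sgi.
have GG : Gamma0 6 (g *m inv2 g0).
  split=> //; rewrite mulmx2 !mxE /=.
  have : (g0 1%R 1%R * g 1%R 0%R == g0 1%R 0%R * g 1%R 1%R %[mod 6])%Z.
    rewrite -[X in X == _]modzMm -[X in _ == X]modzMm (eqP cg) (eqP dg) (eqP c0) (eqP d0).
    by rewrite mulrC.
  by rewrite eqz_mod_dvd; congr (_ %| _)%Z; ring.
have -> : g = (g *m inv2 g0) *m g0 by rewrite -mulmxA inv2Kl // mulmx1.
by rewrite slashzM // If //; apply: HB.
Qed.

(* |f| (Im t)^(-12) is bounded: t = h t' with Im t' >= 1/2 and h among finitely
   many cosets.  So Cauchy's estimate for the coefficients of f tends to 0 with Im t. *)
Lemma negative_weight f : Mf (- 24) (fun=> 0) f -> forall t, f t = 0.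
Proof.
move=> Mff; have [If Lf] := Mff.
have HB (p : 'I_6 * 'I_6) := coset_bounded p.1 p.2 Mff.
have [B HB'] : exists B : 'I_6 * 'I_6 -> R, forall (p : 'I_6 * 'I_6) g, SL2Z g ->
  (g 1%R 0%R == p.1%:Z %[mod 6])%Z -> (g 1%R 1%R == p.2%:Z %[mod 6])%Z ->
  forall t, 1 / 2 <= complex.Im (val t) -> cabs (slashz (- 24) g f t) <= B p.
  by exists (fun p => sval (cid (HB p))) => p; apply: (svalP (cid (HB p))).
pose M := \sum_p `|B p|.
have M0 : 0 <= M by apply: sumr_ge0.
have HM g t : SL2Z g -> 1 / 2 <= complex.Im (val t) -> cabs (slashz (- 24) g f t) <= M.
  move=> Sg Ht; have md (x : int) : exists i : 'I_6, (x == i%:Z %[mod 6])%Z.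
    have l : (`|(x %% 6)%Z|%N < 6)%N by have := ltz_mod x (_ : 6 != 0); have := modz_ge0 x (_ : 6 != 0); lia.
    by exists (Ordinal l); rewrite /= gez0_abs ?modz_ge0 // modz_mod.
  have [i Hi] := md (g 1 0); have [j Hj] := md (g 1 1).
  apply: le_trans (HB' (i, j) g Sg Hi Hj t Ht) _; apply: le_trans (ler_norm _) _.
  by rewrite /M (bigD1 (i, j)) //= lerDl sumr_ge0.
(* With Im t' >= 1/2, the automorphy factor satisfies |j|^-24 = (Im t / Im t')^12 <= (2 Im t)^12. *)
have bnd t : cabs (f t) <= M * (2 * complex.Im (val t)) ^+ 12.
  have [h Sh Hh] := reduction t; have Shi := SL_inv Sh.
  set t' := mobius h t in Hh.
  have tE : mobius (inv2 h) t' = t by rewrite /t' -mobiusM // inv2Kl // mobius1.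
  have jn := autj_neq0 t' Shi.
  have fE : f t = slashz (- 24) (inv2 h) f t' * autj (inv2 h) t' ^- 24.
    by rewrite /slashz tE opprK -exprnP mulrAC mulfV ?mul1r // expf_neq0.
  have IE := Im_mobius t' Shi; rewrite tE in IE.
  rewrite fE cabsM cabsV cabsX; apply: ler_pM; rewrite ?invr_ge0 ?exprn_ge0 ?cabs_ge0 //.
    exact: HM.
  have j0 : 0 < cabs (autj (inv2 h) t') by rewrite cabs_gt0.
  rewrite -exprVn (exprM _ 2 12); apply: lerXn2r; rewrite ?nnegrE ?exprn_ge0 ?invr_ge0 ?(ltW j0) //.
    by rewrite mulr_ge0 // ltW // (valP t).
  rewrite IE exprVn mulrA ler_peMl ?invr_ge0 ?exprn_ge0 ?(ltW j0) //.
  move: Hh; move: (complex.Im _) => y; lra.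
have /LO0[a] := Lf _ SL1; rewrite slashz1 => Ha.
suff a0 n : a n = 0.
  move=> t; apply: hsum_uniq (FX_hsum t (ltn0Sn 5) Ha) _.
  by apply: hsum_ext (@hsum0 R nat) => n; rewrite a0 mul0r.
apply: cabs_inf_eq0 => eps eps0.
pose K := M * 2 ^+ 12 * expR (2 * pi * n%:R).
have K0 : 0 <= K by rewrite !mulr_ge0 ?exprn_ge0 ?expR_ge0.
(* At height y <= 1 the estimate gives |a_n| <= M (2y)^12 exp (2 pi n y / 6) <= K y, which this y
   makes less than [eps]. *)
pose y := Num.min 1 (eps / (K + 1) / 2).
have y0 : 0 < y by rewrite lt_min ltr01 !divr_gt0 // ltr_wpDl.
have y1 : y <= 1 by rewrite ge_min lexx.
have i0 : 0 < complex.Im (Complex 0 y : C) by [].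
pose t : H := mkH i0.
have := @cauchy_estimate R 6 f a n t (M * (2 * y) ^+ 12) (ltn0Sn 5) Ha.
have bt x : cabs (f (trans t x)) <= M * (2 * y) ^+ 12.
  by have := bnd (trans t x); rewrite val_trans ImD /= addr0.
move=> /(_ bt); rewrite cabs_e Im_divn /= -expRM_natl.
have p0 := expR_gt0 (n%:R * - (2 * pi * (y / 6%:R))).
rewrite -ler_pdivlMr // => E; apply: le_lt_trans E _.
rewrite -expRN mulrN opprK.
apply: (@le_lt_trans _ _ (K * y)).
  have c0 : 0 <= M * 2 ^+ 12 by rewrite mulr_ge0 // exprn_ge0.
  rewrite /K exprMn [leRHS]mulrAC (mulrA M).
  apply: ler_pM; [by rewrite (mulr_ge0 c0) // exprn_ge0 // ltW|exact: expR_ge0| |].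
    apply: ler_wpM2l => //.
    by rewrite exprS ler_piMr ?(ltW y0) // exprn_ile1 // ltW.
  rewrite ler_expR [leRHS]mulrC; apply: ler_wpM2l => //.
  have pi0 : 0 <= 2 * pi :> R by rewrite mulr_ge0 // pi_ge0.
  by rewrite ler_piMr // ler_pdivrMr // mul1r (le_trans y1) // ler1n.
apply: (@le_lt_trans _ _ (K * (eps / (K + 1) / 2))).
  by rewrite ler_wpM2l // ge_min lexx orbT.
have k1 : 0 < K + 1 by rewrite ltr_wpDl.
have -> : K * (eps / (K + 1) / 2) = eps * (K / (K + 1) / 2) by field; rewrite gt_eqF.
rewrite -[ltRHS]mulr1 ltr_pM2l // ltr_pdivrMr // mul1r ltr_pdivrMr //; lra.
Qed.

End Cosets.

(** * Forms built from E_2(d t) and Delta(d t) *)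

Section LevelForms.
Variable R : realType.
Local Notation C := (Cx R).
Local Notation H := (upper_half R).
Local Notation e := (@e2ipi R).
Local Notation c2 := (2 * iC R * piC R).
Implicit Types (t : H) (f : H -> C) (g : 'M[int]_2).

Definition FC h (c : C) f := exists2 a, FX h f a & a 0%N = c.

Lemma FC_ext h c f f' : f =1 f' -> FC h c f -> FC h c f'.
Proof. by move=> /funext ->. Qed.

Lemma FC_mul h c c' f f' : (0 < h)%N -> FC h c f -> FC h c' f' -> FC h (c * c') (fun t => f t * f' t).
Proof.
move=> h0 [a Ha <-] [b Hb <-]; exists (conv a b); first exact: FX_mul.
by rewrite /conv big_ord1.
Qed.

Lemma FC_add h c c' f f' : (0 < h)%N -> FC h c f -> FC h c' f' -> FC h (c + c') (fun t => f t + f' t).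
Proof. by move=> h0 [a Ha <-] [b Hb <-]; exists (fun n => a n + b n) => //; apply: FX_add. Qed.

Lemma FC_scale h c f k : (0 < h)%N -> FC h c f -> FC h (k * c) (fun t => k * f t).
Proof. by move=> h0 [a Ha <-]; exists (fun n => k * a n) => //; apply: FX_scale. Qed.

Lemma FC_one h : FC h 1 (fun=> 1).
Proof. by exists (cone R) => //; apply: FX_one. Qed.

Lemma FC_exp h c f n : (0 < h)%N -> FC h c f -> FC h (c ^+ n) (fun t => f t ^+ n).
Proof.
move=> h0 Hf; elim: n => [|n IH]; first exact: FC_one.
by rewrite exprS; apply: FC_ext (FC_mul h0 Hf IH) => t; rewrite exprS.
Qed.

Lemma FC_uniq h c c' f : (0 < h)%N -> FC h c f -> FC h c' f -> c = c'.
Proof. by move=> h0 [a Ha <-] [b Hb <-]; apply: FX_uniq h0 Ha Hb 0%N. Qed.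

Lemma FC_dil (d : nat) f (a : nat -> C) : (0 < d)%N -> tame a ->
  (forall t, f t = psum a (e (d%:R * val t))) -> FC 1 (a 0%N) f.
Proof.
move=> d0 ta E; exists (cdil d 1 a); last by rewrite /cdil dvdn0 div0n expr0 mulr1.
have E' t : f t = psum a (1 * e (val t / 1%:R) ^+ d) by rewrite E mul1r divr1 eX.
exact: (@FX_dil R 1 d 1 a f (ltn0Sn 0) d0 (cabs1 R) ta E').
Qed.

(** A series with nonzero constant term is no zero divisor: the lowest coefficient of the other
    factor would survive in the product. *)
Lemma FC_cancel h c f f' : (0 < h)%N -> c != 0 -> FC h c f ->
  (exists a, FX h f' a) -> (forall t, f' t * f t = 0) -> forall t, f' t = 0.
Proof.
move=> h0 c0 [s Hs sc] [a Ha] E.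
have Z := FX_eq0 h0 (FX_mul h0 Ha Hs) E.
have a0 n : a n = 0.
  have [m] := ubnP n; elim: m n => // m IH n nm.
  have := Z n; rewrite /conv big_ord_recr /= subnn sc big1 ?add0r.
    by move=> /eqP; rewrite mulf_eq0 (negPf c0) orbF => /eqP.
  by move=> i _; rewrite IH ?mul0r //; apply: leq_trans (ltn_ord i) _.
move=> t; apply: hsum_uniq (FX_hsum t h0 Ha) _.
by apply: hsum_ext (@hsum0 R nat) => n; rewrite a0 mul0r.
Qed.

(** Constant terms give k = 1; then f - f' divides f^n - f'^n = 0 with a cofactor of constant term
    n. *)
Lemma root_uniq n k f f' : (0 < n)%N -> FC 1 1 f -> FC 1 1 f' ->
  (forall t, f t ^+ n = k * f' t ^+ n) -> forall t, f t = f' t.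
Proof.
move=> n0 Hf Hf' E.
have k1 : k = 1.
  have h1 := FC_exp n (ltn0Sn 0) Hf; have h2 := FC_scale k (ltn0Sn 0) (FC_exp n (ltn0Sn 0) Hf').
  have := FC_uniq (ltn0Sn 0) (FC_ext E h1) h2; by rewrite !expr1n mulr1.
have HS m : FC 1 m%:R (fun t => \sum_(i < m) f t ^+ (n.-1 - i) * f' t ^+ i).
  elim: m => [|m IH].
    have h := FC_scale 0 (ltn0Sn 0) (FC_one 1); rewrite mul0r in h.
    by apply: FC_ext h => t; rewrite big_ord0.
  have h := FC_mul (ltn0Sn 0) (FC_exp (n.-1 - m) (ltn0Sn 0) Hf) (FC_exp m (ltn0Sn 0) Hf').
  rewrite !expr1n mulr1 in h; rewrite -natr1; apply: FC_ext (FC_add (ltn0Sn 0) IH h) => t.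
  by rewrite big_ord_recr.
have d0 : exists a, FX 1 (fun t => f t - f' t) a.
  have [a Ha _] := FC_add (ltn0Sn 0) Hf (FC_scale (-1) (ltn0Sn 0) Hf').
  by exists a; apply: FX_ext Ha => t; rewrite mulN1r.
have n1 : n%:R != 0 :> C by rewrite pnatr_eq0 -lt0n.
move=> t; apply/eqP; rewrite -subr_eq0; apply/eqP; move: t.
apply: (FC_cancel (ltn0Sn 0) n1 (HS n) d0) => t.
by rewrite -subrXX E k1 mul1r subrr.
Qed.

Definition Dl (d : nat) : H -> C := fun t => Delta (d%:R * val t).
(** The factor d makes the quasi-modular defect under g independent of d. *)
Definition el (d : nat) : H -> C := fun t => d%:R * E2 (d%:R * val t).
(** Order of Delta(d t) in q_6 at the cusp of gcd m: the triangular form has A = gcd(d, m) and A D =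
    d, hence order 6 A / D = 6 A^2 / d. *)
Definition ordD (d m : nat) : nat := (6 * gcdn d m ^ 2 %/ d)%N.

(** [hermite_transform] for diag(d, 1) g. If a and c form the first column of g, then A = gcd(d a,
    c) = gcd(d, c), as a and c are coprime. *)
Lemma level_matrix (d : nat) g : (d %| 6)%N -> SL2Z g -> exists (A D : nat) (B : int),
  [/\ A = gcdn d (cgcd g), (0 < A)%N, (A * D)%N = d & forall t,
    Dl d (mobius g t) = (autj g t / D%:R) ^+ 12 * Delta ((A%:R * val t + B%:~R) / D%:R) /\
    el d (mobius g t) / autj g t ^+ 2 = A%:R / D%:R * E2 ((A%:R * val t + B%:~R) / D%:R) +
      12 / c2 * ((g 1 0)%:~R / autj g t)].
Proof.
move=> d6 Sg; have d0 : (0 < d)%N := dvdn_gt0 (ltn0Sn 5) d6.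
have dE : (d%:Z * g 0 0) * g 1 1 - (d%:Z * g 0 1) * g 1 0 = d%:Z.
  by rewrite -!mulrA -mulrBr SL_det // mulr1.
have D0 : 0 < (d%:Z * g 0 0) * g 1 1 - (d%:Z * g 0 1) * g 1 0 by rewrite dE.
have [A [B [D [A0 D1 AD AE HM]]]] := @hermite_transform R _ _ _ _ D0.
have cop : coprime `|g 1%R 0%R|%N `|g 0%R 0%R|%N.
  rewrite -coprimezE; apply/coprimezP; exists (- g 0 1, g 1 1) => /=.
  by rewrite -(SL_det Sg); ring.
have Ag : `|A|%N = gcdn d (cgcd g).
  rewrite AE /gcdz absz_nat abszM absz_nat gcdnC Gauss_gcdl //.
  by rewrite /cgcd gcdnCA (gcdn_idPl d6).
exists `|A|%N, `|D|%N, B; split=> //.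
- by rewrite absz_gt0 gt_eqF.
- by rewrite -abszM AD dE.
move=> t; have [] := HM _ (valP t).
have jE : jz (g 1 0) (g 1 1) (val t) = autj g t by [].
have mE : mz (d%:Z * g 0 0) (d%:Z * g 0 1) (g 1 0) (g 1 1) (val t) = d%:R * val (mobius g t).
  by rewrite /mz jE val_mobius // !rmorphM /= -pmulrn -!mulrA -mulrDr mulrA.
have AC : A%:~R = `|A|%N%:R :> C by rewrite -[A in LHS]gez0_abs ?(ltW A0).
have DC : D%:~R = `|D|%N%:R :> C by rewrite -[D in LHS]gez0_abs ?(ltW D1).
by rewrite mE jE dE AC DC /Dl /el -pmulrn.
Qed.

Section Triangular.
Variables (A D : nat) (B : int).
Hypotheses (A0 : (0 < A)%N) (D6 : (D %| 6)%N).
(** In these terms e((A t + B) / D) is z q_6^k. *)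
Let k := (6 %/ D * A)%N.
Let z : C := e (B%:~R / D%:R).

Lemma tri_k : (0 < k)%N.
Proof. by rewrite muln_gt0 A0 andbT divn_gt0 ?(dvdn_gt0 _ D6) // dvdn_leq. Qed.

Lemma tri_z : cabs z = 1.
Proof.
rewrite /z cabs_e (_ : complex.Im _ = 0) ?mulr0 ?oppr0 ?expR0 //.
by rewrite Im_divn -rC_int /= mul0r.
Qed.

Lemma tri_e t : e ((A%:R * val t + B%:~R) / D%:R) = z * e (val t / 6%:R) ^+ k.
Proof.
rewrite /z eX -eD; congr e; rewrite /k natrM.
have D0 : D%:R != 0 :> C by rewrite pnatr_eq0 -lt0n (dvdn_gt0 _ D6).
have -> : (6 %/ D)%:R = 6 / D%:R :> C by apply: (mulIf D0); rewrite -natrM divnK // divfK.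
by field.
Qed.

Lemma tri_Im t : 0 < complex.Im ((A%:R * val t + B%:~R) / D%:R).
Proof.
have t0 := valP t; have D0 := dvdn_gt0 (ltn0Sn 5) D6.
by rewrite Im_divn ImD Im_int addr0 pmulrn ImM_int divr_gt0 ?mulr_gt0 ?ltr0n // ltr0z.
Qed.

Lemma tri_FC (a : nat -> C) f : tame a ->
  (forall t, f t = psum a (e ((A%:R * val t + B%:~R) / D%:R))) -> FC 6 (a 0%N) f.
Proof.
move=> ta E; exists (cdil k z a); last by rewrite /cdil dvdn0 div0n expr0 mulr1.
have E' t : f t = psum a (z * e (val t / 6%:R) ^+ k) by rewrite E tri_e.
exact: (@FX_dil R 6 k z a f (ltn0Sn 5) tri_k tri_z ta E').
Qed.

Lemma tri_LO (a : nat -> C) f (N : int) : tame a ->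
  (forall t, f t = e (N%:~R * ((A%:R * val t + B%:~R) / D%:R)) *
     psum a (e ((A%:R * val t + B%:~R) / D%:R))) -> LO (N * k%:Z) f.
Proof.
move=> ta E; have [b Hb _] := tri_FC ta (fun t => erefl).
exists (fun n => e (N%:~R * (B%:~R / D%:R)) * b n); apply: FX_ext (FX_scale _ (ltn0Sn 5) Hb) => t.
rewrite E [RHS]mulrA -eD; congr (e _ * _).
have D0 : D%:R != 0 :> C by rewrite pnatr_eq0 -lt0n (dvdn_gt0 _ D6).
rewrite rmorphM /=; have -> : k%:Z%:~R = 6 / D%:R * A%:R :> C.
  apply: (mulIf D0); rewrite -pmulrn /k natrM mulrAC -natrM divnK //.
  by field.
by field.
Qed.

End Triangular.

Lemma ordD_tri (A D d m : nat) : (0 < A)%N -> (A * D)%N = d -> (d %| 6)%N -> A = gcdn d m ->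
  (6 %/ D * A)%N = ordD d m.
Proof.
move=> A0 AD d6 AE; rewrite /ordD -AE -AD.
have D0 : (0 < D)%N by move: (dvdn_gt0 (ltn0Sn 5) d6); rewrite -AD muln_gt0 => /andP[].
have /dvdnP[u uE] : (D %| 6)%N by apply: dvdn_trans d6; rewrite -AD dvdn_mull.
by rewrite uE mulnK // -mulnn mulnACA [(D * A)%N]mulnC mulnK // muln_gt0 A0.
Qed.

Definition s1 : nat -> C := fun n => cone R n + (- 24) * sig R n.

Lemma tame_s1 : tame s1.
Proof. by apply: tame_add; [exact: tame_cone|exact/tame_scale/tame_sig]. Qed.

Lemma s1_0 : s1 0 = 1. Proof. by rewrite /s1 sig0 mulr0 addr0. Qed.

Lemma Dl_neq0 d t : (0 < d)%N -> Dl d t != 0.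
Proof. by move=> d0; apply: Delta_neq0; apply: TT_rel (valP t) d0. Qed.

Lemma tri_Dl (A D : nat) (B : int) : (0 < A)%N -> (D %| 6)%N ->
  LO (6 %/ D * A)%N%:Z (fun t => Delta ((A%:R * val t + B%:~R) / D%:R)) /\
  LO (- (6 %/ D * A)%N%:Z) (fun t => (Delta ((A%:R * val t + B%:~R) / D%:R))^-1).
Proof.
move=> A0 D6; split.
  have := @tri_LO A D B A0 D6 (P24 R) (fun t => Delta ((A%:R * val t + B%:~R) / D%:R)) 1 (@tame_P24 R).
  rewrite mul1r; apply => t; by rewrite /Delta mul1r.
have := @tri_LO A D B A0 D6 (P24' R) (fun t => (Delta ((A%:R * val t + B%:~R) / D%:R))^-1) (- 1) (@tame_P24' R).
rewrite mulN1r; apply => t; by rewrite (DeltaV (tri_Im B A0 D6 t)) mulN1r.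
Qed.

Lemma Dl_slash d g : (d %| 6)%N -> SL2Z g ->
  [/\ Gamma0 6 g -> slashz 12%:Z g (Dl d) = Dl d,
     LO (ordD d (cgcd g))%:Z (slashz 12%:Z g (Dl d)) &
     LO (- (ordD d (cgcd g))%:Z) (fun t => (slashz 12%:Z g (Dl d) t)^-1)].
Proof.
move=> d6 Sg; have [A [D [B [AE A0 AD HM]]]] := level_matrix d6 Sg.
have d0 : (0 < d)%N := dvdn_gt0 (ltn0Sn 5) d6.
have D6 : (D %| 6)%N by apply: dvdn_trans d6; rewrite -AD dvdn_mull.
have D0 : D%:R != 0 :> C by rewrite pnatr_eq0 -lt0n (dvdn_gt0 _ D6).
have E t : slashz 12%:Z g (Dl d) t = D%:R ^- 12 * Delta ((A%:R * val t + B%:~R) / D%:R).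
  have [HD _] := HM t; rewrite /slashz HD -exprnN.
  move: (Delta _) (autj_neq0 t Sg) => X; move: (autj g t) => j j0.
  by rewrite expr_div_n mulrA [j ^- 12 * _]mulrA mulVf ?mul1r // expf_neq0.
have [L L'] := tri_Dl B A0 D6; rewrite -(ordD_tri A0 AD d6 AE); split.
- move=> Gg; have Ad : A = d by rewrite AE cgcd_Gamma0 //; apply/gcdn_idPl.
  have D1 : D = 1%N by apply/eqP; rewrite -(eqn_pmul2l A0) AD muln1 Ad.
  by apply/funext => t; rewrite E D1 Ad [X in Delta X]divr1 Delta_int expr1n invr1 mul1r.
- have := LO_mul (LO_cst (D%:R ^- 12)) L; rewrite add0r; apply: LO_ext => t; by rewrite E.
have := LO_mul (LO_cst (D%:R ^+ 12)) L'; rewrite add0r; apply: LO_ext => t.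
by rewrite E [RHS]invfM invrK.
Qed.

Lemma Mf_Dl d : (d %| 6)%N -> Mf 12%:Z (fun m => (ordD d m)%:Z) (Dl d).
Proof.
move=> d6; split=> g Hg; first by have [E _ _] := Dl_slash d6 (Gamma0_SL Hg); apply: E.
by have [] := Dl_slash d6 Hg.
Qed.

Lemma Mf_DlV d : (d %| 6)%N -> Mf (- 12%:Z) (fun m => - (ordD d m)%:Z) (fun t => (Dl d t)^-1).
Proof.
move=> d6; split=> g Hg.
  have Sg := Gamma0_SL Hg; have [E _ _] := Dl_slash d6 Sg.
  by rewrite slashz_inv // E.
by rewrite slashz_inv //; have [] := Dl_slash d6 Hg.
Qed.

(* The eta quotient Delta_6^(-12), whose only pole is at the cusp oo. *)
Definition Q2V t := (Dl 1 t)^-1 * (Dl 6 t)^-1 ^+ 6 * (Dl 2 t ^+ 2 * Dl 3 t ^+ 3).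

Lemma Q2V_neq0 t : Q2V t != 0.
Proof. by apply: mulf_neq0; apply: mulf_neq0; rewrite ?expf_neq0 ?invr_neq0 ?Dl_neq0. Qed.

Definition i6 (n m : nat) : int := if m == 6 then n%:Z else 0.

Lemma dvd6_case (m : nat) : (m %| 6)%N -> [\/ m = 1%N, m = 2%N, m = 3%N | m = 6%N].
Proof.
move=> m6; have := dvdn_leq (ltn0Sn 5) m6.
by case: m m6 => [|[|[|[|[|[|[|m]]]]]]] // _ _; [constructor 1|constructor 2|constructor 3|constructor 4].
Qed.

(** The orders -[ordD 1] - 6 [ordD 6] + 2 [ordD 2] + 3 [ordD 3] cancel for m = 1, 2, 3, and for m =
    6 they give -6 - 216 + 24 + 54 = -144. *)
Lemma Mf_Q2V : Mf (- 24) (fun m => - i6 144 m) Q2V.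
Proof.
have := Mf_mul (Mf_mul (Mf_DlV (isT : (1 %| 6)%N)) (Mf_exp 6 (Mf_DlV (isT : (6 %| 6)%N))))
  (Mf_mul (Mf_exp 2 (Mf_Dl (isT : (2 %| 6)%N))) (Mf_exp 3 (Mf_Dl (isT : (3 %| 6)%N)))).
by apply: Mf_weak => m /dvd6_case[] ->.
Qed.

(** Subtracting the value at infinity leaves u of order 6 in q_6 there; u^24 makes up for the pole
    of order 144 of [Q2V], and the product has weight -24, hence vanishes. *)
Theorem weight0_const f : Mf 0 (fun=> 0) f -> exists c, forall t, f t = c.
Proof.
move=> Hf; have [If Lf] := Hf.
have /LO0[a] := Lf _ SL1; rewrite slashz1 => Ha.
exists (a 0%N); pose u t := f t + (- a 0%N).
have G0 g : SL2Z g -> cgcd g = 6%N -> Gamma0 6 g.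
  by move=> Sg /gcdn_idPr g6; split=> //; rewrite dvdzE.
have Hu : Mf 0 (i6 6) u.
  have [Iu Lu] := Mf_add Hf (Mf_cst (- a 0%N)); split=> // g Sg.
  rewrite /i6; case: eqP => [c6|_]; last exact: Lu.
  rewrite Iu; last exact: G0.
  have c0 : FX 6 (fun=> - a 0%N) (fun n => - a 0%N * cone R n).
    by apply: FX_ext (FX_scale _ (ltn0Sn 5) (FX_one R 6)) => t; rewrite mulr1.
  apply: (FX_LO (FX_add (ltn0Sn 5) Ha c0)) => -[|n] n6.
    by rewrite /cone mulr1 subrr.
  rewrite /cone mulr0 addr0; apply: (@FX_period R f a 6) => //.
    move=> t; have := slashz_period t If SL1; rewrite slashz1.
    by rewrite (_ : cgcd _ = 6%N) // /cgcd !mxE.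
  by apply: contraL n6 => /dvdn_leq n6; rewrite -leqNgt; apply: n6.
have := Mf_mul (Mf_exp 24 Hu) Mf_Q2V; rewrite mulr0 add0r => HQ.
have /negative_weight Z : Mf (- 24) (fun=> 0) (fun t => u t ^+ 24 * Q2V t).
  by apply: Mf_weak HQ => m /dvd6_case[] ->.
move=> t; have /eqP := Z t; rewrite mulf_eq0 (negPf (Q2V_neq0 t)) orbF expf_eq0 /=.
by rewrite subr_eq0 => /eqP.
Qed.

(** Constant term of [el d] at the cusp of gcd m, namely A / D = A^2 / d with A = gcd(d, m). *)
Definition kap (d m : nat) : C := (gcdn d m)%:R ^+ 2 / d%:R.

Lemma el_slash d g : (d %| 6)%N -> SL2Z g -> exists f,
  [/\ FC 6 (kap d (cgcd g)) f, Gamma0 6 g -> f = el d &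
    forall t, slashz 2%:Z g (el d) t = f t + 12 / c2 * ((g 1 0)%:~R / autj g t)].
Proof.
move=> d6 Sg; have [A [D [B [AE A0 AD HM]]]] := level_matrix d6 Sg.
have d0 : (0 < d)%N := dvdn_gt0 (ltn0Sn 5) d6.
have D6 : (D %| 6)%N by apply: dvdn_trans d6; rewrite -AD dvdn_mull.
have D0 : D%:R != 0 :> C by rewrite pnatr_eq0 -lt0n (dvdn_gt0 _ D6).
have A1 : A%:R != 0 :> C by rewrite pnatr_eq0 -lt0n.
exists (fun t => A%:R / D%:R * E2 ((A%:R * val t + B%:~R) / D%:R)); split.
- have -> : kap d (cgcd g) = A%:R / D%:R * s1 0.
    by rewrite s1_0 mulr1 /kap -AE -AD natrM; field; rewrite A1 D0.
  apply: FC_scale => //; apply: (tri_FC (B := B) A0 D6 tame_s1) => t.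
  by rewrite (E2_sig (tri_Im B A0 D6 t)).
- move=> Gg; have Ad : A = d by rewrite AE cgcd_Gamma0 //; apply/gcdn_idPl.
  have D1 : D = 1%N by apply/eqP; rewrite -(eqn_pmul2l A0) AD muln1 Ad.
  apply/funext => t; rewrite D1 Ad !divr1 /el (E2_int _ (_ : 0 < complex.Im (d%:R * val t))) //.
  exact: TT_rel (valP t) d0.
by move=> t; have [_ <-] := HM t; rewrite /slashz -exprnN mulrC.
Qed.

Definition comb (x1 x2 x3 x6 : C) : H -> C :=
  fun t => x1 * el 1 t + x2 * el 2 t + (x3 * el 3 t + x6 * el 6 t).

(** The four defects are equal, so coefficients of sum 0 cancel them. *)
Lemma comb_slash x1 x2 x3 x6 g : x1 + x2 + (x3 + x6) = 0 -> SL2Z g ->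
  (Gamma0 6 g -> slashz 2%:Z g (comb x1 x2 x3 x6) = comb x1 x2 x3 x6) /\
  FC 6 (x1 * kap 1 (cgcd g) + x2 * kap 2 (cgcd g) + (x3 * kap 3 (cgcd g) + x6 * kap 6 (cgcd g)))
    (slashz 2%:Z g (comb x1 x2 x3 x6)).
Proof.
move=> x0 Sg.
have [f1 [F1 G1 E1]] := el_slash (isT : (1 %| 6)%N) Sg.
have [f2 [F2 G2' E2']] := el_slash (isT : (2 %| 6)%N) Sg.
have [f3 [F3 G3 E3]] := el_slash (isT : (3 %| 6)%N) Sg.
have [f6 [F6 G6 E6]] := el_slash (isT : (6 %| 6)%N) Sg.
have E : slashz 2%:Z g (comb x1 x2 x3 x6) = fun t => x1 * f1 t + x2 * f2 t + (x3 * f3 t + x6 * f6 t).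
  apply/funext => t; move: (E1 t) (E2' t) (E3 t) (E6 t); rewrite /slashz /comb.
  move: (autj g t ^ _) (_ / _ * _) (el 1 _) (el 2 _) (el 3 _) (el 6 _) => j p y1 y2 y3 y6 h1 h2 h3 h6.
  have -> : j * (x1 * y1 + x2 * y2 + (x3 * y3 + x6 * y6)) =
    x1 * (j * y1) + x2 * (j * y2) + (x3 * (j * y3) + x6 * (j * y6)) by ring.
  rewrite h1 h2 h3 h6; have -> : x1 = - (x2 + (x3 + x6)) by rewrite -[RHS]add0r -x0; ring.
  by ring.
rewrite E; split.
  by move=> Gg; rewrite G1 // G2' // G3 // G6.
by do 2!(apply: FC_add => //); apply: FC_scale.
Qed.

Lemma Mf_comb x1 x2 x3 x6 : x1 + x2 + (x3 + x6) = 0 -> Mf 2%:Z (fun=> 0) (comb x1 x2 x3 x6).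
Proof.
move=> x0; split=> g Hg; first by have [E _] := comb_slash x0 (Gamma0_SL Hg); apply: E.
by have [_ [a Ha _]] := comb_slash x0 Hg; apply/LO0; exists a.
Qed.

Lemma FX_el d : (0 < d)%N -> FX 1 (el d) (fun n => d%:R * cdil d 1 s1 n).
Proof.
move=> d0; apply: FX_scale => //.
have E t : E2 (d%:R * val t) = psum s1 (1 * e (val t / 1%:R) ^+ d).
  by rewrite mul1r divr1 eX (E2_sig (TT_rel (valP t) d0)).
exact: (@FX_dil R 1 d 1 s1 _ (ltn0Sn 0) d0 (cabs1 R) tame_s1 E).
Qed.

Lemma FX_comb x1 x2 x3 x6 : FX 1 (comb x1 x2 x3 x6) (fun n =>
  x1 * (1%:R * cdil 1 1 s1 n) + x2 * (2%:R * cdil 2 1 s1 n) +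
  (x3 * (3%:R * cdil 3 1 s1 n) + x6 * (6%:R * cdil 6 1 s1 n))).
Proof. by do 2!(apply: FX_add => //); apply: FX_scale => //; apply: FX_el. Qed.

Lemma s1_1 : s1 1 = - 24.
Proof. by rewrite /s1 /sig /sig_to big_ord1 /dl /cone /= add0r mulr1. Qed.

End LevelForms.

(** * The forms of level 6 *)

Section Level6Forms.
Variable R : realType.
Local Notation C := (Cx R).
Local Notation H := (upper_half R).
Local Notation e := (@e2ipi R).
Implicit Types (t : H) (f : H -> C) (g : 'M[int]_2).

Lemma piC_neq0 : piC R != 0.
Proof. by have := twopii_neq0 R; rewrite mulf_eq0 negb_or => /andP[]. Qed.

Lemma w_const (x : C) : piC R ^- 2 * ((2 * iC R * piC R) ^+ 2 * x) = - 4 * x.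
Proof.
have p0 := piC_neq0; have i2 := iC2 R; move: (piC R) (iC R) p0 i2 => p i p0 i2.
have -> : p ^- 2 * ((2 * i * p) ^+ 2 * x) = 4 * i ^+ 2 * x by field.
by rewrite i2; ring.
Qed.

Lemma el1E t : el 1 t = E2 (val t).
Proof. by rewrite /el !mul1r. Qed.

Lemma E26_0_comb t : E26_0 t = comb (- 1) 1 0 0 t.
Proof.
rewrite /E26_0 /w (wp_2 (valP t)) -[_ * (1 / 12) * _]mulrA w_const /comb el1E /el.
by move: (E2 (2 * _)) (E2 (3 * _)) (E2 (6 * _)) (E2 (val t)) => x y z u; field.
Qed.

Lemma E26_1_comb t : E26_1 t = comb (- (1 / 24)) (1 / 12) (- (1 / 24)) 0 t.
Proof.
rewrite /E26_1 /w (wp_2 (valP t)) (wp_3 (valP t)) -[_ * (1 / 12) * _]mulrA -[_ * (1 / 24) * _]mulrA !w_const /comb el1E /el.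
by move: (E2 (2 * _)) (E2 (3 * _)) (E2 (6 * _)) (E2 (val t)) => x y z u; field.
Qed.

(** The only combination of the [el d] with coefficient sum 0 and expansion q^2 + O(q^3), hence the
    candidate for Delta_6. *)
Definition E26 : H -> C := comb 0 (- (1 / 48)) (1 / 36) (- (1 / 144)).

Lemma E26_sum0 : 0 + - (1 / 48) + (1 / 36 + - (1 / 144)) = 0 :> C.
Proof. by field. Qed.

Lemma E26_q2 : exists2 u, FC 1 1 u & forall t, E26 t = e (val t) ^+ 2 * u t.
Proof.
have Ha := FX_comb 0 (- (1 / 48)) (1 / 36) (- (1 / 144)) : FX 1 E26 _.
set a := (fun n : nat => _) in Ha.
have a0 n : (n < 2)%N -> a n = 0.
  case: n => [|[|n]] // _; rewrite /a /cdil /=; last by ring.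
  by rewrite !div0n s1_0; field.
exists (fun t => E26 t / e (val t / 1%:R) ^+ 2).
  exists (fun n => a (n + 2)%N); first exact: FX_shift Ha a0.
  by rewrite add0n /a /cdil /= (_ : (2 %/ 2)%N = 1%N) // s1_1; field.
by move=> t; rewrite divr1 mulrC divfK // expf_neq0 // e_neq0.
Qed.

Lemma FX16 f (a : nat -> C) : FX 1 f a -> FX 6 f (cdil 6 1 a).
Proof.
move=> [ta Ha]; have E t : f t = psum a (1 * e (val t / 6%:R) ^+ 6).
  by rewrite Ha mul1r divr1 eX; congr (psum a (e _)); field.
exact: (@FX_dil R 6 6 1 a f (ltn0Sn 5) (ltn0Sn 5) (cabs1 R) ta E).
Qed.

Lemma Gamma0_cgcd g : SL2Z g -> cgcd g = 6%N -> Gamma0 6 g.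
Proof. by move=> Sg /gcdn_idPr g6; split=> //; rewrite dvdzE. Qed.

Lemma Mf_E26 : Mf 2%:Z (i6 12) E26.
Proof.
have [IE LE] := Mf_comb E26_sum0; split=> // g Sg.
rewrite /i6; case: eqP => [c6|_]; last exact: LE.
rewrite IE; last exact: Gamma0_cgcd.
have [u [b Hb _] Eu] := E26_q2.
have L0 : LO 0 u by apply/LO0; exists (cdil 6 1 b); apply: FX16.
have Lq : LO 12%:Z (fun t : H => e (val t) ^+ 2).
  exists (cone R); apply: FX_ext (FX_one R 6) => t.
  rewrite mulNr eN -pmulrn eX (_ : 12%:R * (val t / 6%:R) = 2%:R * val t); last by field.
  by rewrite mulVf // e_neq0.
have := LO_mul Lq L0; rewrite addr0; apply: LO_ext => t; by rewrite -[RHS]/(E26 t) Eu.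
Qed.

Lemma ode_psum_inv (q : C) : cabs q < 1 ->
  psum (ode (fun k => - 1 * sig R k)) q * psum (ode (sig R)) q = 1.
Proof.
move=> q1; have ts := @tame_sig R; rewrite -psum_conv //; [|exact/tame_ode/tame_scale|exact: tame_ode].
rewrite conv_ode ?sig0 ?mulr0 //; transitivity (psum (cone R) q); last exact: psum_cone.
rewrite -(ode_scale0 (sig R)); congr (psum (ode _) _); apply/funext => n; ring.
Qed.

(** In x = e(t/24) the leading exponent is 2 + 72 - 8 - 18 = 48, that is q^2. *)
Lemma E26_2_q2 : exists2 u, FC 1 1 u & forall t, E26_2 t = e (val t) ^+ 2 * u t.
Proof.
pose P (d : nat) (t : H) := psum (ode (fun k => - 1 * sig R k)) (e (d%:R * val t)).
pose P' (d : nat) (t : H) := psum (ode (sig R)) (e (d%:R * val t)).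
have ts := @tame_sig R.
have HP d : (0 < d)%N -> FC 1 1 (P d).
  by move=> d0; apply: (@FC_dil R d (P d) (ode (fun k => - 1 * sig R k)) d0) => //; exact/tame_ode/tame_scale.
have HP' d : (0 < d)%N -> FC 1 1 (P' d).
  by move=> d0; apply: (@FC_dil R d (P' d) (ode (sig R)) d0) => //; exact: tame_ode.
have PV d t : (0 < d)%N -> (P d t)^-1 = P' d t.
  move=> d0; have E := ode_psum_inv (cabs_et_lt1 (TT_rel (valP t) d0)).
  have n0 : P d t != 0 by apply/eqP => z0; move: E; rewrite -/(P d t) z0 mul0r => /eqP; rewrite eq_sym oner_eq0.
  by apply: (mulfI n0); rewrite mulfV.
exists (fun t => P 1 t ^+ 2 * P 6 t ^+ 12 * (P' 2 t ^+ 4 * P' 3 t ^+ 6)).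
  have := FC_mul (ltn0Sn 0) (FC_mul (ltn0Sn 0) (FC_exp 2 (ltn0Sn 0) (HP 1 isT)) (FC_exp 12 (ltn0Sn 0) (HP 6 isT)))
    (FC_mul (ltn0Sn 0) (FC_exp 4 (ltn0Sn 0) (HP' 2 isT)) (FC_exp 6 (ltn0Sn 0) (HP' 3 isT))).
  by rewrite !expr1n !mulr1.
move=> t; pose x := e (val t / 24).
have HE d : (0 < d)%N -> Defs.eta (d%:R * val t) = x ^+ d * P d t.
  by move=> d0; rewrite (etaE (TT_rel (valP t) d0)) /x eX mulrA.
have x0 : x != 0 by apply: e_neq0.
have -> : e (val t) = x ^+ 24 by rewrite /x eX; congr e; field.
have n0 d : (0 < d)%N -> P d t != 0.
  move=> d0; apply/eqP => z0; have := ode_psum_inv (cabs_et_lt1 (TT_rel (valP t) d0)).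
  by rewrite -/(P d t) z0 mul0r => /eqP; rewrite eq_sym oner_eq0.
have H1 := HE 1%N isT; rewrite mul1r expr1 in H1.
rewrite /E26_2 H1 !HE // -(PV 2) // -(PV 3) //.
move: (n0 2%N isT) (n0 3%N isT) x0.
move: (P 1 t) (P 2 t) (P 3 t) (P 6 t) (x) => p1 p2 p3 p6 y n2 n3 y0.
by field; rewrite n2 n3 y0.
Qed.

Lemma Q2V_E26_2 t : E26_2 t ^+ 12 = (Q2V t)^-1.
Proof.
rewrite /E26_2 /Q2V /Dl mul1r -!eta24; try exact: (valP t); try exact: (TT_rel (valP t)).
have n0 d : (0 < d)%N -> Defs.eta (d%:R * val t) != 0.
  by move=> d0; apply: contra_neq (Dl_neq0 t d0) => z0; rewrite /Dl -eta24 ?z0 ?expr0n //; exact: (TT_rel (valP t)).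
move: (n0 1%N isT) (n0 2%N isT) (n0 3%N isT) (n0 6%N isT); rewrite mul1r.
move: (Defs.eta _) (Defs.eta _) (Defs.eta _) (Defs.eta _) => p1 p2 p3 p6 n1 n2 n3 n6.
by field; rewrite n1 n2 n3 n6.
Qed.

(** [E26] has order 12 in q_6 at infinity, so its twelfth power cancels the pole of [Q2V] and the
    quotient is constant. Both sides being q^2 times a series of constant term 1, [root_uniq] takes
    the twelfth root. *)
Theorem E26_2_E26 t : E26_2 t = E26 t.
Proof.
have HM : Mf 0 (fun=> 0) (fun t => E26 t ^+ 12 * Q2V t).
  by have := Mf_mul (Mf_exp 12 Mf_E26) (Mf_Q2V R); apply: Mf_weak => m /dvd6_case[] ->.
have [k Hk] := weight0_const HM.
have [u Hu Eu] := E26_q2; have [v Hv Ev] := E26_2_q2.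
suff uv : forall t, u t = v t by rewrite Eu Ev uv.
apply: (@root_uniq R 12 k) => // {}t.
have := Hk t; move=> /(congr1 ( *%R^~ (Q2V t)^-1)); rewrite mulfK ?Q2V_neq0 // -Q2V_E26_2 Eu Ev.
have n0 : (e (val t) ^+ 2) ^+ 12 != 0 by rewrite !expf_neq0 // e_neq0.
by move: (e _ ^+ 2) n0 => y n0; move=> E; apply: (mulfI n0); rewrite -exprMn E exprMn; ring.
Qed.

Lemma comb_kap x1 x2 x3 x6 m : (m %| 6)%N ->
  x1 * kap R 1 m + x2 * kap R 2 m + (x3 * kap R 3 m + x6 * kap R 6 m) =
  x1 + x2 * (gcdn 2 m)%:R ^+ 2 / 2 + (x3 * (gcdn 3 m)%:R ^+ 2 / 3 + x6 * m%:R ^+ 2 / 6).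
Proof.
by move=> m6; rewrite /kap gcd1n (gcdn_idPr m6) expr1n divr1 mulr1 !mulrA.
Qed.

(** At infinity every product vanishes by itself, as [E26_1] and [E26_2] do; -25, 540 and 864 are
    the solution of the three linear conditions at the other cusps. *)
Lemma F46_modular g : SL2Z g -> FC 6 0 (slashz 4%:Z g (F46_1 R)).
Proof.
move=> Sg.
have x0 : -1 + 1 + (0 + 0) = 0 :> C by rewrite addNr !addr0.
have y0 : - (1 / 24) + 1 / 12 + (- (1 / 24) + 0) = 0 :> C by field.
have [_ A0] := comb_slash x0 Sg; have [_ A1] := comb_slash y0 Sg.
have [_ A2] := comb_slash E26_sum0 Sg.
rewrite !(comb_kap _ _ _ _ (cgcd_dvd g)) in A0 A1 A2.
set a0 := (X in FC 6 X _) in A0; set a1 := (X in FC 6 X _) in A1; set a2 := (X in FC 6 X _) in A2.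
have H6 := ltn0Sn 5.
have := FC_add H6 (FC_add H6 (FC_add H6 (FC_mul H6 A0 A1) (FC_scale (- 25) H6 (FC_mul H6 A0 A2)))
  (FC_scale 540 H6 (FC_mul H6 A1 A2))) (FC_scale 864 H6 (FC_mul H6 A2 A2)).
have -> : a0 * a1 + - 25 * (a0 * a2) + 540 * (a1 * a2) + 864 * (a2 * a2) = 0.
  have G : (gcdn 2 1 = 1%N) * (gcdn 3 1 = 1%N) * (gcdn 2 2 = 2%N) * (gcdn 3 2 = 1%N) *
    (gcdn 2 3 = 1%N) * (gcdn 3 3 = 3%N) * (gcdn 2 6 = 2%N) * (gcdn 3 6 = 3%N) by [].
  by rewrite /a0 /a1 /a2; case: (dvd6_case (cgcd_dvd g)) => ->; rewrite !G; field.
apply: FC_ext => t; rewrite /F46_1 /E46_1 /E46_2 /E46_3 /E46_4 /slashz.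
rewrite E26_0_comb E26_1_comb E26_2_E26 /E26.
have -> : autj g t ^ (- 4%:Z) = autj g t ^ (- 2%:Z) * autj g t ^ (- 2%:Z) by rewrite -expfzDr ?autj_neq0.
move: (comb _ _ _ _ _) (comb _ _ _ _ _) (comb _ _ _ _ _) (autj g t ^ _) => p q r j; ring.
Qed.

Lemma Mf_F46_aux : (forall g, Gamma0 6 g -> slashz 4%:Z g (F46_1 R) = F46_1 R).
Proof.
move=> g Gg.
have x0 : -1 + 1 + (0 + 0) = 0 :> C by rewrite addNr !addr0.
have y0 : - (1 / 24) + 1 / 12 + (- (1 / 24) + 0) = 0 :> C by field.
have [A0 _] := Mf_comb x0; have [A1 _] := Mf_comb y0; have [A2 _] := Mf_comb E26_sum0.
apply/funext => t; have := congr1 (fun f => f t) (A0 g Gg); have := congr1 (fun f => f t) (A1 g Gg).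
have := congr1 (fun f => f t) (A2 g Gg).
rewrite /F46_1 /E46_1 /E46_2 /E46_3 /E46_4 /slashz.
rewrite !E26_0_comb !E26_1_comb !E26_2_E26 /E26.
have -> : autj g t ^ (- 4%:Z) = autj g t ^ (- 2%:Z) * autj g t ^ (- 2%:Z).
  by rewrite -expfzDr ?autj_neq0 //; apply: Gamma0_SL.
move=> <- <- <-.
move: (comb _ _ _ _ _) (comb _ _ _ _ _) (comb _ _ _ _ _) (autj g t ^ _) => p q r j; ring.
Qed.

Lemma F46_cusp : cusp_form 4 6 (F46_1 R).
Proof.
split.
  apply/modular_Mf; split=> [|g Sg]; first exact: Mf_F46_aux.
  by have [a Ha _] := F46_modular Sg; apply/LO0; exists a.
move=> g Sg; have [a Ha a0] := F46_modular Sg; exists a; split=> //.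
by rewrite -slashzE; apply: FX_FE.
Qed.

Lemma FC_e : FC 1 0 (fun t : H => e (val t)).
Proof.
exists (xm R 1) => //; split; first exact: tame_xm.
by move=> t; rewrite psum_xm divr1 expr1.
Qed.

Lemma E26_1_q : exists2 u, FC 1 1 u & forall t, E26_1 t = e (val t) * u t.
Proof.
have Ha := @FX_comb R (- (1 / 24)) (1 / 12) (- (1 / 24)) 0.
set a := (fun n : nat => _) in Ha.
have a0 n : (n < 1)%N -> a n = 0.
  by case: n => // _; rewrite /a /cdil /= !div0n s1_0; field.
exists (fun t => comb (- (1 / 24)) (1 / 12) (- (1 / 24)) 0 t / e (val t / 1%:R) ^+ 1).
  exists (fun n => a (n + 1)%N); first exact: FX_shift Ha a0.
  by rewrite add0n /a /cdil /= (_ : (1 %/ 1)%N = 1%N) // s1_1; field.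
by move=> t; rewrite divr1 expr1 mulrC divfK ?e_neq0 // E26_1_comb.
Qed.

Lemma E26_0_1 : FC 1 1 (@E26_0 R).
Proof.
have Ha := @FX_comb R (- 1) 1 0 0; set a := (fun n : nat => _) in Ha.
exists a; first by apply: FX_ext Ha => t; rewrite E26_0_comb.
by rewrite /a /cdil /= !div0n s1_0; ring.
Qed.

Lemma F46_q : exists2 u, FC 1 1 u & forall t, F46_1 R t = e (val t) * u t.
Proof.
have [u Hu Eu] := E26_1_q; have [v Hv Ev] := E26_2_q2; have H0 := E26_0_1; have He := FC_e.
exists (fun t => E26_0 t * u t + e (val t) * (- 25 * (E26_0 t * v t) +
   540 * (e (val t) * (u t * v t)) + 864 * (e (val t) ^+ 2 * (v t * v t)))).
  have H1 := ltn0Sn 0.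
  have := FC_add H1 (FC_mul H1 H0 Hu) (FC_mul H1 He (FC_add H1 (FC_add H1
    (FC_scale (- 25) H1 (FC_mul H1 H0 Hv)) (FC_scale 540 H1 (FC_mul H1 He (FC_mul H1 Hu Hv))))
    (FC_scale 864 H1 (FC_mul H1 (FC_exp 2 H1 He) (FC_mul H1 Hv Hv))))).
  by rewrite mul0r addr0 mulr1.
move=> t; rewrite /F46_1 /E46_1 /E46_2 /E46_3 /E46_4 Eu Ev.
move: (E26_0 t) (u t) (v t) (e _) => p q r x; ring.
Qed.

Lemma F46_unitary : unitary (F46_1 R).
Proof.
have [u [b Hb b0] Eu] := F46_q; exists (conv b (xm R 1)), 1%N; split.
- apply: FX_FE => //; apply: FX_ext (FX_mul _ Hb (_ : FX 1 (fun t => e (val t)) (xm R 1))) => // [t|].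
    by rewrite Eu mulrC.
  split; first exact: tame_xm.
  by move=> t; rewrite psum_xm divr1 expr1.
- by rewrite conv_xm.
by case=> // _; rewrite conv_xm.
Qed.

(** Twelfth power of (eta(t) eta(2t) eta(3t) eta(6t))^2. Its order in q_6 at the cusp of gcd m is
    exactly 12 m, the order guaranteed for F^12. *)
Definition PD t : C := Dl 1 t * Dl 2 t * (Dl 3 t * Dl 6 t).

Lemma PD_neq0 t : PD t != 0.
Proof. by apply: mulf_neq0; apply: mulf_neq0; apply: Dl_neq0. Qed.

Lemma Mf_F46_12 : Mf 0 (fun=> 0) (fun t => F46_1 R t ^+ 12 * (PD t)^-1).
Proof.
have D1 := Mf_DlV R (isT : (1 %| 6)%N); have D2 := Mf_DlV R (isT : (2 %| 6)%N).
have D3 := Mf_DlV R (isT : (3 %| 6)%N); have D6 := Mf_DlV R (isT : (6 %| 6)%N).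
have := Mf_mul (Mf_exp 12 (cusp_Mf F46_cusp)) (Mf_mul (Mf_mul D1 D2) (Mf_mul D3 D6)).
move=> HM; have {}HM : Mf 0 (fun=> 0) (fun t => F46_1 R t ^+ 12 *
  ((Dl 1 t)^-1 * (Dl 2 t)^-1 * ((Dl 3 t)^-1 * (Dl 6 t)^-1))).
  by apply: Mf_weak HM => m /dvd6_case[] ->.
apply: Mf_ext HM => t; rewrite /PD.
by move: (Dl 1 t) (Dl 2 t) (Dl 3 t) (Dl 6 t) => x1 x2 x3 x6; rewrite !invfM.
Qed.

Lemma F46_12 : exists2 k : C, k != 0 & forall t, F46_1 R t ^+ 12 = k * PD t.
Proof.
have [k Hk] := weight0_const Mf_F46_12.
have E t : F46_1 R t ^+ 12 = k * PD t by rewrite -(Hk t) divfK // PD_neq0.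
(* If k were 0, F would vanish, against its leading coefficient 1. *)
exists k => //; apply/eqP => k0.
have [u [b Hb b0] Eu] := F46_q.
have u0 t : u t = 0.
  have := E t; rewrite k0 mul0r Eu => /eqP; rewrite expf_eq0 /= mulf_eq0 (negPf (e_neq0 _)).
  by move=> /eqP.
by have /eqP := FX_eq0 (ltn0Sn 0) Hb u0 0%N; rewrite b0 oner_eq0.
Qed.

Lemma F46_neq0 t : F46_1 R t != 0.
Proof.
have [k k0 E] := F46_12; have : F46_1 R t ^+ 12 != 0 by rewrite E mulf_neq0 // PD_neq0.
by rewrite expf_eq0.
Qed.

(** f / F is rewritten as f F^11 / F^12, where F^12 = c [PD] has an inverse of known orders: they
    add up to m + 11 m - 12 m = 0. *)
Lemma cusp_div (k : nat) f : cusp_form (k + 4) 6 f -> modular_form k 6 (fun t => f t / F46_1 R t).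
Proof.
move=> Hf; apply/modular_Mf; have [c c0 E] := F46_12.
have D1 := Mf_DlV R (isT : (1 %| 6)%N); have D2 := Mf_DlV R (isT : (2 %| 6)%N).
have D3 := Mf_DlV R (isT : (3 %| 6)%N); have D6 := Mf_DlV R (isT : (6 %| 6)%N).
have := Mf_mul (Mf_mul (cusp_Mf Hf) (Mf_exp 11 (cusp_Mf F46_cusp))) (Mf_mul (Mf_mul D1 D2) (Mf_mul D3 D6)).
move=> /(Mf_scale c^-1); rewrite (_ : _ + _ = k%:Z); last by lia.
move=> HM; have := Mf_weak (M := fun=> 0) _ HM.
move=> /(_ _)/wrap[|{}HM]; first by move=> m /dvd6_case[] ->.
apply: Mf_ext HM => t.
have F0 := F46_neq0 t; have := E t; rewrite /PD; have P0 := fun d => @Dl_neq0 R d t.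
move: (P0 1%N isT) (P0 2%N isT) (P0 3%N isT) (P0 6%N isT) F0.
move: (F46_1 R t) (Dl 1 t) (Dl 2 t) (Dl 3 t) (Dl 6 t) => F x1 x2 x3 x6 n1 n2 n3 n6 F0 EF.
apply: (mulIf (expf_neq0 12 F0)); have -> : f t / F * F ^+ 12 = f t * F ^+ 11 by field.
rewrite EF.
by field; rewrite n1 n2 n3 n6 c0.
Qed.

Lemma cusp_mul (k : nat) f : modular_form k 6 f -> cusp_form (k + 4) 6 (F46_1 R \* f).
Proof.
move=> /modular_Mf Hf; apply: Mf_cusp; have := Mf_mul (cusp_Mf F46_cusp) Hf.
rewrite (_ : _ + _ = (k + 4)%N%:Z); last by lia.
by apply: Mf_weak => m _; rewrite addr0.
Qed.

Lemma F46_mul_lead f (v : nat) a : FX 1 f a -> (forall m, (m < v)%N -> a m = 0) ->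
  exists b, [/\ FX 1 (F46_1 R \* f) b, b v.+1 = a v & forall m, (m < v.+1)%N -> b m = 0].
Proof.
move=> Ha a0; have [u [b Hb b0] Eu] := F46_q.
have Hq : FX 1 (fun t : H => e (val t)) (xm R 1).
  by split; [exact: tame_xm|move=> t; rewrite psum_xm divr1 expr1].
exists (conv (conv b a) (xm R 1)); split.
- apply: FX_ext (FX_mul _ (FX_mul _ Hb Ha) Hq) => // t; rewrite /= Eu; ring.
- rewrite conv_xm subn1 /= /conv big_ord_recl /= b0 mul1r subn0 big1 ?addr0 // => i _.
  by rewrite a0 ?mulr0 // /bump /= add1n; have := ltn_ord i; lia.
move=> [|m] mv; rewrite conv_xm // subn1 /= /conv big1 // => i _.
by rewrite a0 ?mulr0 //; apply: leq_ltn_trans (leq_subr _ _) _.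
Qed.

End Level6Forms.

Theorem mainTheorem10 (R : realType) :
  [/\ has_dimension (@cusp_form R 4 6) 1,
      unitary (F46_1 R),
      is_basis (@cusp_form R 4 6) (fun _ : 'I_1 => F46_1 R) &
      forall (k n : nat) (b : 'I_n -> upper_half R -> Cx R),
        (2 <= k)%N ->
        is_basis (modular_form (2 * k - 4) 6) b ->
        unitary_upper_triangular b ->
        is_basis (cusp_form (2 * k) 6) (fun i => F46_1 R \* b i) /\
        unitary_upper_triangular (fun i => F46_1 R \* b i)].
Proof.
have B4 : is_basis (@cusp_form R 4 6) (fun _ : 'I_1 => F46_1 R).
  split=> [i|f Hf|c].
  - exact: F46_cusp.
  (* Division by F carries S_4 into M_0, which consists of constants. *)
  - have /(modular_Mf 0)/weight0_const[c Hc] := cusp_div (k := 0) Hf.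
    exists (fun=> c); rewrite big_ord1; apply/funext => t.
    by rewrite -[LHS](divfK (F46_neq0 t)) Hc.
  rewrite big_ord1 => E i; rewrite (ord1 i); have := congr1 (fun f => f (H_inhabited R)) E.
  by move=> /eqP; rewrite mulf_eq0 (negPf (F46_neq0 _)) orbF => /eqP.
split; [by exists (fun=> F46_1 R)|exact: F46_unitary|exact: B4|].
move=> k n b k2 [Sb Gb Ib] [Ub [v [Hv mv]]].
(* Subtraction in nat is truncated; 2 <= k makes this an equality. *)
have kE : (2 * k - 4 + 4)%N = (2 * k)%N by lia.
split; [split|split].
- by move=> i; rewrite -kE; apply: cusp_mul.
- move=> f; rewrite -kE => /cusp_div /Gb[c Hc]; exists c; apply/funext => t.
  rewrite -[LHS](divfK (F46_neq0 t)); have := congr1 (fun f => f t) Hc => /= ->.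
  rewrite !fct_sumE mulr_suml; apply: eq_bigr => i _ /=.
  by rewrite -[LHS]mulrA [_ * F46_1 R t]mulrC.
- move=> c E; apply: Ib; apply/funext => t.
  have := congr1 (fun f => f t) E; rewrite !fct_sumE => H.
  apply: (mulIf (F46_neq0 t)); rewrite mul0r -[RHS]H mulr_suml; apply: eq_bigr => i _ /=.
  by rewrite -[LHS]mulrA [_ * F46_1 R t]mulrC.
- move=> i; have [a [w [Ha aw a0]]] := Ub i.
  have [d [Hd dw d0]] := F46_mul_lead (FE_FX (ltn0Sn 0) Ha) a0.
  by exists d, w.+1; split; [exact: FX_FE (ltn0Sn 0) Hd|rewrite dw|exact: d0].
exists (fun i => (v i).+1); split; last by move=> i j ij; rewrite ltnS; apply: mv.
move=> i; have [a [Ha aw a0]] := Hv i.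
have [d [Hd dw d0]] := F46_mul_lead (FE_FX (ltn0Sn 0) Ha) a0.
by exists d; split; [exact: FX_FE (ltn0Sn 0) Hd|rewrite dw|exact: d0].
Qed.
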